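(* Let $\bm\lambda$ and $\bm\mu$ be horizontal-strips. If the weighted graphs $\Pi(\bm\lambda)$ and $\Pi(\bm\mu)$ are isomorphic, then $G_{\bm\lambda}(\bm x;q)=G_{\bm\mu}(\bm x;q)$.
   Context: A row is a set of cells $R=a/b=\{(1,j): b+1\le j\le a\}$ for integers $a\ge b\ge 0$; the content of the cell $(1,j)$ is $c((1,j))=j-1$. Write $l(R)=b$, $r(R)=a-1$, and $|R|$ for the number of cells; $R^+=(a+1)/(b+1)$ is the row shifted one cell to the right. For rows $R,R'$ put $M(R,R')=|R\cap R'|$ if $l(R)\le l(R')$ and $M(R,R')=|R\cap R'^+|$ if $l(R)>l(R')$. A horizontal-strip is a finite sequence of rows $\bm\lambda=(R_1,\dots,R_n)$. The weighted graph $\Pi(\bm\lambda)$ has vertices $1,\dots,n$, vertex $i$ of weight $|R_i|$, and for $i<j$ an edge between $i$ and $j$ of weight $M(R_i,R_j)$ (weight-zero edges omitted). For $\bm\mu=(S_1,\dots,S_m)$, $\Pi(\bm\lambda)\cong\Pi(\bm\mu)$ means $m=n$ and there is a permutation $\varphi$ of $\{1,\dots,n\}$ preserving vertex weights ($|R_i|=|S_{\varphi_i}|$) and edge weights. A semistandard filling of a row is a left-to-right weakly increasing map to $\{1,2,\dots\}$; $\mathrm{SSYT}_{\bm\lambda}$ is the set of tuples $\bm T=(T^{(1)},\dots,T^{(n)})$ with $T^{(i)}$ a semistandard filling of $R_i$. Two entries $T^{(i)}(u)$, $T^{(j)}(v)$ with $i<j$ form an inversion if either $c(u)=c(v)$ and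 $T^{(i)}(u)>T^{(j)}(v)$, or $c(u)=c(v)+1$ and $T^{(i)}(u)<T^{(j)}(v)$. The LLT polynomial is $G_{\bm\lambda}(\bm x;q)=\sum_{\bm T\in\mathrm{SSYT}_{\bm\lambda}}q^{\mathrm{inv}(\bm T)}\bm x^{\bm T}$, where $\mathrm{inv}(\bm T)$ is the number of inversions and $\bm x^{\bm T}=\prod_{k\ge1}x_k^{\#\{\text{entries of }\bm T\text{ equal to }k\}}$. *)

(* Defs.v *)
From HB Require Import structures.
From mathcomp Require Import all_boot ssralg ssrint poly.
From mathcomp Require Import finmap multiset.
From mathcomp Require Import boolp classical_sets functions cardinality fsbigop.

Set Implicit Arguments.
Unset Strict Implicit.
Unset Printing Implicit Defensive.

Import GRing.Theory.

Local Open Scope nat_scope.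

(* The row a/b is HRow a b _.  It is kept as the pair (a, b), so that
   l(R) = b also makes sense for the empty rows b/b. *)
Record hrow := HRow { hrow_a : nat; hrow_b : nat; _ : hrow_b <= hrow_a }.

Lemma hrow_leP (R : hrow) : hrow_b R <= hrow_a R.
Proof. by case: R. Qed.

(* The cell (1, j) is encoded by its column j >= 1. *)
Definition cell_seq (R : hrow) : seq nat := index_iota (hrow_b R).+1 (hrow_a R).+1.

Definition cells (R : hrow) : {fset nat} := [fset j in cell_seq R]%fset.

Definition content (j : nat) : nat := j.-1.

Definition hrow_l (R : hrow) : nat := hrow_b R.

Definition hrow_size (R : hrow) : nat := #|` cells R|.

Definition hrow_shift (R : hrow) : hrow :=
  @HRow (hrow_a R).+1 (hrow_b R).+1 (hrow_leP R).

Definition row_meet (R R' : hrow) : nat :=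
  if hrow_l R <= hrow_l R' then #|` (cells R `&` cells R')%fset|
  else #|` (cells R `&` cells (hrow_shift R'))%fset|.

Notation hstrip n := (n.-tuple hrow).

(* Weighted graphs on 'I_n; edge weight 0 means that there is no edge. *)
Record wgraph (n : nat) := WGraph {
  vweight : 'I_n -> nat;
  eweight : 'I_n -> 'I_n -> nat }.

Definition Pi (n : nat) (lam : hstrip n) : wgraph n := {|
  vweight := fun i => hrow_size (tnth lam i);
  eweight := fun i j =>
    if i < j then row_meet (tnth lam i) (tnth lam j)
    else if j < i then row_meet (tnth lam j) (tnth lam i)
    else 0 |}.

Definition wgraph_iso (n m : nat) (G : wgraph n) (H : wgraph m) : Prop :=
  exists phi : 'I_n -> 'I_m,
    [/\ bijective phi,
        forall i, vweight G i = vweight H (phi i)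
      & forall i j, eweight G i j = eweight H (phi i) (phi j)].

(* A filling of the row a/b lists its entries from left to right: the entry in
   column j is at position j - b - 1. *)
Notation filling n := (n.-tuple (seq nat)).

Definition entry (n : nat) (lam : hstrip n) (T : filling n) (i : 'I_n) (j : nat)
    : nat :=
  nth 0 (tnth T i) (j - (hrow_b (tnth lam i)).+1).

Definition semistandard (R : hrow) (t : seq nat) : bool :=
  [&& size t == hrow_size R, all (leq 1) t & sorted leq t].

Definition SSYT (n : nat) (lam : hstrip n) (T : filling n) : Prop :=
  forall i : 'I_n, semistandard (tnth lam i) (tnth T i).

Definition inversion (n : nat) (lam : hstrip n) (T : filling n) (i j : 'I_n)
    (u v : nat) : bool :=
  (content u == content v) && (entry lam T i u > entry lam T j v)
  || (content u == (content v).+1) && (entry lam T i u < entry lam T j v).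

Definition inversions (n : nat) (lam : hstrip n) (T : filling n) : nat :=
  \sum_(i < n) \sum_(j < n | i < j)
    \sum_(u <- cell_seq (tnth lam i)) \sum_(v <- cell_seq (tnth lam j))
      inversion lam T i j u v.

(* Formal power series in x_1, x_2, ... with coefficients in Z[q]: a monomial
   is the finitely supported function k |-> exponent of x_k, i.e. a multiset of
   indices; 'X : {poly int} is q. *)
Notation monomial := ({mset nat})%mset.
Notation qseries := (monomial -> {poly int}).

Definition filling_monomial (n : nat) (T : filling n) : monomial :=
  seq_mset (flatten T).

Local Open Scope ring_scope.
Local Open Scope classical_set_scope.

Definition LLT (n : nat) (lam : hstrip n) : qseries := fun alpha =>
  \sum_(T \in [set T : filling n | SSYT lam T /\ filling_monomial T = alpha])
    ('X^(inversions lam T) : {poly int}).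

(* \sum_(_ \in _) is 0 over an infinite support; the sums defining LLT are
   always finite. *)
Lemma finite_SSYT_monomial (n : nat) (lam : hstrip n) (alpha : monomial) :
  finite_set [set T : filling n | SSYT lam T /\ filling_monomial T = alpha].
Proof.
pose sh := map hrow_size lam.
pose f (s : seq nat) : filling n := insubd (nseq_tuple n [::]) (reshape sh s).
apply: (@sub_finite_set _ _ (f @` [set` permutations (enum_mset alpha)])).
  move=> T /= [sT eT]; exists (flatten T).
    rewrite /= mem_permutations -eT perm_sym.
    by apply: perm_trans (perm_eq_seq_mset _) _.
  have shT : sh = shape T.
    apply: (@eq_from_nth _ 0%N) => [|k].
      by rewrite !size_map !size_tuple.
    rewrite size_map size_tuple => kn.
    have /and3P[/eqP eqk _ _] := sT (Ordinal kn).
    rewrite (nth_map (tnth lam (Ordinal kn))) ?size_tuple//.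
    rewrite -[k]/(val (Ordinal kn)) -tnth_nth -eqk.
    by rewrite (nth_map [::]) ?size_tuple// (tnth_nth [::]).
  by rewrite /f shT flattenK; apply: val_inj; rewrite val_insubd size_tuple eqxx.
exact/finite_image/finite_seq.
Qed.

(* Main.v *)
(* A row of length s is an interval [L, L + s) of the real line, with cells at
   L, L + 1, ..., L + s - 1; giving the i-th row of a strip the starting point
   l(R_i) + i * eps, an inversion is a pair of cells at positions p < p' < p + 1
   such that the entry at p is larger.  Both the edge weights and the LLT
   polynomial only depend on the integers floor (L_i - L_j), that is, on the
   alcove of the affine arrangement x_i - x_j = k containing L.

   Crossing a wall leaves the polynomial unchanged if it does not change the
   weight of the pair (i, j); if the weight grows from m to m + 1, then
   G_new = q G_old + (1 - q) G_merged, where in G_merged the two rows are replaced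
   by their union and their intersection.  The weighted graph of the merged strip
   is determined by the old graph, and it has a larger sum of squared row
   lengths, so one can argue by induction on this sum.

   Two rows whose weight is not the maximal one, min(s_i, s_j), occur in a
   definite order, and the set of positions with a given graph and a given order
   of these pairs is convex; hence graph and order determine G.  To change the
   order, one reflects a set T of rows inside the window it spans, where every
   other row either covers this window (up to one unit) or avoids it.
   Contracting T to one end of the window while contracting the reflected
   configuration in parallel crosses corresponding walls, so this does not
   change G.  Finally, any two orders compatible with one graph are related by
   such reflections: as in Gallai's theory of transitive orientations, the pairs
   on which two orders disagree form no rainbow triangles with the remaining
   pairs, and this produces smaller windows to reflect. *)
Require Import Defs.
From mathcomp Require Import all_boot fingroup perm ssralg ssrnum ssrint order intdiv poly.
From mathcomp Require Import finmap multiset zify ring.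

Set Implicit Arguments.
Unset Strict Implicit.
Unset Printing Implicit Defensive.

Import GRing.Theory.

(** * Two rows at a wall *)

(** The wall identity reduces to two rows because no third row separates them at the wall: every
    other row sees the second row as the first one translated by an integer, so both carry the same
    weight in each column. With that weight left arbitrary, the identity is a column-by-column
    recursion on the last entries of the two rows.

    The obstacle is the order of the comparable pairs: single pairs cannot be reversed
    independently, so whole sets are reflected, and a set is admissible only if every outside row
    avoids or covers it. The sets used come from components of reordered pairs, enlarged by the rows
    incomparable to them that do not cover them.

    Infinitely many variables are avoided coefficientwise: a coefficient involves bounded entries
    only, and substituting sparse powers of one variable turns it into a coefficient of a polynomial
    over [Z[q]]; these polynomials form a domain, so [q] can be cancelled. *)

Section Transfer.
Variables (R : comNzRingType) (q : R).
Local Open Scope ring_scope.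

Lemma sum_sym (V V' : nat -> nat -> R) (t : nat) :
  (forall a, V a a = V' a a) ->
  (forall a b, V a b + V b a = V' a b + V' b a) ->
  \sum_(a < t) \sum_(b < t) V a b = \sum_(a < t) \sum_(b < t) V' a b.
Proof.
move=> hd hs; elim: t => [|t IH]; first by rewrite !big_ord0.
rewrite !big_ord_recr /= hd; under eq_bigr do rewrite big_ord_recr /=.
rewrite [in RHS](eq_bigr (fun a : 'I_t => \sum_(b < t) V' a b + V' a t)); last first.
  by move=> a _; rewrite big_ord_recr.
rewrite !big_split /= IH -!addrA; congr (_ + _).
rewrite !addrA; congr (_ + _).
by rewrite -!big_split /=; apply: eq_bigr => a _; rewrite hs.
Qed.

Definition sum_square (V : nat -> nat -> R) t := \sum_(0 <= a < t) \sum_(0 <= b < t) V a b.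
Definition sum_above (V : nat -> nat -> R) t t' := \sum_(0 <= a < t) \sum_(t <= b < t') V a b.
Definition sum_below (V : nat -> nat -> R) t t' := \sum_(t <= a < t') \sum_(0 <= b < t) V a b.

(* The invariant of the transfer through the columns common to two rows; it
   sums up the effect of exchanging the two rows inside maximal runs of columns
   where the exchange is forced to be simultaneous. *)
Definition balanced (X Y : nat -> nat -> R) :=
  [/\ forall a, X a a = Y a a,
      forall a b, X a b + X b a = Y a b + Y b a &
      forall a b, (a < b)%N -> Y a b = q * X a b].

Lemma balanced_sq X Y t : balanced X Y -> sum_square X t = sum_square Y t.
Proof.
case=> h1 h2 _; rewrite /sum_square big_mkord [RHS]big_mkord.
under eq_bigr do rewrite big_mkord; under [in RHS]eq_bigr do rewrite big_mkord.
exact: sum_sym.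
Qed.

Lemma balanced_up X Y t t' : balanced X Y -> sum_above Y t t' = q * sum_above X t t'.
Proof.
case=> _ _ h; rewrite /sum_above mulr_sumr; apply: eq_big_nat => a /andP[_ ha].
rewrite mulr_sumr; apply: eq_big_nat => b /andP[hb _].
by apply: h; apply: leq_trans hb.
Qed.

Lemma balanced_updn X Y t t' : balanced X Y -> sum_above X t t' + sum_below X t t' = sum_above Y t t' + sum_below Y t t'.
Proof.
case=> _ h _; rewrite /sum_above /sum_below.
rewrite [X in _ + X = _]exchange_big /= [X in _ = _ + X]exchange_big /=.
rewrite -!big_split /=; apply: eq_bigr => a _.
by rewrite -!big_split /=; apply: eq_bigr => b _.
Qed.

(* V a b stands for the weighted number of fillings of the columns treated so far
   that end in a (first row) and b (second row); a column with two cells is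
   appended.  In X the second row is a little to the right of the first one, in
   Y a little to the left. *)
Definition stepX (w : nat -> R) (V : nat -> nat -> R) a' b' :=
  w a' * w b' * q ^+ (b' < a')%N *
  \sum_(0 <= a < a'.+1) \sum_(0 <= b < b'.+1) V a b * q ^+ (a' < b)%N.
Definition stepY (w : nat -> R) (V : nat -> nat -> R) a' b' :=
  w a' * w b' * q ^+ (a' < b')%N *
  \sum_(0 <= a < a'.+1) \sum_(0 <= b < b'.+1) V a b * q ^+ (b' < a)%N.

Lemma rowX_ge V a' b' : (b' <= a')%N ->
  \sum_(0 <= a < a'.+1) \sum_(0 <= b < b'.+1) V a b * q ^+ (a' < b)%N =
  sum_square V b'.+1 + sum_below V b'.+1 a'.+1.
Proof.
move=> h; rewrite (@big_cat_nat _ _ _ b'.+1) //=; congr (_ + _);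
 apply: eq_bigr => a _; apply: eq_big_nat => b hb;
 by rewrite (_ : (a' < b)%N = false) ?mulr1 //; lia.
Qed.

Lemma rowX_lt V a' b' : (a' <= b')%N ->
  \sum_(0 <= a < a'.+1) \sum_(0 <= b < b'.+1) V a b * q ^+ (a' < b)%N =
  sum_square V a'.+1 + q * sum_above V a'.+1 b'.+1.
Proof.
move=> h; rewrite /sum_square /sum_above mulr_sumr -big_split; apply: eq_bigr => a _.
rewrite (@big_cat_nat _ _ _ a'.+1) //=; congr (_ + _).
  by apply: eq_big_nat => b hb; rewrite (_ : (a' < b)%N = false) ?mulr1 //; lia.
rewrite mulr_sumr; apply: eq_big_nat => b hb.
by rewrite (_ : (a' < b)%N = true) ?expr1 1?mulrC //; lia.
Qed.

Lemma rowY_le V a' b' : (a' <= b')%N ->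
  \sum_(0 <= a < a'.+1) \sum_(0 <= b < b'.+1) V a b * q ^+ (b' < a)%N =
  sum_square V a'.+1 + sum_above V a'.+1 b'.+1.
Proof.
move=> h; rewrite /sum_square /sum_above -big_split; apply: eq_big_nat => a ha.
rewrite (_ : (b' < a)%N = false) ?expr0; last lia.
under eq_bigr do rewrite mulr1.
by rewrite (@big_cat_nat _ _ _ a'.+1).
Qed.

Lemma rowY_ge V a' b' : (b' <= a')%N ->
  \sum_(0 <= a < a'.+1) \sum_(0 <= b < b'.+1) V a b * q ^+ (b' < a)%N =
  sum_square V b'.+1 + q * sum_below V b'.+1 a'.+1.
Proof.
move=> h; rewrite (@big_cat_nat _ _ _ b'.+1) //=; congr (_ + _).
  apply: eq_big_nat => a ha; apply: eq_bigr => b _.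
  by rewrite (_ : (b' < a)%N = false) ?mulr1 //; lia.
rewrite mulr_sumr; apply: eq_big_nat => a ha; rewrite mulr_sumr; apply: eq_bigr => b _.
by rewrite (_ : (b' < a)%N = true) ?expr1 1?mulrC //; lia.
Qed.

(** Splitting the ranges at the smaller of the two new entries leaves only [sum_square], [sum_above]
    and [sum_below]. Balance relates these sums for [X] and [Y], and the conditions on the new pair
    follow by linear algebra. *)
Lemma balanced_step w X Y : balanced X Y -> balanced (stepX w X) (stepY w Y).
Proof.
move=> hb.
have key a b : (a < b)%N -> stepY w Y a b = q * stepX w X a b /\
   stepX w X a b + stepX w X b a = stepY w Y a b + stepY w Y b a.
  move=> ab; rewrite /stepX /stepY.
  rewrite ab (_ : (b < a)%N = false) ?expr0 ?expr1 ?mulr1; last lia.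
  rewrite (rowX_lt X (ltnW ab)) (rowX_ge X (ltnW ab)).
  rewrite (rowY_le Y (ltnW ab)) (rowY_ge Y (ltnW ab)).
  have e1 := balanced_sq a.+1 hb.
  have e2 := balanced_up a.+1 b.+1 hb.
  have e3 : sum_below X a.+1 b.+1 = sum_above Y a.+1 b.+1 + sum_below Y a.+1 b.+1 - sum_above X a.+1 b.+1.
    by rewrite -(balanced_updn _ _ hb) [RHS]addrC addKr.
  by rewrite e1 e3 e2; split; ring.
split.
- move=> a; rewrite /stepX /stepY ltnn (rowX_ge X (leqnn a)) (rowY_ge Y (leqnn a)).
  rewrite (balanced_sq _ hb) /sum_below !(big_geq (leqnn _)).
  by rewrite mulr0.
- move=> a b; case: (ltngtP a b) => [ab|ab|->].
  + by case: (key a b ab).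
  + by rewrite addrC (proj2 (key b a ab)) addrC.
  + rewrite /stepX /stepY ltnn (rowX_ge X (leqnn b)) (rowY_ge Y (leqnn b)).
    by rewrite (balanced_sq _ hb) /sum_below !(big_geq (leqnn _)) mulr0.
- by move=> a b /key [].
Qed.

(** The first row continues alone past the last common column. Its new entry [t] may form an
    inversion with the last cell of the second row in [X], but never in [Y]; the invariant absorbs
    the factor. *)
Lemma balanced_endA X Y t N : balanced X Y -> (t < N)%N ->
  \sum_(0 <= a < t.+1) \sum_(0 <= b < N) X a b * q ^+ (t < b)%N =
  \sum_(0 <= a < t.+1) \sum_(0 <= b < N) Y a b.
Proof.
move=> hb; case: N => // N tN.
rewrite rowX_lt; last lia.
rewrite (balanced_sq _ hb) -(balanced_up _ _ hb) /sum_square /sum_above -big_split; apply: eq_bigr => a _.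
rewrite [RHS](@big_cat_nat _ _ _ t.+1) //=.
Qed.

(** Here the second row continues alone. The last sum is the one of [balanced_endA]: it gives the
    extra cell to the first row instead, which is how the merged pair enters. *)
Lemma balanced_endB X Y t N : balanced X Y -> (t < N)%N ->
  \sum_(0 <= a < N) \sum_(0 <= b < t.+1) Y a b * q ^+ (t < a)%N =
  q * (\sum_(0 <= a < N) \sum_(0 <= b < t.+1) X a b) +
  (1 - q) * \sum_(0 <= a < t.+1) \sum_(0 <= b < N) X a b * q ^+ (t < b)%N.
Proof.
move=> hb; case: N => // N tN.
rewrite rowY_ge; last lia. rewrite rowX_lt; last lia.
have -> : \sum_(0 <= a < N.+1) \sum_(0 <= b < t.+1) X a b = sum_square X t.+1 + sum_below X t.+1 N.+1.
  by rewrite (@big_cat_nat _ _ _ t.+1).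
rewrite -(balanced_sq _ hb).
have -> : sum_below X t.+1 N.+1 = sum_above Y t.+1 N.+1 + sum_below Y t.+1 N.+1 - sum_above X t.+1 N.+1.
    by rewrite -(balanced_updn _ _ hb) [RHS]addrC addKr.
rewrite (balanced_up _ _ hb); ring.
Qed.

End Transfer.

(** * Weakly increasing rows with bounded entries *)

Section Rows.
Variable vmax : nat.

(** Cells are appended on the right, the direction of the transfer. Entries are at least 1, so the
    default [last 0] of the empty row imposes no condition on the first entry. *)
Fixpoint rows m : seq (seq nat) :=
  if m is m'.+1 then
    [seq rcons r v | r <- rows m', v <- [seq v <- index_iota 1 vmax.+1 | last 0 r <= v]]
  else [:: [::]].

Lemma big_rowsS (R : nmodType) m (G : seq nat -> R) :
  (\sum_(A <- rows m.+1) G A =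
   \sum_(A <- rows m) \sum_(1 <= v < vmax.+1 | (last 0%N A <= v)%N) G (rcons A v))%R.
Proof. by rewrite /= big_allpairs_dep; under eq_bigr do rewrite big_filter. Qed.

Lemma mem_rows m r :
  (r \in rows m) = [&& size r == m, all (fun v => 1 <= v <= vmax) r & sorted leq r].
Proof.
elim: m r => [|m IH] r.
  by rewrite inE; case: r => [|x r] //=; rewrite andbF.
apply/allpairsPdep/idP => [[r' [v [+ + ->]]]|].
  rewrite IH mem_filter mem_index_iota size_rcons all_rcons.
  case/and3P=> /eqP <- h1 h2 /andP[h3 h4].
  rewrite eqxx h1 /= andbT; apply/andP; split; first lia.
  case: r' h1 h2 h3 => //= x r' _ h2 h3.
  by rewrite rcons_path h2.
case/lastP: r => [//|r v]; rewrite size_rcons all_rcons eqSS.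
case/and3P=> h1 /andP[h2 h3] h4; exists r, v; split => //.
  rewrite IH h1 h3 /=; case: r h4 {h1 h3} => //= x r.
  by rewrite rcons_path => /andP[].
rewrite mem_filter mem_index_iota; case: r h4 {h1 h3} => [|x r] /=; first lia.
by rewrite rcons_path => /andP[_ ->]; lia.
Qed.

Lemma uniq_rows m : uniq (rows m).
Proof.
elim: m => //= m IH; apply: allpairs_uniq_dep => //.
  by move=> r _; rewrite filter_uniq // iota_uniq.
by move=> [r v] [r' v'] _ _ /= /rcons_inj [-> ->].
Qed.

Lemma size_row m r : r \in rows m -> size r = m.
Proof. by rewrite mem_rows => /andP[/eqP]. Qed.

Lemma last_row m r : r \in rows m -> last 0 r < vmax.+1.
Proof.
rewrite mem_rows => /and3P[_ /allP h _]; case/lastP: r h => [//|r v] h.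
by rewrite last_rcons; have := h v; rewrite mem_rcons inE eqxx => /(_ isT); lia.
Qed.

End Rows.

(* The inversions between two rows, the second one starting k columns after the
   first one, and a little later (X) or a little earlier (Y) than this. *)
Definition pairX k (A B : seq nat) :=
  \sum_(u < size A) \sum_(v < size B)
    ((((u : nat) == k + v) && (nth 0 B v < nth 0 A u)) + (((u : nat) == (k + v).+1) && (nth 0 A u < nth 0 B v))).
Definition pairY k (A B : seq nat) :=
  \sum_(u < size A) \sum_(v < size B)
    (((u.+1 == k + v) && (nth 0 B v < nth 0 A u)) + (((u : nat) == k + v) && (nth 0 A u < nth 0 B v))).

Lemma sum_rconsA (P : nat -> nat -> nat -> nat -> nat) A B a :
  \sum_(u < size (rcons A a)) \sum_(v < size B) P u v (nth 0 (rcons A a) u) (nth 0 B v) =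
  \sum_(u < size A) \sum_(v < size B) P u v (nth 0 A u) (nth 0 B v) +
  \sum_(v < size B) P (size A) v a (nth 0 B v).
Proof.
rewrite size_rcons big_ord_recr /= nth_rcons ltnn eqxx; congr (_ + _).
by apply: eq_bigr => u _; apply: eq_bigr => v _; rewrite nth_rcons ltn_ord.
Qed.

Lemma sum_rconsB (P : nat -> nat -> nat -> nat -> nat) A B b :
  \sum_(u < size A) \sum_(v < size (rcons B b)) P u v (nth 0 A u) (nth 0 (rcons B b) v) =
  \sum_(u < size A) \sum_(v < size B) P u v (nth 0 A u) (nth 0 B v) +
  \sum_(u < size A) P u (size B) (nth 0 A u) b.
Proof.
rewrite -big_split; apply: eq_bigr => u _.
rewrite size_rcons big_ord_recr /= nth_rcons ltnn eqxx; congr (_ + _).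
by apply: eq_bigr => v _; rewrite nth_rcons ltn_ord.
Qed.

(** An appended cell has at most one cell of the other row at the relevant distance, namely its last
    one. The condition on [P 0] makes an empty row contribute nothing. *)
Lemma sum_last (c P : nat -> bool) B :
  (forall v, v.+1 < size B -> c v = false) -> (forall v, size B = v.+1 -> c v) ->
  P 0 = false ->
  \sum_(v < size B) (c v && P (nth 0 B v)) = P (last 0 B) :> nat.
Proof.
move=> h1 h2 h3; case/lastP: B h1 h2 => [|B b] h1 h2; first by rewrite big_ord0 h3.
rewrite last_rcons; move: h1 h2; rewrite size_rcons => h1 h2.
rewrite big_ord_recr /= h2 // nth_rcons ltnn eqxx big1 // => v _.
by rewrite h1 ?ltnS ?ltn_ord.
Qed.

Lemma sum_false m (F : 'I_m -> bool) : (forall v, F v = false) -> \sum_(v < m) F v = 0 :> nat.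
Proof. by move=> h; rewrite big1 // => v _; rewrite h. Qed.

Ltac no_hit := let v := fresh "v" in
  move=> v; have := ltn_ord v; move: (nat_of_ord v) => {}v ?; apply/negP => /andP[/eqP ? ?]; lia.

Lemma pairX_A k A B a : k + size B <= size A ->
  pairX k (rcons A a) B = pairX k A B + (size A == k + size B) * (a < last 0 B).
Proof.
move=> h; rewrite /pairX (sum_rconsA (fun u v x y => ((u == k + v) && (y < x)) + ((u == (k + v).+1) && (x < y)))).
congr (_ + _); rewrite big_split /= sum_false ?add0n; last by no_hit.
case: eqP => hs; last by rewrite mul0n sum_false //; no_hit.
rewrite mul1n; apply: (@sum_last (fun v => size A == (k + v).+1) (fun y => a < y)) => // v hv; lia.
Qed.

Lemma pairY_A k A B a : k + size B <= size A ->
  pairY k (rcons A a) B = pairY k A B.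
Proof.
move=> h; rewrite /pairY (sum_rconsA (fun u v x y => ((u.+1 == k + v) && (y < x)) + ((u == k + v) && (x < y)))).
rewrite -[RHS]addn0; congr (_ + _); rewrite big_split /= !sum_false //; no_hit.
Qed.

Lemma pairX_B k A B b : size A <= k + size B ->
  pairX k A (rcons B b) = pairX k A B.
Proof.
move=> h; rewrite /pairX (sum_rconsB (fun u v x y => ((u == k + v) && (y < x)) + ((u == (k + v).+1) && (x < y)))).
rewrite -[RHS]addn0; congr (_ + _); rewrite big_split /= !sum_false //; no_hit.
Qed.

Lemma pairY_B k A B b : size A <= k + size B ->
  pairY k A (rcons B b) = pairY k A B + (size A == k + size B) * (b < last 0 A).
Proof.
move=> h; rewrite /pairY (sum_rconsB (fun u v x y => ((u.+1 == k + v) && (y < x)) + ((u == k + v) && (x < y)))).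
congr (_ + _); rewrite big_split /= [X in _ + X = _]sum_false ?addn0; last by no_hit.
case: eqP => hs; last by rewrite mul0n sum_false //; no_hit.
rewrite mul1n; apply: (@sum_last (fun u => u.+1 == k + size B) (fun y => b < y)) => // v hv; lia.
Qed.

Lemma pairX_AB k A B a b : size A = k + size B ->
  pairX k (rcons A a) (rcons B b) = pairX k A B + ((b < a) + (a < last 0 B)).
Proof.
move=> h; rewrite /pairX (sum_rconsB (fun u v x y => ((u == k + v) && (y < x)) + ((u == (k + v).+1) && (x < y)))).
rewrite -/(pairX k (rcons A a) B) pairX_A; last (by rewrite h); rewrite (introT eqP h) mul1n -addnA; congr (_ + _).
rewrite addnC; congr (_ + _); rewrite size_rcons big_ord_recr /= h eqxx nth_rcons h ltnn eqxx /=.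
rewrite (_ : (k + size B == (k + size B).+1) = false); last lia.
rewrite addn0 big_split /= !sum_false //; no_hit.
Qed.

Lemma pairY_AB k A B a b : size A = k + size B ->
  pairY k (rcons A a) (rcons B b) = pairY k A B + ((a < b) + (b < last 0 A)).
Proof.
move=> h; rewrite /pairY (sum_rconsA (fun u v x y => ((u.+1 == k + v) && (y < x)) + ((u == k + v) && (x < y)))).
rewrite -/(pairY k A (rcons B b)) pairY_B; last (by rewrite h); rewrite (introT eqP h) mul1n -addnA; congr (_ + _).
rewrite addnC; congr (_ + _); rewrite size_rcons big_ord_recr /= h nth_rcons ltnn eqxx /=.
rewrite (_ : ((k + size B).+1 == (k + size B)) = false); last lia.
rewrite eqxx /= add0n big_split /= !sum_false //; no_hit.
Qed.

(** * Weighted sums over two rows, column by column *)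

Section Pair.
Variables (R : comNzRingType) (q : R) (vmax k : nat) (al : nat -> nat -> R).
Local Notation rows := (rows vmax).
Local Open Scope ring_scope.

Lemma big_rowsS_last m a (G : seq nat -> R) :
  \sum_(A <- rows m.+1 | last 0%N A == a) G A =
  (\sum_(A <- rows m | (last 0%N A < a.+1)%N) G (rcons A a)) *+ (1 <= a <= vmax)%N.
Proof.
rewrite -sumrMnl [LHS]big_mkcond [RHS]big_mkcond big_rowsS; apply: eq_bigr => A _.
under eq_bigr do rewrite last_rcons.
rewrite -big_mkcondr /= big_mkcond /=.
case: (boolP (1 <= a <= vmax)%N) => [ha|ha]; last first.
  rewrite if_same big1_seq // => v /andP[_]; rewrite mem_index_iota => hv.
  by case: ifP => // /andP[_ /eqP]; lia.
rewrite (bigD1_seq a) ?iota_uniq ?mem_index_iota //= eqxx andbT ltnS big1 ?addr0 //.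
by move=> v /negPf ->; rewrite andbF.
Qed.

Lemma sum_last_lt m t (G : seq nat -> R) :
  \sum_(A <- rows m | (last 0%N A < t)%N) G A =
  \sum_(0 <= a < t) \sum_(A <- rows m | last 0%N A == a) G A.
Proof.
under [RHS]eq_bigr do rewrite big_mkcond.
rewrite exchange_big /= big_mkcond; apply: eq_bigr => A _.
rewrite -big_mkcond /=; case: ltnP => h.
  rewrite (eq_bigl (fun a => a == last 0%N A)); last by move=> a; rewrite eq_sym.
  by rewrite big_nat1_eq h.
by rewrite big_nat_cond big1 // => a /andP[ha /eqP hb]; lia.
Qed.

Lemma sum_last_all m (G : seq nat -> R) :
  \sum_(A <- rows m) G A =
  \sum_(0 <= a < vmax.+1) \sum_(A <- rows m | last 0%N A == a) G A.
Proof.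
rewrite -sum_last_lt big_seq [RHS]big_seq_cond; apply: eq_bigl => A.
by case: (boolP (A \in rows m)) => // /last_row ->.
Qed.

(** [al x v] is the weight of an entry [v] in column [x], later filled with the contribution of the
    other rows; [c] is the column where the row starts. *)
Definition wrow c (A : seq nat) : R := \prod_(u < size A) al (c + u)%N (nth 0%N A u).

Lemma wrow_rcons c A a : wrow c (rcons A a) = wrow c A * al (c + size A)%N a.
Proof.
rewrite /wrow size_rcons big_ord_recr /= nth_rcons ltnn eqxx; congr (_ * _).
by apply: eq_bigr => u _; rewrite nth_rcons ltn_ord.
Qed.

Definition wX A B := wrow 0 A * wrow k B * q ^+ pairX k A B.
Definition wY A B := wrow 0 A * wrow k B * q ^+ pairY k A B.

Definition part (w : seq nat -> seq nat -> R) m m' a b :=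
  \sum_(A <- rows m | last 0%N A == a) \sum_(B <- rows m' | last 0%N B == b) w A B.

Lemma sum_part w m m' t t' (g : nat -> nat -> R) :
  \sum_(A <- rows m | (last 0%N A < t)%N) \sum_(B <- rows m' | (last 0%N B < t')%N)
     w A B * g (last 0%N A) (last 0%N B) =
  \sum_(0 <= a < t) \sum_(0 <= b < t') part w m m' a b * g a b.
Proof.
rewrite sum_last_lt; apply: eq_bigr => a _.
under eq_bigr do rewrite sum_last_lt.
rewrite exchange_big /=; apply: eq_bigr => b _.
rewrite /part mulr_suml; apply: eq_bigr => A /eqP ha.
by rewrite mulr_suml; apply: eq_bigr => B /eqP hb; rewrite ha hb.
Qed.

Let wal x v := al x v *+ (1 <= v <= vmax)%N.

(** [e] collects the weight of the two new cells and [g] their interaction with the previous last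
    entries. The boolean multiplicities make the formula valid for entries out of range, where both
    sides vanish. *)
Lemma step_gen (w w' : seq nat -> seq nat -> R) m d e (g : nat -> nat -> R) a b :
  (forall A B, A \in rows m -> B \in rows d ->
     w' (rcons A a) (rcons B b) = e * (w A B * g (last 0%N A) (last 0%N B))) ->
  part w' m.+1 d.+1 a b =
  e *+ (1 <= a <= vmax)%N *+ (1 <= b <= vmax)%N *
  \sum_(0 <= a0 < a.+1) \sum_(0 <= b0 < b.+1) part w m d a0 b0 * g a0 b0.
Proof.
move=> h; rewrite -sum_part mulrnAl mulrnAl mulr_sumr /part big_rowsS_last.
case: (1 <= a <= vmax)%N; last by rewrite !mulr0n mul0rn.
rewrite !mulr1n -[RHS]sumrMnl big_seq_cond [RHS]big_seq_cond.
apply: eq_bigr => A /andP[hA _].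
rewrite big_rowsS_last mulr_sumr; congr (_ *+ _).
rewrite big_seq_cond [RHS]big_seq_cond.
by apply: eq_bigr => B /andP[hB _]; exact: h.
Qed.

Lemma step_A (w w' : seq nat -> seq nat -> R) m d e (g : nat -> nat -> R) a :
  (forall A B, A \in rows m -> B \in rows d ->
     w' (rcons A a) B = e * (w A B * g (last 0%N A) (last 0%N B))) ->
  \sum_(0 <= b < vmax.+1) part w' m.+1 d a b =
  e *+ (1 <= a <= vmax)%N *
  \sum_(0 <= a0 < a.+1) \sum_(0 <= b0 < vmax.+1) part w m d a0 b0 * g a0 b0.
Proof.
move=> h; rewrite -sum_part mulrnAl mulr_sumr /part exchange_big /=.
rewrite big_rowsS_last; congr (_ *+ _).
rewrite big_seq_cond [RHS]big_seq_cond.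
apply: eq_bigr => A /andP[hA _]; rewrite -sum_last_all mulr_sumr.
rewrite big_seq [RHS]big_seq_cond.
apply: eq_big => [B|B hB]; first by case: (boolP (B \in rows d)) => // /last_row ->.
exact: h.
Qed.

Lemma step_B (w w' : seq nat -> seq nat -> R) m d e (g : nat -> nat -> R) b :
  (forall A B, A \in rows m -> B \in rows d ->
     w' A (rcons B b) = e * (w A B * g (last 0%N A) (last 0%N B))) ->
  \sum_(0 <= a < vmax.+1) part w' m d.+1 a b =
  e *+ (1 <= b <= vmax)%N *
  \sum_(0 <= a0 < vmax.+1) \sum_(0 <= b0 < b.+1) part w m d a0 b0 * g a0 b0.
Proof.
move=> h; rewrite -sum_part mulrnAl mulr_sumr /part -sum_last_all -sumrMnl.
rewrite big_seq [RHS]big_seq_cond.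
apply: eq_big => [A|A hA]; first by case: (boolP (A \in rows m)) => // /last_row ->.
rewrite big_rowsS_last mulr_sumr; congr (_ *+ _).
rewrite big_seq_cond [RHS]big_seq_cond.
by apply: eq_bigr => B /andP[hB _]; exact: h.
Qed.

Lemma partX_step d a b :
  part wX (k + d.+1) d.+1 a b = stepX q (wal (k + d)) (part wX (k + d) d) a b.
Proof.
rewrite /stepX addnS.
rewrite (@step_gen wX wX _ _ (al (k + d)%N a * al (k + d)%N b * q ^+ (b < a)%N)
  (fun a0 b0 => q ^+ (a < b0)%N)).
  congr (_ * _); rewrite /wal.
  by case: (1 <= a <= vmax)%N; case: (1 <= b <= vmax)%N; rewrite ?mulr1n ?mulr0n ?mul0r ?mulr0 ?mul0r.
move=> A B /size_row hA /size_row hB.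
rewrite /wX !wrow_rcons pairX_AB ?hA ?hB // !exprD add0n; ring.
Qed.

Lemma partY_step d a b :
  part wY (k + d.+1) d.+1 a b = stepY q (wal (k + d)) (part wY (k + d) d) a b.
Proof.
rewrite /stepY addnS.
rewrite (@step_gen wY wY _ _ (al (k + d)%N a * al (k + d)%N b * q ^+ (a < b)%N)
  (fun a0 b0 => q ^+ (b < a0)%N)).
  congr (_ * _); rewrite /wal.
  by case: (1 <= a <= vmax)%N; case: (1 <= b <= vmax)%N; rewrite ?mulr1n ?mulr0n ?mul0r ?mulr0 ?mul0r.
move=> A B /size_row hA /size_row hB.
rewrite /wY !wrow_rcons pairY_AB ?hA ?hB // !exprD add0n; ring.
Qed.

(** Before the first common column the second row is empty, so its last entry is the default 0 and
    no pair [a < b] contributes; each common column is then one [balanced_step]. *)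
Lemma balanced_part d : balanced q (part wX (k + d) d) (part wY (k + d) d).
Proof.
elim: d => [|d IH].
  have h0 A : pairX k A [::] = 0%N /\ pairY k A [::] = 0%N.
    by split; rewrite /pairX /pairY big1 // => u _; rewrite big_ord0.
  have e a b : part wX (k + 0) 0 a b = part wY (k + 0) 0 a b.
    rewrite /part; apply: eq_bigr => A _; rewrite !big_cons !big_nil /=.
    by rewrite /wX /wY (proj1 (h0 A)) (proj2 (h0 A)).
  split=> [a|a b|a b ab]; rewrite -?e //.
  rewrite /part !big1 ?mulr0 // => A _; rewrite big_cons big_nil /=;
  by rewrite (_ : (0 == b)%N = false) //; lia.
have [h1 h2 h3] := balanced_step (wal (k + d)) IH.
by split=> *; rewrite !partX_step !partY_step; [apply: h1|apply: h2|apply: h3].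
Qed.

Lemma wX_A A B a : (k + size B < size A)%N ->
  wX (rcons A a) B = al (size A) a * wX A B.
Proof.
move=> h; rewrite /wX wrow_rcons pairX_A; last lia.
by rewrite (_ : (_ == _) = false) ?mul0n ?addn0 ?add0n; [ring | lia].
Qed.
Lemma wY_A A B a : (k + size B <= size A)%N ->
  wY (rcons A a) B = al (size A) a * wY A B.
Proof. by move=> h; rewrite /wY wrow_rcons pairY_A // add0n; ring. Qed.
Lemma wX_B A B b : (size A <= k + size B)%N ->
  wX A (rcons B b) = al (k + size B) b * wX A B.
Proof. by move=> h; rewrite /wX wrow_rcons pairX_B //; ring. Qed.
Lemma wY_B A B b : (size A < k + size B)%N ->
  wY A (rcons B b) = al (k + size B) b * wY A B.
Proof.
move=> h; rewrite /wY wrow_rcons pairY_B; last lia.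
by rewrite (_ : (_ == _) = false) ?mul0n ?addn0; [ring | lia].
Qed.

Local Notation N := vmax.+1.
Let one (a b : nat) : R := 1.

Let mul_one (w : seq nat -> seq nat -> R) m d t t' :
  \sum_(0 <= a0 < t) \sum_(0 <= b0 < t') part w m d a0 b0 * one a0 b0 =
  \sum_(0 <= a0 < t) \sum_(0 <= b0 < t') part w m d a0 b0.
Proof. by apply: eq_bigr => a _; apply: eq_bigr => b _; rewrite mulr1. Qed.

(** The first cell beyond the common columns is [balanced_endA]; later cells are too far from the
    second row to interact with it. *)
Lemma nested_last d e a :
  \sum_(0 <= b < N) part wX (k + d + e.+1) d a b =
  \sum_(0 <= b < N) part wY (k + d + e.+1) d a b.
Proof.
elim: e a => [|e IH] a; rewrite !(addnS (k + d)).
  rewrite addn0 (@step_A wX wX _ _ (al (k + d) a) (fun a0 b0 => q ^+ (a < b0)%N)); last first.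
    move=> A B /size_row hA /size_row hB.
    rewrite /wX wrow_rcons pairX_A ?hA ?hB // eqxx mul1n exprD add0n; ring.
  rewrite (@step_A wY wY _ _ (al (k + d) a) one) ?mul_one; last first.
    by move=> A B /size_row hA /size_row hB; rewrite wY_A ?hA ?hB // mulr1.
  case: (boolP (1 <= a <= vmax)%N) => [ha|_]; last by rewrite mulr0n !mul0r.
  congr (_ * _); apply: balanced_endA (balanced_part d) _; lia.
rewrite (@step_A wX wX _ _ (al (k + d + e.+1) a) one) ?mul_one; last first.
  by move=> A B /size_row hA /size_row hB; rewrite wX_A ?hA ?hB ?mulr1 ?addnS //; lia.
rewrite (@step_A wY wY _ _ (al (k + d + e.+1) a) one) ?mul_one; last first.
  by move=> A B /size_row hA /size_row hB; rewrite wY_A ?hA ?hB ?mulr1 ?addnS //; lia.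
by congr (_ * _); apply: eq_bigr => a0 _; rewrite -!(addnS (k + d)) IH.
Qed.

Definition total (w : seq nat -> seq nat -> R) m m' := \sum_(A <- rows m) \sum_(B <- rows m') w A B.

Lemma total_part w m m' : total w m m' = \sum_(0 <= a < N) \sum_(0 <= b < N) part w m m' a b.
Proof.
rewrite /total sum_last_all; apply: eq_bigr => a _.
rewrite /part [RHS]exchange_big /=; apply: eq_bigr => A _; exact: sum_last_all.
Qed.

Lemma total_nested m d : (k + d <= m)%N -> total wX m d = total wY m d.
Proof.
move=> h; rewrite !total_part; case: (ltngtP (k + d) m) h => // [h _|<- _]; last first.
  exact: balanced_sq (balanced_part d).
have -> : m = (k + d + (m - (k + d)).-1.+1)%N by lia.
by apply: eq_bigr => a _; exact: nested_last.
Qed.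

(** The first extra cell of the second row is [balanced_endB]. In the merged term the first row has
    the union of the columns, of length [k + d + e.+1], and the second their intersection, of length
    [d]; hence the last entry [b] now belongs to the first row. *)
Lemma overlap_last d e b :
  \sum_(0 <= a < N) part wY (k + d) (d + e.+1) a b =
  q * (\sum_(0 <= a < N) part wX (k + d) (d + e.+1) a b) +
  (1 - q) * \sum_(0 <= b0 < N) part wX (k + d + e.+1) d b b0.
Proof.
elim: e b => [|e IH] b; rewrite !(addnS (k + d)) !(addnS d).
  rewrite !addn0 (@step_A wX wX _ _ (al (k + d) b) (fun a0 b0 => q ^+ (b < b0)%N)); last first.
    move=> A B /size_row hA /size_row hB.
    rewrite /wX wrow_rcons pairX_A ?hA ?hB // eqxx mul1n exprD add0n; ring.
  rewrite (@step_B wX wX _ _ (al (k + d) b) one) ?mul_one; last first.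
    by move=> A B /size_row hA /size_row hB; rewrite wX_B ?hA ?hB // mulr1.
  rewrite (@step_B wY wY _ _ (al (k + d) b) (fun a0 b0 => q ^+ (b < a0)%N)); last first.
    move=> A B /size_row hA /size_row hB.
    rewrite /wY wrow_rcons pairY_B ?hA ?hB // eqxx mul1n exprD; ring.
  case: (boolP (1 <= b <= vmax)%N) => [hb|_]; last by rewrite mulr0n !mul0r !mulr0 addr0.
  rewrite mulr1n (balanced_endB (N := N) (t := b) (balanced_part d)); last lia.
  by ring.
rewrite (@step_A wX wX _ _ (al (k + d + e.+1) b) one) ?mul_one; last first.
  by move=> A B /size_row hA /size_row hB; rewrite wX_A ?hA ?hB ?mulr1 ?addnS //; lia.
rewrite (@step_B wX wX _ _ (al (k + d + e.+1) b) one) ?mul_one; last first.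
  by move=> A B /size_row hA /size_row hB; rewrite wX_B ?hA ?hB ?mulr1; last lia; congr (al _ _ * _); lia.
rewrite (@step_B wY wY _ _ (al (k + d + e.+1) b) one) ?mul_one; last first.
  by move=> A B /size_row hA /size_row hB; rewrite wY_B ?hA ?hB ?mulr1; last lia; congr (al _ _ * _); lia.
rewrite exchange_big /= [X in q * (_ * X)]exchange_big /=.
rewrite -!(addnS (k + d)) -!(addnS d); under eq_bigr do rewrite IH.
by rewrite big_split /= -!mulr_sumr; ring.
Qed.

Lemma total_overlap m m' : (k <= m < k + m')%N ->
  total wY m m' = q * total wX m m' + (1 - q) * total wX (k + m') (m - k).
Proof.
move=> h; rewrite !total_part.
have -> : m = (k + (m - k))%N by lia.
have -> : m' = ((m - k) + (k + m' - m).-1.+1)%N by lia.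
move: (m - k)%N (k + m' - m).-1 => d e; rewrite addKn addnA.
rewrite exchange_big /= [X in q * X]exchange_big /=.
under eq_bigr do rewrite overlap_last.
by rewrite big_split /= -!mulr_sumr.
Qed.

End Pair.

(** * Generating functions of fillings *)

Section Poly.
Variables (R : comNzRingType) (q : R) (vmax smax : nat) (y : nat -> R) (n : nat).
Local Notation rows := (rows vmax).

(** Rows of bounded length and entries form a finite type, and the lengths are imposed by a
    predicate; so the rows of a strip and those of its merged strips live in one type. *)
Definition allrows := flatten [seq rows m | m <- iota 0 smax.+1].
Definition frow := seq_sub allrows.

Lemma mem_allrows m r : m <= smax -> r \in rows m -> r \in allrows.
Proof.
by move=> h hr; apply/flatten_mapP; exists m => //; rewrite mem_iota; lia.
Qed.

Lemma allrows_sub r : r \in allrows -> r \in rows (size r).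
Proof. by case/flatten_mapP => m _ h; rewrite (size_row h). Qed.

Lemma big_frow m (G : seq nat -> R) : m <= smax ->
  (\sum_(w : frow | size (val w) == m) G (val w) = \sum_(r <- rows m) G r)%R.
Proof.
move=> h; rewrite -(big_map val (fun r => size r == m) G) -big_filter.
apply: perm_big; apply: uniq_perm; rewrite ?uniq_rows //.
  by rewrite filter_uniq // map_inj_uniq ?index_enum_uniq //; exact: val_inj.
move=> r; rewrite mem_filter; apply/andP/idP => [[/eqP <- /mapP [w _ ->]]|hr].
  exact: allrows_sub (valP w).
split; first by rewrite (size_row hr).
apply/mapP; exists (SeqSub (mem_allrows h hr)) => //; exact: mem_index_enum.
Qed.

Lemma nil_allrows : [::] \in allrows.
Proof. exact: (mem_allrows (m := 0)). Qed.
Definition w0 : frow := SeqSub nil_allrows.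

(* Inversions between rows A and B when c is the rounded down distance from the
   start of A to the start of B. *)
Definition inter (c : int) (A B : seq nat) : nat :=
  \sum_(u < size A) \sum_(v < size B)
     ((c + v%:Z - u%:Z == 0)%R && (nth 0 B v < nth 0 A u)).

(** [f b a] stands for the floor of the start of row [b] minus the start of row [a]; at this stage
    any array of integers is allowed. *)
Definition ninv (f : 'I_n -> 'I_n -> int) (t : 'I_n -> seq nat) : nat :=
  \sum_a \sum_b inter (f b a) (t a) (t b).

Definition upd (t : 'I_n -> seq nat) i A := fun h => if h == i then A else t h.

(** The inversions that an entry [a], placed in row [i] at distance [x] from its start, forms with
    the rows of [t]. *)
Definition ginv f (t : 'I_n -> seq nat) i (x : int) (a : nat) : nat :=
  \sum_h \sum_(w < size (t h))
   (((f h i + w%:Z - x == 0)%R && (nth 0 (t h) w < a)) +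
    ((f i h + x - w%:Z == 0)%R && (a < nth 0 (t h) w))).

Lemma inter_nilr c A : inter c A [::] = 0.
Proof. by rewrite /inter big1 // => u _; rewrite big_ord0. Qed.
Lemma inter_nill c A : inter c [::] A = 0.
Proof. by rewrite /inter big_ord0. Qed.

Lemma inter_self A : inter 0 A A = 0.
Proof.
rewrite /inter big1 // => u _; rewrite big1 // => v _.
case: eqP => // e; rewrite (_ : nat_of_ord v = u) ?ltnn //; lia.
Qed.

Lemma inv_upd f t i A : f i i = 0%R -> t i = [::] ->
  ninv f (upd t i A) = ninv f t + \sum_h (inter (f h i) A (t h) + inter (f i h) (t h) A).
Proof.
move=> fii ti; rewrite /ninv (bigD1 i) //= [X in _ = X + _](bigD1 i) //=.
rewrite (eq_bigr (fun h => inter (f h i) A (upd t i A h))); last by move=> h _; rewrite /upd eqxx.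
rewrite (bigD1 i) //= {1}/upd eqxx fii inter_self add0n.
rewrite ti [X in _ = X + _ + _]big1 ?add0n; last by move=> h _; rewrite inter_nill.
rewrite (eq_bigr (fun h => inter (f h i) A (t h))); last by move=> h /negPf hi; rewrite /upd hi.
rewrite [X in _ = _ + X](bigD1 i) //= ti inter_nilr inter_nill !add0n.
rewrite [X in _ = _ + X]big_split /= [RHS]addnCA; congr (_ + _).
rewrite -big_split /=; apply: eq_bigr => h /negPf hi.
rewrite (bigD1 i) //= {1 2}/upd hi eqxx addnC [X in _ = X + _](bigD1 i) //= ti inter_nilr add0n.
by congr (_ + _); apply: eq_bigr => h1 /negPf h1i; rewrite /upd hi h1i.
Qed.

Lemma ginvE f t i A :
  \sum_h (inter (f h i) A (t h) + inter (f i h) (t h) A) =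
  \sum_(u < size A) ginv f t i u (nth 0 A u).
Proof.
rewrite /ginv exchange_big /=; apply: eq_bigr => h _.
rewrite {2}/inter exchange_big -big_split /=; apply: eq_bigr => u _.
by rewrite -big_split /=; apply: eq_bigr => w _.
Qed.

Definition wt f (t : 'I_n -> seq nat) : R :=
  ((\prod_h \prod_(u < size (t h)) y (nth 0 (t h) u)) * q ^+ ninv f t)%R.

Definition llt_sum (s : 'I_n -> nat) f : R :=
  (\sum_(T : {ffun 'I_n -> frow} | [forall h, size (val (T h)) == s h])
     wt f (fun h => val (T h)))%R.

Lemma wt_ext f t t' : t =1 t' -> wt f t = wt f t'.
Proof.
move=> e; rewrite /wt /ninv; congr (_ * _ ^+ _)%R.
  by apply: eq_bigr => h _; rewrite e.
by apply: eq_bigr => a _; apply: eq_bigr => b _; rewrite !e.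
Qed.

Definition alpha f t i (x v : nat) : R := (y v * q ^+ ginv f t i x%:Z v)%R.

Lemma wt_upd f t i A : f i i = 0%R -> t i = [::] ->
  (wt f (upd t i A) = wt f t * wrow (alpha f t i) 0 A)%R.
Proof.
move=> fii ti; rewrite /wt inv_upd // ginvE exprD.
have e : upd t i A i = A by rewrite /upd eqxx.
rewrite (bigD1 i) //= [in RHS](bigD1 i) //= e ti big_ord0 mul1r.
rewrite (eq_bigr (fun h => (\prod_(u < size (t h)) y (nth 0 (t h) u))%R)); last first.
  by move=> h /negPf hi; rewrite /upd hi.
have -> : (wrow (alpha f t i) 0 A = (\prod_(u < size A) y (nth 0%N A u)) *
   q ^+ (\sum_(u < size A) ginv f t i u (nth 0%N A u)))%R.
  rewrite /wrow /alpha big_split /=; congr (_ * _)%R.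
  by rewrite (big_morph _ (exprD q) (expr0 q)); apply: eq_bigr => u _; rewrite add0n.
by set a := (\prod_(i0 | _) _)%R; rewrite /=; ring.
Qed.

(** Fubini for one row: the outer sum runs over fillings whose row [i] is blanked by the placeholder
    [w0]. *)
Lemma F_split1 (P : 'I_n -> pred frow) (G : {ffun 'I_n -> frow} -> R) i :
  (\sum_(T : {ffun 'I_n -> frow} | [forall h, P h (T h)]) G T =
   \sum_(T : {ffun 'I_n -> frow} | [forall h, if h == i then T h == w0 else P h (T h)])
     \sum_(w | P i w) G [ffun h => if h == i then w else T h])%R.
Proof.
rewrite pair_big_dep /=.
rewrite (reindex_onto
  (fun T : {ffun 'I_n -> frow} => ([ffun h => if h == i then w0 else T h], T i))
  (fun p => [ffun h => if h == i then p.2 else p.1 h])) /=.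
  apply: eq_big => [T|T _]; last first.
    by congr G; apply/ffunP => h; rewrite !ffunE; case: eqP => [->|].
  symmetry; apply/andP/forallP => [[/andP[/forallP h1 h2] _] h|hT].
    have := h1 h; rewrite ffunE; case: eqP => [->|] //.
  split; last by apply/eqP/ffunP => h; rewrite !ffunE; case: eqP => [->|].
  by rewrite hT andbT; apply/forallP => h; rewrite ffunE; case: eqP.
move=> [T w] /andP[/forallP h1 h2] /=; congr pair; last by rewrite ffunE eqxx.
by apply/ffunP => h; have := h1 h; rewrite !ffunE; case: eqP => // _ /eqP.
Qed.

Definition rest (s : 'I_n -> nat) i j (T : {ffun 'I_n -> frow}) :=
  [forall h, if (h == i) || (h == j) then T h == w0 else size (val (T h)) == s h].

(** By the last hypothesis the other rows see row [j] as row [i] moved by [k], so the weights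
    [alpha f t i] serve both rows, with offset [k] for row [j]. This is the form studied in
    [total]. *)
Lemma F_split s f i j (k : nat) : i != j -> s i <= smax -> s j <= smax ->
  (forall h, f h h = 0%R) ->
  (forall h, h != i -> h != j -> f h j = (f h i - k%:Z)%R /\ f j h = (f i h + k%:Z)%R) ->
  (llt_sum s f = \sum_(T | rest s i j T) (let t h := val (T h) in wt f t *
    \sum_(A <- rows (s i)) \sum_(B <- rows (s j))
      wrow (alpha f t i) 0 A * wrow (alpha f t i) k B *
      q ^+ (inter (f j i) A B + inter (f i j) B A)))%R.
Proof.
move=> ij si sj fh hf; rewrite /llt_sum.
rewrite (F_split1 (fun h w => size (val w) == s h) _ i).
rewrite (F_split1 (fun h w => if h == i then w == w0 else size (val w) == s h) _ j); apply: eq_big => [T|T].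
  apply: eq_forallb => h; case: (altP (h =P j)) => [->|]; first by rewrite orbT.
  by rewrite orbF.
move=> /forallP hT; rewrite (negPf (contra_neq esym ij)) /=.
set t := fun h => val (T h).
have ti : t i = [::] by have := hT i; rewrite (negPf ij) eqxx /t => /eqP ->.
have tj : t j = [::] by have := hT j; rewrite eqxx /t => /eqP ->.
rewrite exchange_big /=.
transitivity (\sum_(wA : frow | size (val wA) == s i) \sum_(wB : frow | size (val wB) == s j)
   wt f (upd (upd t i (val wA)) j (val wB)))%R.
  apply: eq_bigr => wA _; apply: eq_bigr => wB _; apply: wt_ext => h.
  rewrite !ffunE /upd /t; case: (altP (h =P i)) => [->|hi]; first by rewrite (negPf ij).
  by case: eqP.
rewrite (big_frow (fun A => \sum_(wB : frow | size (val wB) == s j) wt f (upd (upd t i A) j (val wB)))%R) //.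
rewrite mulr_sumr; apply: eq_bigr => A _.
rewrite (big_frow (fun B => wt f (upd (upd t i A) j B))) // mulr_sumr.
apply: eq_bigr => B _.
rewrite wt_upd //; last by rewrite /upd eq_sym (negPf ij).
rewrite wt_upd // -!mulrA; congr (_ * (_ * _))%R.
rewrite /wrow /alpha !big_split /= -!mulrA; congr (_ * _)%R.
rewrite -!(big_morph _ (exprD q) (expr0 q)) -exprD; congr (_ * (_ * _ ^+ _))%R.

have -> : inter (f j i) A B + inter (f i j) B A =
  \sum_(v < size B) \sum_(w < size A)
   (((f i j + w%:Z - v%:Z == 0)%R && (nth 0 A w < nth 0 B v)) +
    ((f j i + v%:Z - w%:Z == 0)%R && (nth 0 B v < nth 0 A w))).
  rewrite addnC /inter [X in _ + X]exchange_big -big_split /=.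
  by apply: eq_bigr => v _; rewrite -big_split.
rewrite -big_split /=; apply: eq_bigr => v _.
have e : upd t i A i = A by rewrite /upd eqxx.
rewrite /ginv add0n (bigD1 i) //= e [X in _ = X + _](bigD1 i) //= ti big_ord0 add0n [RHS]addnC.
congr (_ + _); apply: eq_bigr => h hi; rewrite /upd (negPf hi).
have [->|hj] := eqVneq h j; first by rewrite tj !big_ord0.
have [-> ->] := hf h hi hj.
apply: eq_bigr => w _.
have -> : (f h i - k%:Z + w%:Z - v%:Z = f h i + w%:Z - (k + v)%:Z)%R by lia.
by have -> : (f i h + k%:Z + v%:Z - w%:Z = f i h + (k + v)%:Z - w%:Z)%R by lia.
Qed.

Lemma interX k A B (c d : int) : c = Posz k -> d = (- 1 - k%:Z)%R ->
  inter c A B + inter d B A = pairX k A B.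
Proof.
move=> -> ->; rewrite /inter [X in _ + X]exchange_big -big_split /=.
apply: eq_bigr => u _; rewrite -big_split /=; apply: eq_bigr => v _.
by congr ((_ && _) + (_ && _)); apply/eqP/eqP; lia.
Qed.

Lemma interY k A B (c d : int) : c = (k%:Z - 1)%R -> d = (- k%:Z)%R ->
  inter c A B + inter d B A = pairY k A B.
Proof.
move=> -> ->; rewrite /inter [X in _ + X]exchange_big -big_split /=.
apply: eq_bigr => u _; rewrite -big_split /=; apply: eq_bigr => v _.
by congr ((_ && _) + (_ && _)); apply/eqP/eqP; lia.
Qed.

(* In g the start of row j is less than k after the start of row i, in f it is more. *)
Record wall (f g : 'I_n -> 'I_n -> int) (i j : 'I_n) (k : int) : Prop := Wall {
  wall_neq : i != j;
  wall_f : f j i = k;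
  wall_f' : f i j = (- 1 - k)%R;
  wall_g : g j i = (k - 1)%R;
  wall_g' : g i j = (- k)%R;
  wall_fd : forall h, f h h = 0%R;
  wall_eq : forall a b, ~~ [&& a == i & b == j] -> ~~ [&& a == j & b == i] -> f a b = g a b;
  wall_col : forall h, h != i -> h != j -> f h j = (f h i - k)%R /\ f j h = (f i h + k)%R }.

(** The two-row identities have a natural number as offset; a negative [k] is treated by exchanging
    the rows and the sides of the wall. *)
Lemma wall_sym f g i j k : wall f g i j k -> wall g f j i (- k)%R.
Proof.
case=> ij h1 h2 h3 h4 hd he hc; split; rewrite ?h1 ?h2 ?h3 ?h4 //; try lia.
- by rewrite eq_sym.
- by move=> h; rewrite -he //; apply/negP => /andP[/eqP -> /eqP e]; move: ij; rewrite e eqxx.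
- by move=> a b *; rewrite he.
move=> h hj hi; have [e1 e2] := hc h hi hj.
rewrite -!he ?(negPf hi) ?(negPf hj) ?andbF // e1 e2; lia.
Qed.

Lemma wall_gd f g i j k : wall f g i j k -> forall h, g h h = 0%R.
Proof. by move/wall_sym/wall_fd. Qed.

Lemma rest_g_eq f g i j k s T : wall f g i j k -> rest s i j T ->
  wt f (fun h => val (T h)) = wt g (fun h => val (T h)).
Proof.
move=> w /forallP hT; rewrite /wt /ninv; congr (_ * _ ^+ _)%R.
apply: eq_bigr => a _; apply: eq_bigr => b _.
have [/andP[/eqP eb _]|hn] := boolP [&& b == i & a == j].
  by have := hT b; rewrite eb eqxx /= => /eqP ->; rewrite !inter_nilr.
have [/andP[/eqP eb _]|hn'] := boolP [&& b == j & a == i].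
  by have := hT b; rewrite eb eqxx orbT => /eqP ->; rewrite !inter_nilr.
by rewrite (wall_eq w).
Qed.

Lemma rest_alpha_eq f g i j k s T : wall f g i j k -> rest s i j T ->
  forall x v, alpha f (fun h => val (T h)) i x v = alpha g (fun h => val (T h)) i x v.
Proof.
move=> w /forallP hT x v; rewrite /alpha /ginv; congr (_ * _ ^+ _)%R.
apply: eq_bigr => h _; have [e|hj] := eqVneq h j.
  by have := hT h; rewrite e eqxx orbT => /eqP ->; rewrite !big_ord0.
have ij := wall_neq w; have ji : j != i by rewrite eq_sym.
by rewrite !(wall_eq w) // ?(negPf hj) ?(negPf ij) ?(negPf ji) ?andbF.
Qed.

Lemma wrow_ext al al' c A : (forall x v, al x v = al' x v) -> wrow al c A = wrow al' c A :> R.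
Proof. by move=> e; rewrite /wrow; apply: eq_bigr => u _; rewrite e. Qed.

Lemma F_wallX s f g i j (k : nat) : wall f g i j k -> s i <= smax -> s j <= smax ->
  (llt_sum s f = \sum_(T | rest s i j T) wt f (fun h => val (T h)) *
    total vmax (wX q k (alpha f (fun h => val (T h)) i)) (s i) (s j))%R.
Proof.
move=> w si sj; rewrite (F_split (k := k) (wall_neq w)) //; first last.
- exact: wall_col w.
- exact: wall_fd w.
apply: eq_bigr => T hT /=; congr (_ * _)%R; apply: eq_bigr => A _; apply: eq_bigr => B _.
by rewrite (interX A B (wall_f w) (wall_f' w)).
Qed.

Lemma F_wallY s f g i j (k : nat) : wall f g i j k -> s i <= smax -> s j <= smax ->
  (llt_sum s g = \sum_(T | rest s i j T) wt f (fun h => val (T h)) *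
    total vmax (wY q k (alpha f (fun h => val (T h)) i)) (s i) (s j))%R.
Proof.
move=> w si sj; rewrite (F_split (k := k) (wall_neq w)) //; first last.
- move=> h hi hj; have [e1 e2] := wall_col w hi hj.
  by rewrite -!(wall_eq w) ?(negPf hi) ?(negPf hj) ?andbF.
- exact: wall_gd w.
apply: eq_bigr => T hT /=; rewrite (rest_g_eq w hT); congr (_ * _)%R; apply: eq_bigr => A _; apply: eq_bigr => B _.
rewrite (interY A B (wall_g w) (wall_g' w)) /wY.
by congr (_ * _ * _)%R; apply: wrow_ext => x v; rewrite (rest_alpha_eq w hT).
Qed.

Lemma F_nested s f g i j (k : nat) : wall f g i j k -> s i <= smax ->
  k + s j <= s i -> llt_sum s f = llt_sum s g.
Proof.
move=> w si h; have sj : s j <= smax by lia.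
rewrite (F_wallX w) // (F_wallY w) //; apply: eq_bigr => T _.
by rewrite total_nested.
Qed.

Lemma pair_apart k A B : size A < k -> pairX k A B = 0 /\ pairY k A B = 0.
Proof.
move=> h; rewrite /pairX /pairY; split; apply: big1 => u _; apply: big1 => v _;
  have := ltn_ord u; move: (nat_of_ord u) (nat_of_ord v) => u0 v0 hu.
  have e1 : (u0 == (k + v0).+1) = false by apply/eqP; lia.
  have e2 : (u0 == (k + v0)) = false by apply/eqP; lia.
  by rewrite e1 e2.
have e2 : (u0 == (k + v0)) = false by apply/eqP; lia.
have e1 : (u0.+1 == (k + v0)) = false by apply/eqP; lia.
by rewrite e1 e2.
Qed.

Lemma F_apart s f g i j (k : nat) : wall f g i j k -> s i <= smax -> s j <= smax ->
  s i < k -> llt_sum s f = llt_sum s g.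
Proof.
move=> w si sj h; rewrite (F_wallX w) // (F_wallY w) //; apply: eq_bigr => T _.
congr (_ * _)%R; rewrite /total big_seq [RHS]big_seq; apply: eq_bigr => A /size_row hA.
rewrite -hA in h; apply: eq_bigr => B _; rewrite /wX /wY.
by have [-> ->] := pair_apart B h.
Qed.

Lemma F_overlap s s' f g i j (k : nat) : wall f g i j k -> k + s j <= smax ->
  k <= s i -> s i < k + s j -> s' i = k + s j -> s' j = s i - k ->
  (forall h, h != i -> h != j -> s' h = s h) ->
  (llt_sum s g = q * llt_sum s f + (1 - q) * llt_sum s' f)%R.
Proof.
move=> w hS h1 h2 h3 h4 h5.
rewrite (F_wallX w) ?(F_wallY w) ?(F_wallX (s := s') w); try lia.
rewrite [X in (_ = _ + _ * X)%R](eq_bigl (rest s i j)); last first.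
  move=> T; apply: eq_forallb => h; case: (altP (h =P i)) => //= hi; case: (altP (h =P j)) => //= hj.
  by rewrite h5.
rewrite !mulr_sumr -big_split /=; apply: eq_bigr => T _.
by rewrite total_overlap ?h3 ?h4; [ring | lia].
Qed.

End Poly.

Import Num.Theory Order.TTheory.
Local Open Scope ring_scope.

(** * Alcoves *)

(* Positions are measured in units of 1 / scale. *)
Record alcove n := Alcove {
  scale : int;
  pos : 'I_n -> int;
  scale_gt0 : 0 < scale;
  pos_inj : forall i j, (scale %| pos i - pos j)%Z -> i = j }.

Section Alcove.
Variable n : nat.
Implicit Types (A B : alcove n) (i j h : 'I_n) (s : 'I_n -> nat).

Definition fl A i j : int := ((pos A i - pos A j) %/ scale A)%Z.
Definition fr A i j : int := ((pos A i - pos A j) %% scale A)%Z.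

Lemma flE A i j : pos A i - pos A j = fl A i j * scale A + fr A i j.
Proof. exact: divz_eq. Qed.

Lemma frP A i j : 0 <= fr A i j < scale A.
Proof. by rewrite /fr ltz_pmod ?scale_gt0 // modz_ge0 //; have := scale_gt0 A; lia. Qed.

Lemma fr_gt0 A i j : i != j -> 0 < fr A i j.
Proof.
move=> ij; have /andP[h _] := frP A i j; rewrite lt_neqAle h andbT eq_sym.
by apply: contra ij => /eqP e; apply/eqP/(@pos_inj _ A)/dvdz_mod0P.
Qed.

Lemma fl_unique A i j (c r : int) : pos A i - pos A j = c * scale A + r ->
  0 <= r < scale A -> fl A i j = c.
Proof.
move=> e h; rewrite /fl e divzMDl; last by have := scale_gt0 A; lia.
by rewrite divz_small ?addr0 //; move: h; rewrite gtz0_abs ?scale_gt0.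
Qed.

Lemma fl_ii A i : fl A i i = 0.
Proof. by rewrite /fl subrr div0z. Qed.

(** Distinct rows are never at integral distance, so the floor of [-x] is [-1] minus the floor of
    [x]. *)
Lemma fl_anti A i j : i != j -> fl A i j = - 1 - fl A j i.
Proof.
move=> ij; apply: (@fl_unique _ _ _ _ (scale A - fr A j i)).
  have := flE A j i; lia.
have := frP A j i; have := @fr_gt0 A j i; rewrite eq_sym ij => /(_ isT); lia.
Qed.

Lemma fl_tri A i j h :
  (fl A i h = fl A i j + fl A j h /\ fr A i h = fr A i j + fr A j h) \/
  (fl A i h = fl A i j + fl A j h + 1 /\ fr A i h = fr A i j + fr A j h - scale A).
Proof.
have e1 := flE A i j; have e2 := flE A j h; have e3 := flE A i h.
have h1 := frP A i j; have h2 := frP A j h; have h3 := frP A i h.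
case: (ltP (fr A i j + fr A j h) (scale A)) => hlt; [left|right].
  have e : fl A i h = fl A i j + fl A j h.
    by apply: (@fl_unique _ _ _ _ (fr A i j + fr A j h)); lia.
  by split=> //; move: e3; rewrite e; lia.
have e : fl A i h = fl A i j + fl A j h + 1.
  by apply: (@fl_unique _ _ _ _ (fr A i j + fr A j h - scale A)); lia.
by split=> //; move: e3; rewrite e; lia.
Qed.

Lemma fl_triP A i j h : fl A i j + fl A j h <= fl A i h <= fl A i j + fl A j h + 1.
Proof. by case: (fl_tri A i j h) => [[-> _]|[-> _]]; lia. Qed.

(** The triangle inequalities for the floors, used in both alcoves, pin down how a third row sees
    [i] and [j]. *)
Lemma wall_alcove A A' i j k : i != j -> fl A' j i = k -> fl A j i = k - 1 ->
  (forall a b, ~~ [&& a == i & b == j] -> ~~ [&& a == j & b == i] -> fl A' a b = fl A a b) ->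
  wall (fl A') (fl A) i j k.
Proof.
move=> ij h1 h2 he; have ji : j != i by rewrite eq_sym.
split=> //; rewrite ?(fl_anti _ ij) ?h1 ?h2 //; first lia.
  exact: fl_ii.
move=> h hi hj.
have e1 : fl A' h j = fl A h j by rewrite he ?(negPf hi) ?(negPf hj) ?andbF.
have e2 : fl A' h i = fl A h i by rewrite he ?(negPf hi) ?(negPf hj) ?andbF.
have e3 := fl_anti A' hj; have e4 := fl_anti A' hi.
have := fl_triP A h j i; have := fl_triP A' h j i; lia.
Qed.

Definition dist A B : nat := (\sum_i \sum_j `|fl A i j - fl B i j|)%N.

(* A pair (j, i) to be crossed, with maximal fractional part, is separated from
   the wall by no other row. *)
Lemma cross A B : (exists i j, fl A i j != fl B i j) ->
  exists A' i j k, [/\ wall (fl A') (fl A) i j k, k <= fl B j i & (dist A' B < dist A B)%N].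
Proof.
have [p0 hp0|none] := pickP (fun p : 'I_n * 'I_n => fl A p.1 p.2 < fl B p.1 p.2); last first.
  case=> i [j ne]; have ij : i != j by apply: contra_neq ne => ->; rewrite !fl_ii.
  have := none (i, j); have := none (j, i) => /=.
  have := fl_anti A ij; have := fl_anti B ij; lia.
move=> _; case: (@arg_maxnP _ p0 (fun p => fl A p.1 p.2 < fl B p.1 p.2)
  (fun p => `|fr A p.1 p.2|%N) hp0) => -[j i] /= sep mx.
have ji : j != i by apply: contraTneq sep => ->; rewrite !fl_ii.
have ij : i != j by rewrite eq_sym.
set k := fl A j i + 1.
(* If the fractional parts carried, those of [(j, h)] and [(h, i)] would both exceed that of
   [(j, i)]. By maximality neither floor would be below its value in [B], and then neither would the
   floor of [(j, i)]. *)
have col h : fl A j i = fl A j h + fl A h i.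
  case: (fl_tri A j h i) => [[]//|[e1 e2]].
  have := mx (j, h); have := mx (h, i) => /=.
  have := frP A j h; have := frP A h i; have := frP A j i.
  have := fl_triP B j h i; lia.
(* The reflection in the wall; it swaps the residues of the two rows modulo [scale]. *)
pose p h := if h == j then pos A i + k * scale A else if h == i then pos A j - k * scale A else pos A h.
have pj : p j = pos A i + k * scale A by rewrite /p eqxx.
have pi : p i = pos A j - k * scale A by rewrite /p eqxx (negPf ij).
have ph h : h != i -> h != j -> p h = pos A h by rewrite /p => /negPf -> /negPf ->.
pose sw h := if h == j then i else if h == i then j else h.
have sK : involutive sw.
  move=> h; rewrite /sw; case: (altP (h =P j)) => [->|hj]; first by rewrite (negPf ij) eqxx.
  by case: (altP (h =P i)) => [->|hi]; rewrite ?eqxx // (negPf hj) (negPf hi).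
have pE h : exists c, p h = pos A (sw h) + c * scale A.
  rewrite /p /sw; case: (h == j); first by exists k.
  by case: (h == i); [exists (- k); lia | exists 0; lia].
have pI a b : (scale A %| p a - p b)%Z -> a = b.
  move=> hd; apply: (can_inj sK); apply: (@pos_inj _ A).
  have [c ec] := pE a; have [c' ec'] := pE b.
  have -> : pos A (sw a) - pos A (sw b) = (p a - p b) + (c' - c) * scale A by rewrite ec ec'; ring.
  by apply: rpredD => //; apply: dvdz_mull.
pose A' := Alcove (scale_gt0 A) pI.
have fji : fl A' j i = k.
  apply: (@fl_unique A' _ _ _ (scale A - fr A j i)).
    by rewrite /= pj pi; have := flE A j i; rewrite /k; lia.
  by have := frP A j i; have := fr_gt0 A ji; rewrite /=; lia.
have fhj h : h != i -> h != j -> fl A' h j = fl A h j.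
  move=> hi hj; apply: (@fl_unique A' _ _ _ (fr A h i)); last exact: frP.
  rewrite /= pj ph //; have := flE A h i; have := col h; have := fl_anti A hj; rewrite /k => -> ->.
  lia.
have fhi h : h != i -> h != j -> fl A' h i = fl A h i.
  move=> hi hj; apply: (@fl_unique A' _ _ _ (fr A h j)); last exact: frP.
  rewrite /= pi ph //; have := flE A h j; have := col h; have := fl_anti A hj; rewrite /k => -> ->.
  lia.
have he a b : ~~ [&& a == i & b == j] -> ~~ [&& a == j & b == i] -> fl A' a b = fl A a b.
  have [->|ai] := eqVneq a i; have [->|bi] := eqVneq b i; rewrite ?fl_ii //=.
  - have [//|bj] := eqVneq b j => _ _; have ib : i != b by rewrite eq_sym.
    by rewrite !(fl_anti _ ib) fhi.
  - have [//|aj] := eqVneq a j => _ _; exact: fhi.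
  - have [->|aj] := eqVneq a j; have [->|bj] := eqVneq b j; rewrite ?fl_ii //= => _ _.
    + have jb : j != b by rewrite eq_sym.
      by rewrite !(fl_anti _ jb) fhj.
    + exact: fhj.
    + by rewrite /fl /= !ph.
have w : wall (fl A') (fl A) i j k by apply: wall_alcove => //; rewrite /k; lia.
exists A', i, j, k; split=> //; first by rewrite /k; lia.
rewrite /dist (bigD1 j) //= [X in (_ < X)%N](bigD1 j) //= -addSn leq_add //.
  rewrite (bigD1 i) //= [X in (_ < X)%N](bigD1 i) //= -addSn leq_add //.
    by rewrite fji /k; lia.
  by apply: leq_sum => b bi; rewrite he // ?(negPf bi) ?andbF // ?(negPf ji).
apply: leq_sum => a aj; apply: leq_sum => b _.
have [e|ne] := boolP [&& a == i & b == j]; last by rewrite he // (negPf aj).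
case/andP: e => /eqP -> /eqP ->; have := fl_anti A ij; have := fl_anti A' ij; have := fl_anti B ij.
by rewrite fji /k; lia.
Qed.

End Alcove.

(* The weight of two rows of lengths a and b, the second one starting in the unit
   interval at distance x after the first one. *)
Definition overlap (a b : nat) (x : int) : int :=
  Num.max 0 (Num.min (Num.min a%:Z b%:Z) (Num.min (a%:Z - x) (b%:Z + x + 1))).

(** * Weights and orders under wall crossings *)

Section Meet.
Variable n : nat.
Implicit Types (A B : alcove n) (i j h : 'I_n) (s : 'I_n -> nat).

Definition weight s A i j := overlap (s i) (s j) (fl A j i).
(* Both ends of row j lie more than one unit to the right of those of row i.  A
   pair is comparable in this order iff its weight is not maximal. *)
Definition left_of s A i j := (1 <= fl A j i) && (1 <= fl A j i + (s j)%:Z - (s i)%:Z).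

Definition same_graph s A B := forall i j, i != j -> weight s A i j = weight s B i j.
Definition same_order s A B := forall i j, (0 < s i)%N -> (0 < s j)%N -> left_of s A i j = left_of s B i j.

Lemma meet_sym s A i j : i != j -> weight s A i j = weight s A j i.
Proof. by move=> ij; rewrite /weight (fl_anti A ij) /overlap; lia. Qed.

Definition merge s i j (m : nat) : 'I_n -> nat :=
  fun h => if h == i then (s i + s j - m)%N else if h == j then m else s h.

Lemma mm_left (a b : nat) (x : int) : (1 <= x) && (1 <= x + b%:Z - a%:Z) ->
  overlap a b x = Num.max 0 (a%:Z - x).
Proof. by rewrite /overlap => h; congr (Num.max _ _); lia. Qed.

Lemma mm_right (a b : nat) (x : int) : (1 <= - 1 - x) && (1 <= - 1 - x + a%:Z - b%:Z) ->
  overlap a b x = Num.max 0 (b%:Z + x + 1).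
Proof. by rewrite /overlap => h; congr (Num.max _ _); lia. Qed.

Lemma mm_mid (a b : nat) (x : int) : ~~ ((1 <= x) && (1 <= x + b%:Z - a%:Z)) ->
  ~~ ((1 <= - 1 - x) && (1 <= - 1 - x + a%:Z - b%:Z)) ->
  overlap a b x = Num.min a%:Z b%:Z.
Proof. by rewrite /overlap => h1 h2; lia. Qed.

(** The one-dimensional form of convexity: the three ranges of [x] (left, right, incomparable) are
    intervals, and [overlap] is monotone on each. *)
Lemma mm_inside (a b : nat) (x y z : int) :
  overlap a b x = overlap a b z ->
  ((1 <= x) && (1 <= x + b%:Z - a%:Z)) = ((1 <= z) && (1 <= z + b%:Z - a%:Z)) ->
  ((1 <= - 1 - x) && (1 <= - 1 - x + a%:Z - b%:Z)) = ((1 <= - 1 - z) && (1 <= - 1 - z + a%:Z - b%:Z)) ->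
  (x <= y <= z) || (z <= y <= x) ->
  [/\ overlap a b y = overlap a b x,
      ((1 <= y) && (1 <= y + b%:Z - a%:Z)) = ((1 <= z) && (1 <= z + b%:Z - a%:Z)) &
      ((1 <= - 1 - y) && (1 <= - 1 - y + a%:Z - b%:Z)) = ((1 <= - 1 - z) && (1 <= - 1 - z + a%:Z - b%:Z))].
Proof.
move=> hm h1 h2 hy; suff [-> e1 e2] : [/\ overlap a b y = overlap a b z,
      ((1 <= y) && (1 <= y + b%:Z - a%:Z)) = ((1 <= z) && (1 <= z + b%:Z - a%:Z)) &
      ((1 <= - 1 - y) && (1 <= - 1 - y + a%:Z - b%:Z)) = ((1 <= - 1 - z) && (1 <= - 1 - z + a%:Z - b%:Z))] by [].
have [hz|hz] := boolP ((1 <= z) && (1 <= z + b%:Z - a%:Z)).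
  rewrite hz in h1; have hy1 : (1 <= y) && (1 <= y + b%:Z - a%:Z) by clear -h1 hz hy; lia.
  move: hm; rewrite !mm_left // => hm.
  by split; [clear -hm hy; lia| done | clear -hy1 hz; lia].
have [hz'|hz'] := boolP ((1 <= - 1 - z) && (1 <= - 1 - z + a%:Z - b%:Z)).
  rewrite hz' in h2; have hy1 : (1 <= - 1 - y) && (1 <= - 1 - y + a%:Z - b%:Z) by clear -h2 hz' hy; lia.
  move: hm; rewrite !mm_right // => hm.
  by split; [clear -hm hy; lia| clear -hy1 hz; lia | done].
have hy1 : ~~ ((1 <= y) && (1 <= y + b%:Z - a%:Z)).
  by move: h1; rewrite (negPf hz) => h1; clear -h1 hz hy; lia.
have hy2 : ~~ ((1 <= - 1 - y) && (1 <= - 1 - y + a%:Z - b%:Z)).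
  by move: h2; rewrite (negPf hz') => h2; clear -h2 hz' hy; lia.
by rewrite !mm_mid // (negPf hy1) (negPf hy2).
Qed.

Lemma mm0 (a b : nat) x : (a == 0)%N || (b == 0)%N -> overlap a b x = 0.
Proof. by rewrite /overlap; lia. Qed.

Variables (R : idomainType) (q : R) (vmax smax : nat) (y : nat -> R).
Local Notation F := (llt_sum q vmax smax y).

Lemma F_ext s f g : (forall i j, f i j = g i j) -> F s f = F s g.
Proof.
move=> e; apply: eq_bigr => T _; rewrite /wt /ninv; congr (_ * _ ^+ _).
by apply: eq_bigr => a _; apply: eq_bigr => b _; rewrite e.
Qed.

(** Equal weights at [k] and [k - 1] leave four situations: one row nested in the other, in either
    direction, or rows too far apart, on either side. *)
Lemma F_commute s f g i j k : wall f g i j k -> (s i <= smax)%N -> (s j <= smax)%N ->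
  overlap (s i) (s j) k = overlap (s i) (s j) (k - 1) -> F s f = F s g.
Proof.
move=> w si sj h.
have : (0 <= k /\ k + (s j)%:Z <= (s i)%:Z) \/ (k <= 0 /\ (s i)%:Z - k <= (s j)%:Z) \/
       (s i)%:Z < k \/ (s j)%:Z < - k by move: h; rewrite /overlap; lia.
have w' := wall_sym w.
case=> [[h1 h2]|[[h1 h2]|[h1|h1]]].
- have e : k = (`|k|%N)%:Z by lia.
  rewrite e in w; apply: F_nested w _ _ => //; lia.
- have e : - k = (`|k|%N)%:Z by lia.
  rewrite e in w'; symmetry; apply: F_nested w' _ _ => //; lia.
- have e : k = (`|k|%N)%:Z by lia.
  rewrite e in w; apply: F_apart w _ _ _ => //; lia.
- have e : - k = (`|k|%N)%:Z by lia.
  rewrite e in w'; symmetry; apply: F_apart w' _ _ _ => //; lia.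
Qed.

Lemma wall_off (A A' : alcove n) i j k a b : wall (fl A') (fl A) i j k ->
  ~~ [&& a == i & b == j] -> ~~ [&& a == j & b == i] -> fl A' a b = fl A a b.
Proof. by move=> w; apply: (wall_eq w). Qed.

Lemma wall_meet s (A A' : alcove n) i j k a b : wall (fl A') (fl A) i j k ->
  ~~ [&& a == i & b == j] -> ~~ [&& a == j & b == i] ->
  weight s A' a b = weight s A a b /\ left_of s A' a b = left_of s A a b.
Proof.
by move=> w h1 h2; rewrite /weight /left_of (wall_off (a := b) (b := a) w) // andbC.
Qed.

Lemma pairP i j a b : i != j ->
  [\/ a = i /\ b = j, a = j /\ b = i | ~~ [&& a == i & b == j] /\ ~~ [&& a == j & b == i]].
Proof.
move=> ij; case: (boolP [&& a == i & b == j]) => [/andP[/eqP -> /eqP ->]|h1]; first by constructor.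
case: (boolP [&& a == j & b == i]) => [/andP[/eqP -> /eqP ->]|h2]; first by constructor 2.
by constructor 3.
Qed.

Lemma wall_same s (A A' B : alcove n) i j k : wall (fl A') (fl A) i j k -> k <= fl B j i ->
  weight s A i j = weight s B i j ->
  ((0 < s i)%N -> (0 < s j)%N -> left_of s A i j = left_of s B i j /\ left_of s A j i = left_of s B j i) ->
  [/\ weight s A' i j = weight s A i j, weight s A' j i = weight s A j i &
   ((0 < s i)%N -> (0 < s j)%N -> left_of s A' i j = left_of s A i j /\ left_of s A' j i = left_of s A j i)].
Proof.
move=> w hk hm ho; have ij := wall_neq w; have ji : j != i by rewrite eq_sym.
rewrite [weight s A' j i]meet_sym // [weight s A j i]meet_sym //.
have e1 := wall_f w; have e2 := wall_g w.
case: (boolP ((s i == 0)%N || (s j == 0)%N)) => h0.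
  by rewrite /weight !mm0 //; split=> // si sj; move: h0; rewrite -leqn0 -(leqn0 (s j)); lia.
have [si sj] : (0 < s i)%N /\ (0 < s j)%N by lia.
have [o1 o2] := ho si sj.
move: o1 o2 hm; rewrite /left_of /weight !(fl_anti _ ij) => o1 o2 hm.
have := mm_inside (y := fl A' j i) hm o1 o2; case; first by rewrite e1 e2; lia.
move=> h1 h2 h3; split=> // _ _; by rewrite h2 h3 o1 o2.
Qed.

(** By convexity every wall crossed on the way to [B] keeps graph and order, so [F_commute] applies
    to it. *)
Lemma F_conv s A B : (forall h, (s h <= smax)%N) -> same_graph s A B -> same_order s A B ->
  F s (fl A) = F s (fl B).
Proof.
move=> sS; have [d] := ubnP (dist A B); elim: d A => // d IH A hd hM hO.
case: (boolP [exists i, exists j, fl A i j != fl B i j]) => [/existsP [i /existsP [j hij]]|]; last first.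
  move=> /existsPn h; apply: F_ext => i j; have /existsPn /(_ j) := h i.
  by rewrite negbK => /eqP.
have [|A' [{hij}i [{}j [k [w hk hd']]]]] := @cross _ A B; first by exists i, j.
have ij := wall_neq w.
have [h1 h2 h3] := wall_same w hk (hM i j ij) (fun si sj => conj (hO i j si sj) (hO j i sj si)).
have hM' : same_graph s A' B.
  move=> a b ab; rewrite -hM //.
  case: (pairP a b ij) => [[-> ->]//|[-> ->]//|[n1 n2]].
  by have [] := wall_meet s w n1 n2.
have hO' : same_order s A' B.
  move=> a b sa sb; rewrite -hO //.
  case: (pairP a b ij) => [[ea eb]|[ea eb]|[n1 n2]]; subst.
  - by have [] := h3 sa sb.
  - by have [] := h3 sb sa.
  - by have [] := wall_meet s w n1 n2.
rewrite -(IH A') //; last by lia.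
symmetry; apply: (F_commute w) => //.
by move: h1; rewrite /weight (wall_f w) (wall_g w).
Qed.

Lemma mm_pos (a b : nat) (x : int) : 0 <= x -> overlap a b x = Num.max 0 (Num.min (a%:Z - x) b%:Z).
Proof. by rewrite /overlap => h; congr (Num.max _ _); lia. Qed.
Lemma mm_neg (a b : nat) (x : int) : x < 0 -> overlap a b x = Num.max 0 (Num.min a%:Z (b%:Z + x + 1)).
Proof. by rewrite /overlap => h; congr (Num.max _ _); lia. Qed.

(** The weight with the intersection, of length [m], is as large as the old weights and [m] allow;
    the weight with the union, of length [u], is the rest of the sum, capped by [sh]. Thus the new
    weights are functions of the old graph, whatever the positions. *)
Lemma merge_arith (sh si sj m u : nat) (k g : int) :
  m%:Z = si%:Z - k -> u%:Z = k + sj%:Z -> 1 <= k -> si%:Z < k + sj%:Z ->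
  let I := overlap sh m (g + k) in
  I = Num.min (Num.min (overlap sh si g) (overlap sh sj (g + k))) m%:Z /\
  overlap sh u g = Num.min sh%:Z (overlap sh si g + overlap sh sj (g + k) - I).
Proof.
move=> hm hu h2 h3 /=; have h4 : 0 <= si%:Z - k by rewrite -hm.
have [g0|g0] := leP 0 g.
  by rewrite !mm_pos; try lia; rewrite hm hu; clear hm hu u m; split; lia.
have [gk|gk] := leP 0 (g + k).
  rewrite ![overlap _ _ (g + k)]mm_pos // ![overlap _ _ g]mm_neg //.
  by rewrite hm hu; clear hm hu u m; split; lia.
rewrite !mm_neg //.
by rewrite hm hu; clear hm hu u m; split; lia.
Qed.

Lemma merge_meets s (D D' : alcove n) i j k h : wall (fl D) (fl D') i j k ->
  weight s D i j = (s i)%:Z - k -> 1 <= k -> (s i)%:Z < k + (s j)%:Z ->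
  h != i -> h != j ->
  let s' := merge s i j `|weight s D i j|%N in
  weight s' D h j = Num.min (Num.min (weight s D h i) (weight s D h j)) (weight s D i j) /\
  weight s' D h i = Num.min (s h)%:Z (weight s D h i + weight s D h j - weight s' D h j).
Proof.
move=> w hm k2 k3 hi hj /=.
have h0 : 0 <= weight s D i j by rewrite /weight /overlap; lia.
have ij := wall_neq w; have ji : j != i by rewrite eq_sym.
have [_ e] := wall_col w hi hj.
rewrite hm in h0 *; rewrite /weight /merge eqxx (negPf ji) (negPf hi) (negPf hj) eqxx e.
have [] := @merge_arith (s h) (s i) (s j) `|(s i)%:Z - k|%N (s i + s j - `|(s i)%:Z - k|)%N k (fl D i h); try lia.
by move=> -> ->; split=> //; congr (Num.min _ _); lia.
Qed.

(** The weight at [x] is one more than at [k0], so the position [k0 - 1], reached in a single step,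
    already has the order of [x]. *)
Lemma step_orient (si sj k0 : nat) (x : int) : (1 <= k0)%N -> (k0 <= si)%N -> (si < k0 + sj)%N ->
  (1 <= k0%:Z) && (1 <= k0%:Z + sj%:Z - si%:Z) ->
  ~~ ((1 <= - 1 - x) && (1 <= - 1 - x + si%:Z - sj%:Z)) -> overlap si sj x = si%:Z - k0%:Z + 1 ->
  ((1 <= k0%:Z - 1) && (1 <= k0%:Z - 1 + sj%:Z - si%:Z)) = ((1 <= x) && (1 <= x + sj%:Z - si%:Z)) /\
  ((1 <= - 1 - (k0%:Z - 1)) && (1 <= - 1 - (k0%:Z - 1) + si%:Z - sj%:Z)) =
  ((1 <= - 1 - x) && (1 <= - 1 - x + si%:Z - sj%:Z)).
Proof.
move=> h1 h2 h3 h4 h5 h6.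
have [hB|hB] := boolP ((1 <= x) && (1 <= x + sj%:Z - si%:Z)).
  move: h6; rewrite mm_left // => h6; lia.
move: h6; rewrite mm_mid // => h6; lia.
Qed.

Definition off i j a b := ~~ [&& a == i & b == j] /\ ~~ [&& a == j & b == i].

(** On the way from [A] to [B] one crossing changes a weight. The crossings before it are covered by
    [F_commute]; at it the merged term appears, with [D] the alcove just before it; from there
    [F_conv] leads to [B]. The weights in [D] are still those of [A], which expresses the merged
    graph through [A]. *)
Lemma F_step s A B i j : (\sum_h s h <= smax)%N -> i != j -> (0 < s i)%N -> (0 < s j)%N ->
  left_of s A i j -> ~~ left_of s B j i -> weight s B i j = weight s A i j + 1 ->
  (forall a b, a != b -> off i j a b -> weight s A a b = weight s B a b) ->
  (forall a b, (0 < s a)%N -> (0 < s b)%N -> off i j a b -> left_of s A a b = left_of s B a b) ->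
  let s' := merge s i j `|weight s A i j|%N in
  exists D : alcove n,
  [/\ F s (fl B) = q * F s (fl A) + (1 - q) * F s' (fl D),
   weight s' D i j = weight s A i j,
   forall h h', h != i -> h != j -> h' != i -> h' != j -> h != h' -> weight s' D h h' = weight s A h h' &
   forall h, h != i -> h != j ->
    weight s' D h j = Num.min (Num.min (weight s A h i) (weight s A h j)) (weight s A i j) /\
    weight s' D h i = Num.min (s h)%:Z (weight s A h i + weight s A h j - weight s' D h j)].
Proof.
move=> hS ij si sj; have ji : j != i by rewrite eq_sym.
have sS h : (s h <= smax)%N by apply: leq_trans hS; rewrite (bigD1 h) //= leq_addr.
have sS2 : (s i + s j <= smax)%N.
  by apply: leq_trans hS; rewrite (bigD1 i) //= (bigD1 j) //= addnA leq_addr.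
have [d] := ubnP (dist A B); elim: d A => // d IH A hd hl hr hm hM hO.
have : exists a b, fl A a b != fl B a b.
  exists j, i; apply/negP => /eqP e; move: hm; rewrite /weight e; lia.
case/cross=> A' [a [b [k [w hk hd']]]].
have ab := wall_neq w; have ba : b != a by rewrite eq_sym.
have hm0 : weight s A i j = Num.max 0 ((s i)%:Z - fl A j i) by rewrite /weight mm_left.
(* The case of a wall that changes neither graph nor order: the conclusion passes from [A'] back to
   [A]. *)
have next : weight s A' i j = weight s A i j -> left_of s A' i j ->
   (forall a b, a != b -> off i j a b -> weight s A' a b = weight s A a b) ->
   (forall a b, (0 < s a)%N -> (0 < s b)%N -> off i j a b -> left_of s A' a b = left_of s A a b) ->
   weight s A' a b = weight s A a b ->
   exists D : alcove n,
  [/\ F s (fl B) = q * F s (fl A) + (1 - q) * F (merge s i j `|weight s A i j|%N) (fl D),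
   weight (merge s i j `|weight s A i j|%N) D i j = weight s A i j,
   forall h h', h != i -> h != j -> h' != i -> h' != j -> h != h' ->
     weight (merge s i j `|weight s A i j|%N) D h h' = weight s A h h' &
   forall h, h != i -> h != j ->
    weight (merge s i j `|weight s A i j|%N) D h j = Num.min (Num.min (weight s A h i) (weight s A h j)) (weight s A i j) /\
    weight (merge s i j `|weight s A i j|%N) D h i = Num.min (s h)%:Z (weight s A h i + weight s A h j - weight (merge s i j `|weight s A i j|%N) D h j)].
  move=> e1 e2 e3 e4 e5.
  have [||||||D [f1 f2 f4 f3]] := IH A'; rewrite ?e1 //; first lia.
  - by move=> a' b' n1 n2; rewrite e3 ?hM.
  - by move=> a' b' n1 n2 n3; rewrite e4 ?hO.
  rewrite e1 in f1 f2 f3 f4.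
  exists D; split=> //.
    rewrite f1; congr (q * _ + _); apply: (F_commute w) => //.
    by move: e5; rewrite /weight (wall_f w) (wall_g w).
    move=> h h' hi hj h'i h'j hh; rewrite f4 // e3 //.
    by split; rewrite ?(negPf hi) ?(negPf hj) ?andbF.
  move=> h hi hj; have := f3 h hi hj; rewrite !(e3 h) //; split; by rewrite ?(negPf hi) ?(negPf hj) ?andbF.
case: (pairP a b ij) => [[ea eb]|[ea eb]|[n1 n2]].
(* Row [j] would move away from row [i], which cannot lead to a larger weight. *)
- subst a b; exfalso; move: hm hl hr; rewrite hm0 /left_of !(fl_anti _ ij) => hm hl hr.
  have := wall_g w => ek; have [hB|hB] := boolP (left_of s B i j).
    by move: hm; rewrite /weight mm_left //; move: hB; lia.
  move: hB; rewrite /left_of; lia.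
- subst a b.
  have hoff a b : off i j a b -> ~~ [&& a == j & b == i] /\ ~~ [&& a == i & b == j] by case.
  have e3 a b : a != b -> off i j a b -> weight s A' a b = weight s A a b.
    by move=> _ [n1 n2]; have [] := wall_meet s w n2 n1.
  have e4 a b : (0 < s a)%N -> (0 < s b)%N -> off i j a b -> left_of s A' a b = left_of s A a b.
    by move=> _ _ [n1 n2]; have [] := wall_meet s w n2 n1.
  have eA := wall_g' w; have eA' := wall_f' w.
  have [same|diff] := eqVneq (weight s A' i j) (weight s A i j).
    apply: next => //; last by rewrite !(@meet_sym s _ j i).
    have hB : fl B j i = - 1 - fl B i j by rewrite (fl_anti B ji).
    have h1 : fl B j i <= fl A' j i by rewrite hB eA'; lia.
    move: hl; rewrite /left_of => hl; apply: contraNT hr => hl'.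
    move: same; rewrite hm0 {1}/weight; move: hl hl'; rewrite /left_of eA eA'.
    have : (s i)%:Z + (s j)%:Z < 0 \/ 0 <= (s i)%:Z by lia.
    by rewrite /overlap; lia.
  set k0 := `|k|%N.
  have hk0 : - k = k0%:Z.
    by move: hl; rewrite /left_of eA /k0; lia.
  have fA : fl A j i = k0%:Z by rewrite eA; lia.
  have fA' : fl A' j i = k0%:Z - 1 by rewrite eA'; lia.
  have hk1 : (1 <= k0)%N by move: hl; rewrite /left_of fA; lia.
  have [hk2 hk3] : (k0 <= s i)%N /\ (s i < k0 + s j)%N.
    move: hl diff; rewrite hm0 /left_of /weight /overlap fA fA'; lia.
  have hmA : weight s A i j = (s i)%:Z - k0%:Z by rewrite hm0 fA; lia.
  have hmA' : weight s A' i j = weight s A i j + 1.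
    rewrite hmA /weight /overlap fA'; lia.
  have w' := wall_sym w; rewrite hk0 in w'.
  have oO : left_of s A' i j = left_of s B i j /\ left_of s A' j i = left_of s B j i.
    move: hm hl hr; rewrite hmA /left_of !(fl_anti _ ij) fA fA' => hm hl hr.
    exact: (step_orient hk1 hk2 hk3 hl hr hm).
  exists A; split.
  + have -> : F s (fl B) = F s (fl A').
      symmetry; apply: F_conv => //.
        move=> a b nab; case: (pairP a b ij) => [[-> ->]|[-> ->]|hof]; rewrite ?hm //.
          by rewrite [LHS]meet_sym // [RHS]meet_sym // hm.
        by rewrite e3 // hM.
      move=> a b sa sb; case: (pairP a b ij) => [[ea eb]|[ea eb]|hof]; last by rewrite e4 // hO.
      - by subst a b; have [] := oO.
      - by subst a b; have [] := oO.
    apply: (F_overlap q vmax y w'); rewrite ?hmA /merge ?eqxx ?(negPf ji); try lia.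
  + by rewrite {1}/weight /merge eqxx (negPf ji) eqxx hmA fA /overlap; lia.
  + by move=> h h' hi hj h'i h'j _; rewrite /weight /merge (negPf hi) (negPf hj) (negPf h'i) (negPf h'j).
  + move=> h hi hj; apply: (merge_meets w') => //; lia.
have hof : off i j a b.
  by split; apply/negP => /andP[/eqP ea /eqP eb]; subst; move: n1 n2; rewrite !eqxx // andbT.
have hof' : off i j b a by case: hof => m1 m2; split; rewrite andbC.
have [h1 h2 h3] := wall_same w hk (hM a b ab hof) (fun sa sb => conj (hO a b sa sb hof) (hO b a sb sa hof')).
have e3 c d0 : c != d0 -> weight s A' c d0 = weight s A c d0.
  move=> cd; case: (pairP c d0 ab) => [[-> ->]//|[-> ->]//|[m1 m2]].
  by have [] := wall_meet s w m1 m2.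
have e4 c d0 : (0 < s c)%N -> (0 < s d0)%N -> left_of s A' c d0 = left_of s A c d0.
  move=> sc sd; case: (pairP c d0 ab) => [[ec ed]|[ec ed]|[m1 m2]]; subst.
  - by have [] := h3 sc sd.
  - by have [] := h3 sd sc.
  - by have [] := wall_meet s w m1 m2.
by apply: next; rewrite ?e3 ?e4 // => *; rewrite ?e3 ?e4.
Qed.

End Meet.

(** * Permuting the rows *)

Section Relabel.
Variables (n : nat).

Program Definition relabel (A : alcove n) (phi : 'I_n -> 'I_n) (inj : injective phi) : alcove n :=
  @Alcove n (scale A) (fun i => pos A (phi i)) (scale_gt0 A) _.
Next Obligation. by apply: inj; apply: pos_inj H. Qed.

Lemma fl_relabel A phi (inj : injective phi) i j : fl (relabel A inj) i j = fl A (phi i) (phi j).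
Proof. by []. Qed.

Variables (R : idomainType) (q : R) (vmax smax : nat) (y : nat -> R).
Local Notation F := (llt_sum q vmax smax y).

Lemma F_sizes (s s' : 'I_n -> nat) (f : 'I_n -> 'I_n -> int) : s =1 s' -> F s f = F s' f.
Proof. by move=> e; apply: eq_bigl => T; apply: eq_forallb => h; rewrite e. Qed.

Lemma F_relabel (s : 'I_n -> nat) (f : 'I_n -> 'I_n -> int) (phi : 'I_n -> 'I_n) : injective phi ->
  F (fun i => s (phi i)) (fun i j => f (phi i) (phi j)) = F s f.
Proof.
move=> inj; pose p := perm inj; rewrite /llt_sum.
rewrite [RHS](reindex (fun T : {ffun 'I_n -> frow vmax smax} => [ffun h => T ((p^-1)%g h)])) /=; last first.
  exists (fun T : {ffun 'I_n -> frow vmax smax} => [ffun h => T (p h)]) => T _;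
  by apply/ffunP => h; rewrite !ffunE ?permK ?permKV.
apply: eq_big => [T|T _].
  apply/forallP/forallP => hT h.
    by have := hT ((p^-1)%g h); rewrite ffunE -(permE inj) permKV.
  by have := hT (p h); rewrite ffunE permK permE.
rewrite /wt /ninv; congr (_ * _ ^+ _).
  rewrite [RHS](reindex_inj (@perm_inj _ p)); apply: eq_bigr => h _.
  by rewrite ffunE permK.
rewrite [RHS](reindex_inj (@perm_inj _ p)); apply: eq_bigr => a _.
rewrite [RHS](reindex_inj (@perm_inj _ p)); apply: eq_bigr => b _.
by rewrite !ffunE !permK !permE.
Qed.

End Relabel.

Lemma exists_min n (T : {set 'I_n}) (g : 'I_n -> int) : T != set0 ->
  exists2 x, x \in T & forall t, t \in T -> g x <= g t.
Proof.
case/set0Pn => x0 hx0; case: (arg_minP g hx0) => x hx h.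
by exists x.
Qed.

Section Refine.
Variable n : nat.

(* Ties modulo N are broken by the index. *)
Lemma refine (N : int) (L : 'I_n -> int) : 0 < N ->
  exists A : alcove n, forall a b c,
    (c * N < L a - L b -> c <= fl A a b) /\ (L a - L b < c * N -> fl A a b < c).
Proof.
move=> N0; pose m : int := n.+1.
have m0 : 0 < m by rewrite /m.
have mN : 0 < m * N by rewrite mulr_gt0.
pose p i : int := m * L i + (i : nat).
have pI i j : (m * N %| p i - p j)%Z -> i = j.
  case/dvdzP => c e; apply: val_inj => /=.
  have : (m %| (i : nat)%:Z - (j : nat)%:Z)%Z.
    apply/dvdzP; exists (c * N - L i + L j); move: e; rewrite /p; lia.
  have := ltn_ord i; have := ltn_ord j => hj hi /dvdzP [d hd].
  have : d = 0 by move: hd; rewrite /m; nia.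
  lia.
exists (Alcove mN pI) => a b c; have ha := ltn_ord a; have hb := ltn_ord b.
have hm : m = n%:Z + 1 by rewrite /m; lia.
split=> h; rewrite /fl /= /p.
  by rewrite lez_divRL //; nia.
by rewrite ltz_divLR //; nia.
Qed.
End Refine.

(** * Windows and reflections *)

Section Geometry.
Variables (n : nat) (s : 'I_n -> nat).
Implicit Types (A B : alcove n) (i j h u v t : 'I_n) (T : {set 'I_n}).

Definition covers A u t := (fl A u t <= 0) && (fl A t u + (s t)%:Z - (s u)%:Z <= 0).
(* Row a ends before row b starts. *)
Definition before A a b := (s a)%:Z <= fl A b a.

(* Every row outside T covers all of T, or lies on one side of T, and this is the
   same in A and B. *)
Definition same_side A B T := forall u, u \notin T -> (0 < s u)%N ->
  [\/ forall t, t \in T -> covers A u t && covers B u t,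
      forall t, t \in T -> before A t u && before B t u |
      forall t, t \in T -> before A u t && before B u t].
Definition same_outside A B T := forall u v, u \notin T -> v \notin T -> fl A u v = fl B u v.
(** A reflection sends the start of a row to a constant minus its end, whence the difference of
    lengths. *)
Definition mirrored A B T := forall t t', t \in T -> t' \in T -> t != t' ->
  fl B t t' = fl A t' t + (s t')%:Z - (s t)%:Z.

Lemma TYC A B T : same_side A B T -> same_side B A T.
Proof.
move=> h u hu su; case: (h u hu su) => k; [constructor 1|constructor 2|constructor 3] => t ht;
by rewrite andbC k.
Qed.

Lemma cov_meet A u t : u != t -> covers A u t ->
  [/\ weight s A u t = Num.min (s u)%:Z (s t)%:Z, left_of s A u t = false & left_of s A t u = false].
Proof.
move=> ut; rewrite /covers /weight /left_of (fl_anti A ut) => h.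
split; [rewrite /overlap; lia | apply/negP; lia | apply/negP; lia].
Qed.

Lemma bef_meet A a b : a != b -> before A a b -> (0 < s a)%N -> (0 < s b)%N ->
  [/\ weight s A a b = 0, left_of s A a b & left_of s A b a = false].
Proof.
move=> ab; rewrite /before /weight /left_of (fl_anti A ab) => h sa sb.
split; [rewrite /overlap; lia | lia | apply/negP; lia].
Qed.

Lemma meet0 A a b : (s a == 0)%N || (s b == 0)%N -> weight s A a b = 0.
Proof. exact: mm0. Qed.

Lemma TY_same A B T a b : same_outside A B T -> same_side A B T -> (forall t, t \in T -> (0 < s t)%N) ->
  a != b -> ~~ ((a \in T) && (b \in T)) ->
  weight s A a b = weight s B a b /\
  ((0 < s a)%N -> (0 < s b)%N -> left_of s A a b = left_of s B a b).
Proof.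
move=> hE hT hp.
have main u t : u \notin T -> t \in T -> (0 < s u)%N -> [/\ weight s A u t = weight s B u t,
   left_of s A u t = left_of s B u t & left_of s A t u = left_of s B t u].
  move=> hu ht su; have st := hp t ht; have ut : u != t by apply: contraNneq hu => ->.
  have tu : t != u by rewrite eq_sym.
  case: (hT u hu su) => /(_ t ht)/andP[].
  - by move=> /(cov_meet ut) [-> -> ->] /(cov_meet ut) [-> -> ->].
  - move=> /(bef_meet tu) /(_ st su) [e1 -> ->] /(bef_meet tu) /(_ st su) [e2 -> ->].
    by rewrite [LHS]meet_sym // [RHS]meet_sym // e1 e2.
  - by move=> /(bef_meet ut) /(_ su st) [-> -> ->] /(bef_meet ut) /(_ su st) [-> -> ->].
move=> ab; have ba : b != a by rewrite eq_sym.
case: (boolP (a \in T)) => ha; case: (boolP (b \in T)) => hb //= _.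
- case: (posnP (s b)) => [e|sb]; first by rewrite !meet0 ?e ?orbT.
  by have [e1 e2 e3] := main b a hb ha sb; rewrite [LHS]meet_sym // [RHS]meet_sym // e1.
- case: (posnP (s a)) => [e|sa]; first by rewrite !meet0 ?e ?orbT.
  by have [e1 e2 e3] := main a b ha hb sa.
- by rewrite /weight /left_of !(hE b a).
Qed.

Lemma mir_meet A B T a b : mirrored A B T -> a \in T -> b \in T -> a != b ->
  weight s A a b = weight s B a b /\ left_of s A a b = left_of s B b a.
Proof.
move=> h ha hb ab; have ba : b != a by rewrite eq_sym.
have e1 := h b a hb ha ba; have e2 := h a b ha hb ab.
rewrite /weight /left_of e1 e2 (fl_anti A ab); split; last by rewrite [RHS]andbC; congr (_ && _); lia.
by rewrite /overlap; lia.
Qed.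

(** With both alcoves equal, [same_side] is the condition for [T] to be reflectable. *)
Definition closed_rows A T := same_side A A T.

(** The window of [T] does not grow, as seen from the outside rows: a common bound for all starts
    (second clause) or all ends (third clause) persists. *)
Definition in_window A B T := [/\ same_outside A B T,
  forall u (a : int), u \notin T -> (forall t, t \in T -> a <= fl A t u) ->
     forall t, t \in T -> a <= fl B t u &
  forall u (a : int), u \notin T -> (forall t, t \in T -> a <= fl A u t + (s u)%:Z - (s t)%:Z) ->
     forall t, t \in T -> a <= fl B u t + (s u)%:Z - (s t)%:Z].

(** Covering and lying on one side are bounds common to all of [T], with [a = -1] and [a = s u]
    respectively, so they persist in the window. *)
Lemma Pres_TY A B T : closed_rows A T -> in_window A B T -> same_side A B T.
Proof.
move=> hc [_ p1 p2] u hu su; have ne t : t \in T -> u != t /\ t != u.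
  by move=> ht; rewrite eq_sym; have : t != u by [apply: contraNneq hu => <-].
case: (hc u hu su) => h; [constructor 1|constructor 2|constructor 3] => t ht;
  have [n1 n2] := ne t ht; have hh := h t ht; move: (hh) => /andP[-> _] /=.
- have q1 := p1 u (-1) hu _ t ht; have q2 := p2 u (-1) hu _ t ht.
  rewrite /covers; have : -1 <= fl B t u.
    apply: q1 => t' ht'; have [m1 m2] := ne t' ht'.
    by have := h t' ht'; rewrite /covers (fl_anti A m1); lia.
  have : -1 <= fl B u t + (s u)%:Z - (s t)%:Z.
    apply: q2 => t' ht'; have [m1 m2] := ne t' ht'.
    by have := h t' ht'; rewrite /covers (fl_anti A m1); lia.
  by rewrite (fl_anti B n1); lia.
- have q2 := p2 u (s u) hu _ t ht; rewrite /before.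
  have : (s u)%:Z <= fl B u t + (s u)%:Z - (s t)%:Z.
    by apply: q2 => t' ht'; have := h t' ht'; rewrite /before; lia.
  by lia.
- have q1 := p1 u (s u) hu _ t ht; rewrite /before.
  by apply: q1 => t' ht'; have := h t' ht'; rewrite /before; lia.
Qed.

(** The positions [L0] may have ties, which [refine] breaks. The units added and subtracted in the
    bounds come from the nonzero fractional parts in [A]; they give the strict inequalities that
    [refine] preserves. *)
Lemma window A T (L0 : 'I_n -> int) : T != set0 ->
  (forall lo, (forall t, t \in T -> lo <= pos A t) -> forall t, t \in T -> lo <= L0 t) ->
  (forall hi, (forall t, t \in T -> pos A t + (s t)%:Z * scale A <= hi) ->
     forall t, t \in T -> L0 t + (s t)%:Z * scale A <= hi) ->
  exists B, in_window A B T /\ forall t t' c, t \in T -> t' \in T ->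
   (c * scale A < L0 t - L0 t' -> c <= fl B t t') /\ (L0 t - L0 t' < c * scale A -> fl B t t' < c).
Proof.
move=> T0 hlo hhi.
have [B hB] := @refine n (scale A) (fun h => if h \in T then L0 h else pos A h) (scale_gt0 A).
exists B; split; last by move=> t t' c ht ht'; have := hB t t' c; rewrite ht ht'.
have N0 := scale_gt0 A.
split.
- move=> u v hu hv; have [->|uv] := eqVneq u v; first by rewrite !fl_ii.
  have [h1 _] := hB u v (fl A u v); have [_ h2] := hB u v (fl A u v + 1).
  move: h1 h2; rewrite (negPf hu) (negPf hv) !flE => h1 h2.
  have := fr_gt0 A uv; have := frP A u v => f1 f2.
  have : fl A u v <= fl B u v by apply: h1; lia.
  have : fl B u v < fl A u v + 1 by apply: h2; lia.
  by lia.
- move=> u a hu ha t ht; have [h1 _] := hB t u a; apply: h1; rewrite ht (negPf hu).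
  suff : pos A u + a * scale A + 1 <= L0 t by lia.
  apply: (hlo _ _ t ht) => t' ht'; have tu : t' != u by apply: contraNneq hu => <-.
  have := ha t' ht'; have := flE A t' u; have := fr_gt0 A tu; nia.
- move=> u a hu ha t ht; have [h1 _] := hB u t (a - (s u)%:Z + (s t)%:Z).
  suff : a - (s u)%:Z + (s t)%:Z <= fl B u t by lia.
  apply: h1; rewrite ht (negPf hu).
  suff : L0 t + (s t)%:Z * scale A <= pos A u - (a - (s u)%:Z) * scale A - 1 by lia.
  apply: (hhi _ _ t ht) => t' ht'; have tu : u != t' by apply: contraNneq hu => ->.
  have := ha t' ht'; have := flE A u t'; have := fr_gt0 A tu; nia.
Qed.

Lemma mirror A T : exists B, mirrored A B T /\ in_window A B T.
Proof.
have [->|T0] := eqVneq T set0.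
  exists A; split; first by move=> t t'; rewrite inE.
  by split=> // u a _ _ t; rewrite inE.
have [x hx hxm] := exists_min (pos A) T0.
have [z hz hzm] := exists_min (fun t => - (pos A t + (s t)%:Z * scale A)) T0.
(* The sum of the two ends of the window, the least start and the largest end. *)
pose c := pos A x + pos A z + (s z)%:Z * scale A.
have [||B [hP hB]] := @window A T (fun t => c - pos A t - (s t)%:Z * scale A) T0.
- move=> lo h t ht; have := h x hx; have := hzm t ht; rewrite /c; lia.
- move=> hi h t ht; have := h z hz; have := hxm t ht; rewrite /c; lia.
exists B; split=> // t t' ht ht' tt'.
have [h1 _] := hB t t' (fl A t' t + (s t')%:Z - (s t)%:Z) ht ht'.
have [_ h2] := hB t t' (fl A t' t + (s t')%:Z - (s t)%:Z + 1) ht ht'.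
have tt : t' != t by rewrite eq_sym.
have := flE A t' t; have := fr_gt0 A tt; have := frP A t' t => f1 f2 f3.
have : fl A t' t + (s t')%:Z - (s t)%:Z <= fl B t t' by apply: h1; lia.
have : fl B t t' < fl A t' t + (s t')%:Z - (s t)%:Z + 1 by apply: h2; lia.
by lia.
Qed.

Lemma collapse A T : exists B, in_window A B T /\ forall t t', t \in T -> t' \in T -> fl B t t' <= 0.
Proof.
have [->|T0] := eqVneq T set0.
  exists A; split; last by move=> t t'; rewrite inE.
  by split=> // u a _ _ t; rewrite inE.
have [x hx hxm] := exists_min (pos A) T0.
have [||B [hP hB]] := @window A T (fun t => pos A x) T0.
- by move=> lo h t ht; exact: h.
- move=> hi h t ht; have := h t ht; have := hxm t ht; lia.
exists B; split=> // t t' ht ht'.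
have [_ h2] := hB t t' 1 ht ht'; have := scale_gt0 A => N0.
have : fl B t t' < 1 by apply: h2; lia.
by lia.
Qed.

Lemma closedE A B T : same_side A B T -> closed_rows A T.
Proof.
move=> h u hu su; case: (h u hu su) => k; [constructor 1|constructor 2|constructor 3] => t ht;
by have /andP[-> _] := k t ht.
Qed.

Lemma TY_trans A B D T : same_side A B T -> same_side B D T -> (forall t, t \in T -> (0 < s t)%N) -> same_side A D T.
Proof.
move=> h1 h2 hp u hu su.
have [-> | /set0Pn [t0 ht0]] := eqVneq T set0; first by constructor 1 => t; rewrite inE.
have ut : u != t0 by apply: contraNneq hu => ->.
have st := hp _ ht0.
case: (h1 u hu su) => k1; case: (h2 u hu su) => k2.
- by constructor 1 => t ht; have /andP[-> _] := k1 t ht; have /andP[_ ->] := k2 t ht.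
- by exfalso; move: (k1 _ ht0) (k2 _ ht0); rewrite /covers /before (fl_anti B ut); lia.
- by exfalso; move: (k1 _ ht0) (k2 _ ht0); rewrite /covers /before (fl_anti B ut); lia.
- by exfalso; move: (k1 _ ht0) (k2 _ ht0); rewrite /covers /before (fl_anti B ut); lia.
- by constructor 2 => t ht; have /andP[-> _] := k1 t ht; have /andP[_ ->] := k2 t ht.
- by exfalso; move: (k1 _ ht0) (k2 _ ht0); rewrite /covers /before (fl_anti B ut); lia.
- by exfalso; move: (k1 _ ht0) (k2 _ ht0); rewrite /covers /before (fl_anti B ut); lia.
- by exfalso; move: (k1 _ ht0) (k2 _ ht0); rewrite /covers /before (fl_anti B ut); lia.
- by constructor 3 => t ht; have /andP[-> _] := k1 t ht; have /andP[_ ->] := k2 t ht.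
Qed.

(** One step of a contraction, the earlier row approaching the later one: outside the comparable
    range the weight is already maximal. *)
Lemma step_arith (a b : nat) (x : int) : (0 < a)%N -> (0 < b)%N -> x <= -1 ->
  overlap a b (x + 1) != overlap a b x ->
  [/\ (1 <= - 1 - x) && (1 <= - 1 - x + a%:Z - b%:Z) & overlap a b (x + 1) = overlap a b x + 1].
Proof.
move=> ha hb hx; have [h|h] := boolP ((1 <= - 1 - x) && (1 <= - 1 - x + a%:Z - b%:Z)).
  rewrite [overlap a b x]mm_right // => ne; split=> //; move: ne; rewrite /overlap; lia.
rewrite [overlap a b x]mm_mid //; last by apply/negP; lia.
by rewrite mm_mid ?eqxx //; apply/negP; move: h; lia.
Qed.

Lemma step_arith_same (a b : nat) (x : int) : (0 < a)%N -> (0 < b)%N -> x <= -1 ->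
  overlap a b (x + 1) = overlap a b x -> x + 1 <= 0 ->
  ((1 <= - 1 - x) && (1 <= - 1 - x + a%:Z - b%:Z)) =
  ((1 <= - 1 - (x + 1)) && (1 <= - 1 - (x + 1) + a%:Z - b%:Z)).
Proof.
move=> ha hb hx hm hx1; have [h|h] := boolP ((1 <= - 1 - x) && (1 <= - 1 - x + a%:Z - b%:Z)); last first.
  by symmetry; apply/negP; move: h; lia.
symmetry; apply/idP; apply: contraT => h'.
move: hm; rewrite [overlap a b x]mm_right // mm_mid //; last by apply/negP; lia.
by move: h h'; lia.
Qed.

End Geometry.

(** * Invariance of the polynomial under reflections *)

Section Reflect.
Variables (n : nat) (R : idomainType) (q : R) (vmax smax : nat) (y : nat -> R).
Hypothesis q0 : q != 0.
Local Notation F := (llt_sum q vmax smax y).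
Variable s : 'I_n -> nat.
Hypothesis hS : (\sum_h s h <= smax)%N.
Hypothesis IH : forall s' : 'I_n -> nat, (\sum_h s' h = \sum_h s h)%N ->
  (\sum_h s h ^ 2 < \sum_h s' h ^ 2)%N ->
  forall A B : alcove n, same_graph s' A B -> F s' (fl A) = F s' (fl B).
Local Notation same_side := (same_side s).
Local Notation mirrored := (mirrored s).
Local Notation in_window := (in_window s).
Local Notation closed_rows := (closed_rows s).
Implicit Types (A B : alcove n) (i j h u v t : 'I_n) (T : {set 'I_n}).

Let sS h : (s h <= smax)%N.
Proof. by apply: leq_trans hS; rewrite (bigD1 h) //= leq_addr. Qed.

Definition raised A B i j := [/\ left_of s A i j, ~~ left_of s B j i, weight s B i j = weight s A i j + 1,
  (forall a b, a != b -> off i j a b -> weight s A a b = weight s B a b) &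
  (forall a b, (0 < s a)%N -> (0 < s b)%N -> off i j a b -> left_of s A a b = left_of s B a b)].

Lemma merge_sum i j m : i != j -> (m <= s i + s j)%N -> (\sum_h merge s i j m h = \sum_h s h)%N.
Proof.
move=> ij hm; have ji : j != i by rewrite eq_sym.
rewrite (bigD1 i) //= (bigD1 j) //= [RHS](bigD1 i) //= [X in _ = (_ + X)%N](bigD1 j) //=.
rewrite /merge eqxx (negPf ji) eqxx.
rewrite (eq_bigr s); first by rewrite !addnA; congr (_ + _)%N; lia.
by move=> h /andP[/negPf -> /negPf ->].
Qed.

Lemma merge_sq i j m : i != j -> (m < s i)%N -> (m < s j)%N ->
  (\sum_h s h ^ 2 < \sum_h merge s i j m h ^ 2)%N.
Proof.
move=> ij h1 h2; have ji : j != i by rewrite eq_sym.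
rewrite (bigD1 i) //= (bigD1 j) //= [X in (_ < X)%N](bigD1 i) //= [X in (_ < _ + X)%N](bigD1 j) //=.
rewrite /merge eqxx (negPf ji) eqxx.
rewrite [X in (_ < _ + (_ + X))%N](eq_bigr (fun h => (s h ^ 2)%N)); last first.
  by move=> h /andP[/negPf -> /negPf ->].
rewrite !addnA ltn_add2r; nia.
Qed.

Lemma left_lt A i j : (0 < s i)%N -> (0 < s j)%N -> left_of s A i j ->
  (`|weight s A i j| < s i)%N /\ (`|weight s A i j| < s j)%N.
Proof.
by move=> si sj hl; rewrite /weight mm_left //; move: hl; rewrite /left_of; lia.
Qed.

(* The merged strips arising on the two sides have isomorphic graphs. *)
Lemma raised_F A B A2 B2 i j : i != j -> (0 < s i)%N -> (0 < s j)%N ->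
  raised A B i j -> raised A2 B2 j i -> same_graph s A A2 ->
  F s (fl B) = F s (fl B2) -> F s (fl A) = F s (fl A2).
Proof.
move=> ij si sj [a1 a2 a3 a4 a5] [b1 b2 b3 b4 b5] hM hF; have ji : j != i by rewrite eq_sym.
have [D [c1 c2 c3 c4]] := F_step q vmax y hS ij si sj a1 a2 a3 a4 a5.
have [D2 [d1 d2 d3 d4]] := F_step q vmax y hS ji sj si b1 b2 b3 b4 b5.
have em : weight s A2 j i = weight s A i j by rewrite hM // meet_sym.
rewrite em in d1 d2 d3 d4.
set m := `|weight s A i j|%N in c1 c2 c3 c4 d1 d2 d3 d4.
have [m1 m2] := left_lt si sj a1; rewrite -/m in m1 m2.
(* The union sits at index [i] on one side and at index [j] on the other; the transposition matches
   them. *)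
have es : merge s j i m =1 (fun h => merge s i j m (tperm i j h)).
  move=> h; rewrite /merge; case: tpermP => [->|->|]; rewrite ?eqxx ?(negPf ij) ?(negPf ji) //.
    by rewrite addnC.
  by move=> /eqP/negPf -> /eqP/negPf ->.
have et : (fun h => merge s j i m (tperm i j h)) =1 merge s i j m.
  by move=> h; rewrite es tpermK.
have eF : F (merge s i j m) (fl D) = F (merge s j i m) (fl D2).
  rewrite -(@F_relabel n R q vmax smax y (merge s j i m) (fl D2) (tperm i j)); last exact: perm_inj.
  rewrite (F_sizes _ _ _ _ _ et).
  apply: (IH (merge_sum ij _) (merge_sq ij m1 m2) (B := relabel D2 (@perm_inj _ (tperm i j)))); first lia.
  have key h : h != i -> h != j ->
    weight (merge s i j m) D h i = weight (merge s j i m) D2 h j /\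
    weight (merge s i j m) D h j = weight (merge s j i m) D2 h i.
    move=> hi hj; have [e1 e2] := c4 h hi hj; have [e3 e4] := d4 h hj hi.
    rewrite e2 e4 e1 e3 !hM //; split; last by rewrite [Num.min (weight s A2 h j) _]minC.
    by rewrite [Num.min (weight s A2 h j) _]minC [weight s A2 h j + _]addrC.
  have rel a b : weight (merge s i j m) (relabel D2 (@perm_inj _ (tperm i j))) a b =
      weight (merge s j i m) D2 (tperm i j a) (tperm i j b).
    by rewrite /weight fl_relabel !es !tpermK.
  have base a b : a != b -> (b == i) || (b == j) || ((a != i) && (a != j)) ->
     weight (merge s i j m) D a b = weight (merge s i j m) (relabel D2 (@perm_inj _ (tperm i j))) a b.
    move=> ab; rewrite rel; have [eb|bi] := eqVneq b i => /=.
      subst b; rewrite tpermL; have [->|aj] := eqVneq a j.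
        by rewrite tpermR [LHS]meet_sym // c2 [RHS]meet_sym // d2.
      by move=> _; rewrite tpermD 1?eq_sym //; have [] := key a.
    have [eb|bj] := eqVneq b j => /=.
      subst b; rewrite tpermR; have [->|ai] := eqVneq a i.
        by rewrite tpermL c2 d2.
      by move=> _; rewrite tpermD 1?eq_sym //; have [] := key a.
    case/andP=> ai aj; rewrite !tpermD 1?eq_sym // c3 // d3 // hM //.
  move=> a b ab; have [|] := boolP ((b == i) || (b == j) || ((a != i) && (a != j))); first exact: base.
  rewrite -negb_or -[a == i]negbK => h; rewrite [LHS]meet_sym // [RHS]meet_sym //.
  by apply: base; rewrite 1?eq_sym //; move: h; do ![case: eqP].
(* The merged terms of the two wall formulas cancel, and then the factor [q]. *)
by apply: (mulfI q0); move: hF; rewrite c1 d1 eF => /addIr.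
Qed.

(* B0 is the configuration with T contracted, towards which A is moved. *)
Lemma reflect_aux B0 T : (forall t, t \in T -> (0 < s t)%N) ->
  (forall t t', t \in T -> t' \in T -> fl B0 t t' <= 0) ->
  forall A A', same_outside A B0 T -> same_side A B0 T -> mirrored A A' T -> same_outside A A' T -> same_side A A' T ->
  F s (fl A) = F s (fl A').
Proof.
move=> hp h0 A; have [d] := ubnP (dist A B0); elim: d A => // d IHd A hd A' hE hT hm hE' hT'.
case: (boolP [exists i, exists j, fl A i j != fl B0 i j]) => [/existsP [i /existsP [j hij]]|]; last first.
  (* In the contracted position no two rows of [T] are comparable, so the mirror image has the same
     order. *)
  move=> /existsPn h; have e i j : fl A i j = fl B0 i j.
    by have /existsPn /(_ j) := h i; rewrite negbK => /eqP.
  apply: F_conv => //.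
    move=> a b ab; have [/andP[ha hb]|nab] := boolP ((a \in T) && (b \in T)).
      by have [] := mir_meet hm ha hb ab.
    by have [] := TY_same hE' hT' hp ab nab.
  move=> a b sa sb; have [->|ab] := eqVneq a b; first by rewrite /left_of !fl_ii.
  have [/andP[ha hb]|nab] := boolP ((a \in T) && (b \in T)); last first.
    by have [_ ->] := TY_same hE' hT' hp ab nab.
  have [_ e1] := mir_meet hm ha hb ab; have ba : b != a by rewrite eq_sym.
  have [_ e2] := mir_meet hm hb ha ba; rewrite -e2 /left_of !e.
  by have := h0 a b ha hb; have := h0 b a hb ha; lia.
have [|A1 [a [b [k [w hk hd']]]]] := @cross _ A B0; first by exists i, j.
have ab := wall_neq w; have ba : b != a by rewrite eq_sym.
have wg := wall_g w; have wf := wall_f w; have wg' := wall_g' w; have wf' := wall_f' w.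
have hB0 : fl B0 a b = - 1 - fl B0 b a by apply: fl_anti.
have hE1 : same_outside A A1 T.
  move=> u v hu hv; case: (pairP u v ab) => [[? ?]|[? ?]|[n1 n2]]; subst.
  - by have := hE _ _ hv hu; lia.
  - by have := hE _ _ hu hv; lia.
  - by rewrite (wall_off w).
have hE10 : same_outside A1 B0 T by move=> u v hu hv; rewrite -hE1 // hE.
have btw u t : u \notin T -> t \in T ->
   (fl A u t <= fl A1 u t <= fl B0 u t) || (fl B0 u t <= fl A1 u t <= fl A u t).
  move=> hu ht; case: (pairP u t ab) => [[? ?]|[? ?]|[n1 n2]]; subst.
  - by lia.
  - by lia.
  - by rewrite (wall_off w) //; lia.
have hT01 : same_side A A1 T /\ same_side A1 B0 T.
  split=> u hu su; case: (hT u hu su) => h; [constructor 1|constructor 2|constructor 3|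
     constructor 1|constructor 2|constructor 3] => t ht; have := h t ht; have := btw u t hu ht;
  have ut : u != t by [apply: contraNneq hu => ->];
  rewrite /covers /before ?[fl _ t u]fl_anti 1?eq_sym //;
  rewrite ?[fl A1 t u]fl_anti 1?eq_sym //; rewrite ?[fl B0 t u]fl_anti 1?eq_sym //; lia.
have [hT1 hT10] := hT01.
(* [A1] is mirrored afresh: [A1'] need not be adjacent to [A'], only its weights and order are
   compared with those of [A']. *)
have [A1' [hm1 hP1]] := mirror s A1 T.
have hT1' : same_side A1 A1' T by apply: Pres_TY hP1; apply: closedE hT10.
have hE1' : same_outside A1 A1' T by case: hP1.
have IH1 : F s (fl A1) = F s (fl A1') by apply: (IHd A1) => //; lia.
have hE'' : same_outside A' A1' T by move=> u v hu hv; rewrite -hE' // hE1 // hE1'.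
have hT'' : same_side A' A1' T.
  by apply: (TY_trans (TYC hT') _ hp); apply: (TY_trans hT1 hT1' hp).
have offT c e : c \in T -> e \in T -> c != e -> off a b c e ->
   [/\ weight s A c e = weight s A1 c e, weight s A' c e = weight s A1' c e,
       left_of s A c e = left_of s A1 c e & left_of s A' c e = left_of s A1' c e].
  move=> hc he ce [n1 n2]; have ec : e != c by rewrite eq_sym.
  have [e1 e2] := wall_meet s w n1 n2.
  have [e3 e4] : weight s A1 e c = weight s A e c /\ left_of s A1 e c = left_of s A e c.
    by apply: (wall_meet s w); rewrite andbC.
  have [f1 f2] := mir_meet hm hc he ce; have [f3 f4] := mir_meet hm he hc ec.
  have [g1 g2] := mir_meet hm1 hc he ce; have [g3 g4] := mir_meet hm1 he hc ec.
  by split; rewrite -?f1 -?g1 -?f4 -?g4 ?e1 ?e2 ?e4.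
have [/andP[ha hb]|nab] := boolP ((a \in T) && (b \in T)); last first.
  have hM1 : weight s A a b = weight s A1 a b by have [] := TY_same hE1 hT1 hp ab nab.
  have -> : F s (fl A) = F s (fl A1).
    by symmetry; apply: (F_commute _ _ _ w) => //; move: hM1; rewrite /weight wf wg.
  rewrite IH1; symmetry; apply: F_conv => //.
    move=> c e ce; have [/andP[hc he]|nce] := boolP ((c \in T) && (e \in T)); last first.
      by have [] := TY_same hE'' hT'' hp ce nce.
    have [] // := offT c e hc he ce.
    by split; apply/negP => /andP[/eqP ? /eqP ?]; subst; move: nab; rewrite ?hc ?he.
  move=> c e sc se; have [->|ce] := eqVneq c e; first by rewrite /left_of !fl_ii.
  have [/andP[hc he]|nce] := boolP ((c \in T) && (e \in T)); last first.
    by have [_ ->] := TY_same hE'' hT'' hp ce nce.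
  have [] // := offT c e hc he ce.
  by split; apply/negP => /andP[/eqP ? /eqP ?]; subst; move: nab; rewrite ?hc ?he.
have sa := hp a ha; have sb := hp b hb.
have xA : fl A b a <= -1 by have := h0 b a hb ha; clear -hk wg; lia.
have xA1 : fl A1 b a = fl A b a + 1 by clear -wf wg; lia.
have [m1 l1] := mir_meet hm ha hb ab; have [m2 l2] := mir_meet hm hb ha ba.
have [m3 l3] := mir_meet hm1 ha hb ab; have [m4 l4] := mir_meet hm1 hb ha ba.
have lab : left_of s A a b = false /\ left_of s A1 a b = false.
  by split; apply/negP => /andP[c _]; clear -c xA xA1; lia.
have [eqm|neqm] := eqVneq (weight s A1 a b) (weight s A a b).
  have -> : F s (fl A) = F s (fl A1).
    by symmetry; apply: (F_commute _ _ _ w) => //; move: eqm; rewrite /weight wf wg.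
  have lba : left_of s A b a = left_of s A1 b a.
    have em : overlap (s a) (s b) (fl A b a + 1) = overlap (s a) (s b) (fl A b a) by rewrite -xA1.
    have le0 : fl A b a + 1 <= 0 by clear -xA; lia.
    rewrite /left_of (fl_anti A ab) (fl_anti A1 ab) xA1.
    exact: (step_arith_same sa sb xA em le0).
  rewrite IH1; symmetry; apply: F_conv => //.
    move=> c e ce; have [/andP[hc he]|nce] := boolP ((c \in T) && (e \in T)); last first.
      by have [] := TY_same hE'' hT'' hp ce nce.
    case: (pairP c e ab) => [[? ?]|[? ?]|hof]; last by have [] := offT c e hc he ce hof.
      by subst; rewrite -m1 -m3.
    by subst; rewrite -m2 -m4 [LHS]meet_sym // [RHS]meet_sym.
  move=> c e sc se; have [->|ce] := eqVneq c e; first by rewrite /left_of !fl_ii.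
  have [/andP[hc he]|nce] := boolP ((c \in T) && (e \in T)); last first.
    by have [_ ->] := TY_same hE'' hT'' hp ce nce.
  case: (pairP c e ab) => [[? ?]|[? ?]|hof]; last by have [] := offT c e hc he ce hof.
    by subst; rewrite -l2 -l4.
  by subst; rewrite -l1 -l3; case: lab => -> ->.
(* In the mirror image the same pair is raised, with [a] and [b] exchanged. *)
have [l5 m5] : left_of s A b a /\ weight s A1 a b = weight s A a b + 1.
  move: neqm; rewrite /weight xA1 => neqm.
  by have [] := step_arith sa sb xA neqm; rewrite /left_of (fl_anti A ab).
have r1 : raised A A1 b a.
  split.
  + exact: l5.
  + by case: lab => _ ->.
  + by rewrite meet_sym // m5 meet_sym.
  + by move=> c e ce [n1 n2]; have [] := wall_meet s w n2 n1.
  + by move=> c e sc se [n1 n2]; have [] := wall_meet s w n2 n1.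
have r2 : raised A' A1' a b.
  split.
  + by rewrite -l2.
  + by rewrite -l3; case: lab => _ ->.
  + by rewrite -m3 -m1.
  + move=> c e ce hof; have [/andP[hc he]|nce] := boolP ((c \in T) && (e \in T)).
      by have [] := offT c e hc he ce hof.
    by have [] := TY_same hE'' hT'' hp ce nce.
  + move=> c e sc se hof; have [->|ce] := eqVneq c e; first by rewrite /left_of !fl_ii.
    have [/andP[hc he]|nce] := boolP ((c \in T) && (e \in T)).
      by have [] := offT c e hc he ce hof.
    by have [_ ->] := TY_same hE'' hT'' hp ce nce.
apply: (raised_F ba sb sa r1 r2 _ IH1).
move=> c e ce; have [/andP[hc he]|nce] := boolP ((c \in T) && (e \in T)).
  by have [] := mir_meet hm hc he ce.
by have [] := TY_same hE' hT' hp ce nce.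
Qed.

Lemma reflection A T : (forall t, t \in T -> (0 < s t)%N) -> closed_rows A T ->
  exists B, [/\ mirrored A B T, in_window A B T, same_graph s A B & F s (fl A) = F s (fl B)].
Proof.
move=> hp hc; have [B [hm hP]] := mirror s A T; have [B0 [hP0 h0]] := collapse s A T.
have hT := Pres_TY hc hP; have hT0 := Pres_TY hc hP0.
have hE : same_outside A B T by case: hP. have hE0 : same_outside A B0 T by case: hP0.
exists B; split=> //; last exact: (reflect_aux hp h0).
move=> c e ce; have [/andP[hc' he]|nce] := boolP ((c \in T) && (e \in T)).
  by have [] := mir_meet hm hc' he ce.
by have [] := TY_same hE hT hp ce nce.
Qed.

End Reflect.

(** * Orders with the same graph *)

Section Order.
Variables (n : nat) (s : 'I_n -> nat).
Implicit Types (A B X Y : alcove n) (a b c u v t : 'I_n) (T : {set 'I_n}).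
Local Notation left := (left_of s).
Local Notation meet := (weight s).
Local Notation cov := (covers s).
Local Notation bef := (before s).

Lemma left_trans X a b c : left X a b -> left X b c -> left X a c.
Proof. by rewrite /left_of => h1 h2; have := fl_triP X c b a; lia. Qed.

Lemma left_neq X a b : left X a b -> a != b.
Proof. by apply: contraTneq => ->; rewrite /left_of fl_ii. Qed.

Lemma left_asym X a b : left X a b -> left X b a = false.
Proof. by move=> h; have := fl_anti X (left_neq h); move: h; rewrite /left_of; lia. Qed.

Definition comparable X a b := left X a b || left X b a.

Lemma nfC X a b : comparable X a b = comparable X b a.
Proof. by rewrite /comparable orbC. Qed.

Lemma nf_meet X a b : a != b -> (0 < s a)%N -> (0 < s b)%N ->
  comparable X a b = (meet X a b < Num.min (s a)%:Z (s b)%:Z).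
Proof.
move=> ab sa sb; rewrite /comparable /weight.
have [h|h] := boolP (left X a b).
  by rewrite mm_left //; move: h; rewrite /left_of; lia.
have [h'|h'] := boolP (left X b a).
  move: h'; rewrite /left_of (fl_anti X ab) => h'.
  by rewrite mm_right //; move: h'; lia.
move: h h'; rewrite /left_of (fl_anti X ab) => h h'.
by rewrite mm_mid //; lia.
Qed.

Lemma nf_same X Y a b : same_graph s X Y -> (0 < s a)%N -> (0 < s b)%N -> comparable X a b = comparable Y a b.
Proof.
move=> hM sa sb; have [->|ab] := eqVneq a b; first by rewrite /comparable /left_of !fl_ii.
by rewrite !nf_meet // hM.
Qed.

Lemma adjE X a b : a != b -> (0 < s a)%N -> (0 < s b)%N ->
  (0 < meet X a b) = (fl X b a < (s a)%:Z) && (fl X a b < (s b)%:Z).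
Proof. by move=> ab sa sb; rewrite /weight /overlap (fl_anti X ab); lia. Qed.

Lemma meet_ge0 X a b : 0 <= meet X a b.
Proof. by rewrite /weight /overlap; lia. Qed.

Lemma bef_left X a b : bef X a b -> (0 < s a)%N -> (0 < s b)%N -> left X a b.
Proof. by rewrite /before /left_of; lia. Qed.

Lemma nadj_bef X a b : a != b -> (0 < s a)%N -> (0 < s b)%N -> ~~ (0 < meet X a b) ->
  bef X a b || bef X b a.
Proof. by move=> ab sa sb; rewrite adjE // /before; lia. Qed.

Lemma left_bef X a b : (0 < s a)%N -> (0 < s b)%N -> ~~ (0 < meet X a b) -> left X a b -> bef X a b.
Proof.
move=> sa sb h hl; have ab := left_neq hl; move: h hl; rewrite adjE // /before /left_of (fl_anti X ab); lia.
Qed.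

Lemma bef_nadj X a b : a != b -> (0 < s a)%N -> (0 < s b)%N -> bef X a b -> ~~ (0 < meet X a b).
Proof. by move=> ab sa sb; rewrite adjE // /before; lia. Qed.

Lemma bef_trans X a b c : bef X a b -> bef X b c -> bef X a c.
Proof. by rewrite /before => h1 h2; have := fl_triP X c b a; lia. Qed.

Definition btw X a b c := (left X a b && left X b c) || (left X c b && left X b a).

Lemma left_meet X a b c : (0 < s a)%N -> (0 < s b)%N -> (0 < s c)%N -> left X a b -> left X b c ->
  0 < meet X a c -> meet X a c < meet X a b /\ meet X a c < meet X b c.
Proof.
move=> sa sb sc h1 h2; have h3 := left_trans h1 h2.
rewrite /weight !mm_left //; have := fl_triP X c b a; move: h1 h2 h3; rewrite /left_of; lia.
Qed.

Lemma btw_meet X a b c : (0 < s a)%N -> (0 < s b)%N -> (0 < s c)%N -> btw X a b c ->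
  0 < meet X a c -> meet X a c < meet X a b /\ meet X a c < meet X b c.
Proof.
move=> sa sb sc /orP[/andP[h1 h2]|/andP[h1 h2]]; first exact: left_meet.
have n1 := left_neq h1; have n2 := left_neq h2; have n3 := left_neq (left_trans h1 h2).
rewrite [meet X a c]meet_sym 1?[meet X a b]meet_sym 1?[meet X b c]meet_sym 1?eq_sym // => h.
by have [] := left_meet sc sb sa h1 h2 h.
Qed.

(* The middle one of three pairwise comparable rows meets both others in more
   cells than these meet each other, unless the latter are disjoint. *)
Lemma btw_swap X Y a b c : same_graph s X Y -> (0 < s a)%N -> (0 < s b)%N -> (0 < s c)%N ->
  btw X a b c -> btw Y a c b -> ~~ (0 < meet Y a b) /\ ~~ (0 < meet Y a c).
Proof.
move=> hM sa sb sc h1 h2.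
have ab : a != b by case/orP: h1 => /andP[p1 p2]; [exact: left_neq p1 | rewrite eq_sym; exact: left_neq p2].
have ac : a != c by case/orP: h2 => /andP[p1 p2]; [exact: left_neq p1 | rewrite eq_sym; exact: left_neq p2].
have bc : b != c by case/orP: h1 => /andP[p1 p2]; [exact: left_neq p2 | rewrite eq_sym; exact: left_neq p1].
have := btw_meet sa sb sc h1; have := btw_meet sa sc sb h2; rewrite !hM //.
have := meet_ge0 Y a b; have := meet_ge0 Y a c.
case: (ltP 0 (meet Y a b)) => // p1; case: (ltP 0 (meet Y a c)) => // p2 _ _ k1 k2.
- by have [] := k1 isT; have [] := k2 isT; lia.
- by have [] := k1 isT; lia.
- by have [] := k2 isT; lia.
Qed.

Section Colour.
Variables (X Y : alcove n).
Hypothesis hM : same_graph s X Y.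

(** In lemma names, pairs ordered alike in [X] and [Y] are red, reversed ones blue, incomparable
    ones full ([nf] is not full). *)
Definition same_dir a b := (left X a b && left Y a b) || (left X b a && left Y b a).
Definition opp_dir a b := (left X a b && left Y b a) || (left X b a && left Y a b).

Lemma redC a b : same_dir a b = same_dir b a. Proof. by rewrite /same_dir orbC. Qed.
Lemma blueC a b : opp_dir a b = opp_dir b a. Proof. by rewrite /opp_dir orbC. Qed.

Lemma nf_colour a b : (0 < s a)%N -> (0 < s b)%N -> comparable X a b -> same_dir a b || opp_dir a b.
Proof.
move=> sa sb h; have := h; rewrite (nf_same hM) //; move: h; rewrite /comparable /same_dir /opp_dir.
by case: (left X a b); case: (left X b a); case: (left Y a b); case: (left Y b a).
Qed.

Lemma red_nf a b : same_dir a b -> comparable X a b.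
Proof. by rewrite /comparable => /orP[] /andP[-> _]; rewrite ?orbT. Qed.
Lemma blue_nf a b : opp_dir a b -> comparable X a b.
Proof. by rewrite /comparable => /orP[] /andP[-> _]; rewrite ?orbT. Qed.

Lemma red_blue a b : same_dir a b -> opp_dir a b = false.
Proof.
case/orP=> /andP[h1 h2]; rewrite /opp_dir h1 h2 (left_asym h1) (left_asym h2) //.
Qed.

Lemma redP a b : same_dir a b -> left X a b = left Y a b.
Proof. by case/orP=> /andP[h1 h2]; rewrite ?h1 ?h2 // (left_asym h1) (left_asym h2). Qed.

Lemma blueP a b : opp_dir a b -> left X a b = left Y b a.
Proof. by case/orP=> /andP[h1 h2]; rewrite ?h1 ?h2 // (left_asym h1) (left_asym h2). Qed.

Lemma full_side Z a b c : ~~ comparable Z a b -> comparable Z a c -> comparable Z b c -> left Z a c = left Z b c.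
Proof.
rewrite /comparable negb_or => /andP[n1 n2] /orP[] h1 /orP[] h2; rewrite ?h1 ?h2 //.
- by rewrite (left_trans h1 h2) in n1.
- by rewrite (left_trans h2 h1) in n2.
- by rewrite (left_asym h1) (left_asym h2).
Qed.

(* With full pairs as a third colour there is no rainbow triangle. *)

Lemma full_red a b c : (0 < s a)%N -> (0 < s b)%N -> (0 < s c)%N -> ~~ comparable X a b -> comparable X b c -> same_dir a c -> same_dir b c.
Proof.
move=> sa sb sc h1 h2 h3; have h4 := red_nf h3.
have e1 := full_side h1 h4 h2.
have h2' : comparable Y b c by rewrite -(nf_same hM).
have e2 : left Y a c = left Y b c.
  by apply: full_side => //; rewrite -(nf_same hM).
have e3 := redP h3; move: h2 h2'; rewrite /comparable /same_dir -e1 -e2 e3.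
by case: (left Y a c) => //= -> ->.
Qed.

Variable T : {set 'I_n}.
Hypothesis hp : forall t, t \in T -> (0 < s t)%N.

Definition blue_edge a b := [&& a \in T, b \in T & opp_dir a b].
Definition adj_edge a b := [&& a \in T, b \in T & 0 < meet X a b].

Lemma connect_stable (e : rel 'I_n) (P : pred 'I_n) x y :
  (forall a b, P a -> e a b -> P b) -> P x -> connect e x y -> P y.
Proof.
move=> h hx /connectP[p hpth ->]; elim: p x hx hpth => //= z p IH x hx /andP[hz hpth].
by apply: (IH z) => //; apply: h hz.
Qed.

Lemma connect_exit (e : rel 'I_n) (P : pred 'I_n) x y :
  P x -> ~~ P y -> connect e x y -> exists a b, [/\ e a b, P a & ~~ P b].
Proof.
move=> hx hy /connectP[p + ey]; rewrite ey in hy.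
elim: p x hx hy {ey} => /= [x -> //|z p IH x hx hy /andP[hz hpth]].
have [pz|npz] := boolP (P z); last by exists x, z.
exact: (IH z).
Qed.

Lemma eblue_sym : symmetric blue_edge.
Proof. by move=> a b; rewrite /blue_edge blueC andbCA. Qed.

Definition opp_comp b0 := [set t in T | connect blue_edge b0 t].

Section Comp.
Variables b0 b1 : 'I_n.
Hypothesis b01 : blue_edge b0 b1.
Let C := opp_comp b0.

Lemma comp_sub t : t \in C -> t \in T.
Proof. by rewrite inE => /andP[]. Qed.

Lemma comp_b0 : b0 \in C.
Proof. by case/and3P: b01 => h _ _; rewrite inE h connect0. Qed.

Lemma comp_b1 : b1 \in C.
Proof. by case/and3P: (b01) => _ h _; rewrite inE h connect1. Qed.

Lemma comp_step a b : a \in C -> blue_edge a b -> b \in C.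
Proof.
rewrite !inE => /andP[_ h1] h2; case/and3P: (h2) => _ -> _ /=.
exact: connect_trans h1 (connect1 h2).
Qed.

Lemma comp_ind (P : pred 'I_n) c : c \in C -> P c ->
  (forall a b, a \in C -> b \in C -> P a -> opp_dir a b -> P b) -> forall a, a \in C -> P a.
Proof.
move=> hc Pc h a ha.
have hca : connect blue_edge c a.
  have : connect blue_edge c b0.
    by rewrite (sym_connect_sym eblue_sym); move: hc; rewrite inE => /andP[].
  by move/connect_trans; apply; move: ha; rewrite inE => /andP[].
have : (a \in C) && P a.
  apply: (connect_stable (P := fun z => (z \in C) && P z) _ _ hca); last by rewrite hc Pc.
  move=> u v /andP[hu Pu] huv; have hv := comp_step hu huv.
  by rewrite hv (h u v) //; case/and3P: huv.
by case/andP.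
Qed.

Lemma comp_nbr a : a \in C -> exists2 b, b \in C & opp_dir a b.
Proof.
move=> ha; have : [exists b, (b \in C) && opp_dir a b].
  move: a ha; apply: (comp_ind comp_b0).
    by apply/existsP; exists b1; rewrite comp_b1; case/and3P: b01.
  by move=> u v hu hv _ huv; apply/existsP; exists u; rewrite hu blueC.
by case/existsP => b /andP[]; exists b.
Qed.

Lemma comp_out u v : u \in T -> u \notin C -> v \in C -> comparable X u v -> same_dir u v.
Proof.
move=> hu huC hv h; have := nf_colour (hp hu) (hp (comp_sub hv)) h.
case/orP => // hb; case/negP: huC; apply: (comp_step hv).
by rewrite /blue_edge hu (comp_sub hv) blueC hb.
Qed.

(* The connected components C of the graph of reordered pairs are modules. *)
Lemma comp_side u v0 : u \in T -> u \notin C -> v0 \in C -> comparable X u v0 ->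
  forall v, v \in C -> [/\ same_dir u v, ~~ (0 < meet X u v) & left X u v = left X u v0].
Proof.
move=> hu huC hv0 h0; have su := hp hu.
have main v : v \in C -> same_dir u v && (left X u v == left X u v0).
  move: v; apply: (comp_ind hv0); first by rewrite eqxx andbT comp_out.
  move=> a b ha hb /andP[ra /eqP la] hab.
  have sa := hp (comp_sub ha); have sb := hp (comp_sub hb).
  have rb : same_dir u b.
    apply: comp_out => //; apply: contraT => nub.
    have : same_dir b a by apply: (full_red (a := u)) => //; rewrite nfC; exact: blue_nf.
    by move/red_blue; rewrite blueC hab.
  (* If [a] and [b] lay on different sides of [u], then [u] would separate them in both alcoves and
     the pair would not be reordered. *)
  rewrite rb -la /=; apply: contraT => hne.
  have : same_dir a b.
    have e1 := redP ra; have e2 := redP rb; have := red_nf ra; have := red_nf rb.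
    rewrite /comparable; move: hne; case h1: (left X u a); case h2: (left X u b) => //= _ h3 h4.
    - rewrite /same_dir (left_trans h3 h1); move: (red_nf rb); rewrite (nf_same hM) // /comparable -e2 h2 /= => h5.
      by rewrite (left_trans h5) ?orbT // -e1.
    - rewrite /same_dir (left_trans h4 h2); move: (red_nf ra); rewrite (nf_same hM) // /comparable -e1 h1 /= => h5.
      by rewrite (left_trans h5) ?orbT // -e2.
  by move/red_blue; rewrite hab.
move=> v hv; have /andP[rv /eqP lv] := main v hv; split=> //.
have [w hw vw] := comp_nbr hv; have /andP[rw /eqP lw] := main w hw.
have sv := hp (comp_sub hv); have sw := hp (comp_sub hw).
have e1 := redP rv; have e2 := redP rw.
have nv := red_nf rv; have nw := red_nf rw.
have nv' : comparable Y u v by rewrite -(nf_same hM).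
have nw' : comparable Y u w by rewrite -(nf_same hM).
have e3 : left X u v = left X u w by rewrite lv lw.
have nvw := blue_nf vw; have bv := blueP vw; have wv : opp_dir w v by rewrite blueC.
have bw := blueP wv.
have hMY : same_graph s Y X by move=> a b ab; rewrite hM.
(* [u] stays on one side of the reordered pair [v], [w], so the middle one of the three rows changes
   and [btw_swap] makes [u] disjoint from both. *)
suff : (btw X u v w /\ btw Y u w v) \/ (btw X u w v /\ btw Y u v w).
  case=> [[k1 k2]|[k1 k2]]; first by have [] := btw_swap hMY su sw sv k2 k1.
  by have [] := btw_swap hMY su sv sw k2 k1.
move: nv nw nv' nw' nvw; rewrite /btw /comparable -e1 -e2 -bw -bv -e3.
case h1: (left X u v) => /=; case: (left X v w); case: (left X w v);
case: (left X v u); case: (left X w u); case: (left Y v u); case: (left Y w u) => //=; tauto.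
Qed.

(** The added rows are those that would obstruct a reflection of [C]: incomparable to all of it
    without covering it. By [hull_lo] and [hull_hi] they stay in the window spanned by [C]. *)
Definition comp_hull := C :|: [set v in T | [forall t in C, ~~ comparable X v t] && ~~ [forall t in C, cov X v t]].

Lemma hullTP v : v \in comp_hull -> v \notin C ->
  [/\ v \in T, forall t, t \in C -> ~~ comparable X v t & exists2 t, t \in C & ~~ cov X v t].
Proof.
rewrite !inE => /orP[-> //|/andP[hv /andP[/forallP h1 /forallPn [t ht]]]] _; split=> //.
  by move=> c hc; have := h1 c; rewrite hc.
by exists t; move: ht; rewrite negb_imply => /andP[].
Qed.

Lemma hull_sub v : v \in comp_hull -> v \in T.
Proof.
move=> h; have [hc|hc] := boolP (v \in C); first exact: comp_sub.
by have [] := hullTP h hc.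
Qed.

(** If [v] started before all of [C], a row [t0] it does not cover would end later and, being
    incomparable to [v], start within a unit of it. A row [t1] of [C] comparable to [t0] has no room
    to its left, and to its right it would be comparable to [v]. *)
Lemma hull_lo v : v \in comp_hull -> v \notin C -> exists2 t, t \in C & 0 <= fl X v t.
Proof.
move=> hv hvC; have [hT hf [t0 ht0 nc]] := hullTP hv hvC.
case: (boolP [exists t in C, 0 <= fl X v t]) => [/existsP[t /andP[h1 h2]]|]; first by exists t.
move=> /existsPn hlt; exfalso; case/negP: nc.
have lo t : t \in C -> fl X v t <= -1.
  by move=> ht; have := hlt t; rewrite ht /=; lia.
have [t1 ht1 b1'] := comp_nbr ht0; have := blue_nf b1'.
have n0 : v != t0 by apply: contraNneq hvC => ->.
have n1 : v != t1 by apply: contraNneq hvC => ->.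
have := hf t0 ht0; have := hf t1 ht1; have := lo t0 ht0; have := lo t1 ht1.
have := fl_triP X t1 t0 v; have := fl_triP X t0 t1 v.
rewrite /comparable /left_of /covers (fl_anti X n0) (fl_anti X n1).
have n2 : t0 != t1 by apply/eqP => e; move: (blue_nf b1'); rewrite e /comparable /left_of fl_ii.
rewrite (fl_anti X n2); lia.
Qed.

Lemma hull_hi v : v \in comp_hull -> v \notin C ->
  exists2 t, t \in C & 0 <= fl X t v + (s t)%:Z - (s v)%:Z.
Proof.
move=> hv hvC; have [hT hf [t0 ht0 nc]] := hullTP hv hvC.
case: (boolP [exists t in C, 0 <= fl X t v + (s t)%:Z - (s v)%:Z]) => [/existsP[t /andP[h1 h2]]|]; first by exists t.
move=> /existsPn hlt; exfalso; case/negP: nc.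
have lo t : t \in C -> fl X t v + (s t)%:Z - (s v)%:Z <= -1.
  by move=> ht; have := hlt t; rewrite ht /=; lia.
have [t1 ht1 b1'] := comp_nbr ht0; have := blue_nf b1'.
have n0 : v != t0 by apply: contraNneq hvC => ->.
have n1 : v != t1 by apply: contraNneq hvC => ->.
have := hf t0 ht0; have := hf t1 ht1; have := lo t0 ht0; have := lo t1 ht1.
have := fl_triP X t1 t0 v; have := fl_triP X t0 t1 v.
rewrite /comparable /left_of /covers (fl_anti X n0) (fl_anti X n1).
have n2 : t0 != t1 by apply/eqP => e; move: (blue_nf b1'); rewrite e /comparable /left_of fl_ii.
rewrite (fl_anti X n2); lia.
Qed.

(** A row of [T] outside the hull either covers [C] or, by [comp_side], is disjoint from [C] on one
    side. The hull stays in the window of [C], so this extends to the hull. *)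
Lemma hull_closed : closed_rows s X T -> closed_rows s X comp_hull.
Proof.
move=> hc u hu su; have [huT|huT] := boolP (u \in T); last first.
  by case: (hc u huT su) => h; [constructor 1|constructor 2|constructor 3] => t /hull_sub /h.
have huC : u \notin C by apply: contra hu => h; rewrite inE h.
have [/existsP[v0 /andP[hv0 h0]]|hall] := boolP [exists v in C, comparable X u v].
  have side := comp_side huT huC hv0 h0.
  have [hl|hl] := boolP (left X u v0).
    have bC v : v \in C -> bef X u v.
      by move=> hv; have [_ h1 h2] := side v hv; apply: left_bef; rewrite ?h2 //; exact: hp (comp_sub hv).
    constructor 3 => t ht; rewrite andbb; have [htC|htC] := boolP (t \in C); first exact: bC.
    have [w hw hlw] := hull_lo ht htC; have := bC w hw.
    by rewrite /before; have := fl_triP X t w u; lia.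
  have bC v : v \in C -> bef X v u.
    move=> hv; have [h0' h1 h2] := side v hv; have uv : u != v by apply: contraNneq huC => ->.
    apply: left_bef => //; rewrite -1?meet_sym //; first exact: hp (comp_sub hv).
    by have := red_nf h0'; rewrite /comparable h2 (negPf hl).
  constructor 2 => t ht; rewrite andbb; have [htC|htC] := boolP (t \in C); first exact: bC.
  have [w hw hlw] := hull_hi ht htC; have := bC w hw.
  by rewrite /before; have := fl_triP X u w t; lia.
have hf t : t \in C -> ~~ comparable X u t.
  by move=> ht; move/existsPn: hall => /(_ t); rewrite ht.
have cC t : t \in C -> cov X u t.
  move=> hin; move: hu; rewrite !inE negb_or huT /= => /andP[_]; rewrite negb_and negbK.
  have -> : [forall t in C, ~~ comparable X u t] by apply/forallP => c; apply/implyP; exact: hf.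
  by move=> /= /forallP /(_ t) /implyP /(_ hin).
constructor 1 => t ht; rewrite andbb; have [htC|htC] := boolP (t \in C); first exact: cC.
have [w hw hlw] := hull_lo ht htC; have [w' hw' hlw'] := hull_hi ht htC.
have := cC w hw; have := cC w' hw'; rewrite /covers.
by have := fl_triP X u t w; have := fl_triP X w' t u; lia.
Qed.

(** If [u] is comparable to [C], its colour passes by [full_red] to the added rows, which are
    incomparable to [C]. Otherwise [u] covers [C], hence also the added rows. *)
Lemma hull_out u t : u \in T -> u \notin comp_hull -> t \in comp_hull -> comparable X u t -> same_dir u t.
Proof.
move=> huT hu ht hn; have huC : u \notin C by apply: contra hu => h; rewrite inE h.
have [htC|htC] := boolP (t \in C); first exact: comp_out.
have [hT hf [c0 hc0 _]] := hullTP ht htC.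
have [/existsP[v0 /andP[hv0 h0]]|hall] := boolP [exists v in C, comparable X u v].
  have [r _ _] := comp_side huT huC hv0 h0 hv0; have sv := hp (comp_sub hv0).
  rewrite redC; apply: (full_red (a := v0)); rewrite 1?redC 1?nfC //; try exact: hp.
  exact: hf.
have hfu c : c \in C -> ~~ comparable X u c.
  by move=> hc; move/existsPn: hall => /(_ c); rewrite hc.
have cC c : c \in C -> cov X u c.
  move=> hin; move: hu; rewrite !inE negb_or huT /= => /andP[_]; rewrite negb_and negbK.
  have -> : [forall t in C, ~~ comparable X u t] by apply/forallP => c1; apply/implyP; exact: hfu.
  by move=> /= /forallP /(_ c) /implyP /(_ hin).
have [w hw hlw] := hull_lo ht htC; have [w' hw' hlw'] := hull_hi ht htC.
have ut : u != t by apply: contraNneq hu => ->.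
have := cC w hw; have := cC w' hw'; move: hn; rewrite /comparable /left_of /covers (fl_anti X ut).
by have := fl_triP X u t w; have := fl_triP X w' t u; rewrite (fl_anti X ut); lia.
Qed.

End Comp.
End Colour.
End Order.

(** * Extreme rows linked by reordered pairs *)

Section Span.
Variables (n : nat) (s : 'I_n -> nat).
Implicit Types (A B Z : alcove n) (a b c u v t : 'I_n).
Variables (X Y : alcove n) (T : {set 'I_n}).
Hypothesis hM : same_graph s X Y.
Hypothesis hp : forall t, t \in T -> (0 < s t)%N.
Local Notation red := (same_dir s X Y).
Local Notation blue := (opp_dir s X Y).
Local Notation eblue := (blue_edge s X Y T).
Local Notation eadj := (adj_edge s X T).
Local Notation bef := (before s).
Local Notation left := (left_of s).
Local Notation meet := (weight s).

Definition touch u k := (u == k) || (0 < meet X u k).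

(** Since the weights agree, betweenness may be taken in either alcove; the path argument below
    switches between the two. *)
Lemma touch_btw Z a b c u : same_graph s X Z -> (0 < s a)%N -> (0 < s b)%N -> (0 < s c)%N -> (0 < s u)%N ->
  btw s Z a c b -> touch u a -> touch u b -> touch u c.
Proof.
move=> hZ sa sb sc su hb; rewrite /touch.
have [//|uc] := eqVneq u c; rewrite /=.
have ac : a != c by case/orP: hb => /andP[p1 p2]; [exact: left_neq p1 | rewrite eq_sym; exact: left_neq p2].
have bc : b != c by case/orP: hb => /andP[p1 p2]; [rewrite eq_sym; exact: left_neq p2 | exact: left_neq p1].
have ab : a != b.
  by case/orP: hb => /andP[p1 p2]; have := left_neq (left_trans p1 p2); rewrite // eq_sym.
have hm := btw_meet sa sc sb hb.
have [->|ua] := eqVneq u a; rewrite /=.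
  rewrite (negPf ab) !hZ //= => _ /hm [h _].
  by have := meet_ge0 s Z a b; lia.
have [->|ub] := eqVneq u b; rewrite /=.
  have ba : b != a by rewrite eq_sym.
  rewrite !hZ // => h _; rewrite meet_sym // in h.
  by have [_] := hm h; rewrite [meet Z b c]meet_sym //; have := meet_ge0 s Z a b; lia.
rewrite !hZ // !adjE //.
case/orP: hb => /andP[]; rewrite /left_of.
  have := fl_triP Z u c a; have := fl_triP Z b c u; lia.
have := fl_triP Z u c b; have := fl_triP Z a c u; lia.
Qed.

Variables (x y : 'I_n).
Hypothesis hx : x \in T.
Hypothesis hy : y \in T.
Hypothesis hlo : forall t, t \in T -> t != x -> 0 <= fl X t x.
Hypothesis hhi : forall t, t \in T -> t != y -> 0 <= fl X y t + (s y)%:Z - (s t)%:Z.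
Hypothesis hr : red x y.

Lemma lo_left t : t \in T -> comparable s X x t -> left X x t.
Proof.
move=> ht /orP[//|h]; have tx := left_neq h; have := hlo ht tx.
by move: h; rewrite /left_of (fl_anti X tx); lia.
Qed.

Lemma hi_left t : t \in T -> comparable s X t y -> left X t y.
Proof.
move=> ht /orP[//|h]; have yt := left_neq h; have ty : t != y by rewrite eq_sym.
have := hhi ht ty; by move: h; rewrite /left_of (fl_anti X ty); lia.
Qed.

Hypothesis hadj : forall a b, a \in T -> b \in T -> connect eadj a b.
Hypothesis hcon : connect eblue x y.

Lemma ered_path p (k z : 'I_n) : red p z -> z \in T ->
  connect (fun a b => [&& eblue a b, red p a & red p b]) z k -> k \in T /\ red p k.
Proof.
move=> rz hz hk.
have : (k \in T) && red p k; last by case/andP.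
apply: (connect_stable (P := fun k => (k \in T) && red p k) _ _ hk); last by rewrite hz.
by move=> a b _ /and3P[/and3P[_ -> _] _ ->].
Qed.

(** The path must leave the red neighbours of [p]; at the exit the next row [b] is comparable to [p]
    by [full_red], hence blue. *)
Lemma exit_colour p (z w : 'I_n) : red p z -> z \in T -> p \in T -> connect eblue z p ->
  exists k b, [/\ eblue k b, red p k, blue p b &
   connect (fun a b => [&& eblue a b, red p a & red p b]) z k].
Proof.
move=> rz hz hpT hc.
have npz : ~~ connect (fun a b => [&& eblue a b, red p a & red p b]) z p.
  apply/negP => h; have [_ ] := ered_path rz hz h.
  by move/red_nf; rewrite /comparable /left_of fl_ii.
have [k [b [e1 e2 e3]]] := connect_exit (connect0 _ z) npz hc.
have [hk rk] := ered_path rz hz e2; have := e1; case/and3P=> _ hb kb.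
exists k, b; split=> //.
have nb : comparable s X p b.
  apply: contraT => np; have := full_red hM (hp hpT) (hp hb) (hp hk) np _ rk.
  rewrite nfC => /(_ (blue_nf kb)) /red_blue; by rewrite blueC kb.
case/orP: (nf_colour hM (hp hpT) (hp hb) nb) => // rb; case/negP: e3.
by apply: connect_trans e2 (connect1 _); rewrite e1 rk rb.
Qed.

(* If x and y, the two ends of T, are in the same order in X and Y but connected
   by reordered pairs, then a row that touches x and the last row of the connecting
   path that is reordered with x touches all later rows of the path. *)
Lemma spanning_dominator : exists2 u, u \in T & forall t, t \in T -> covers s X u t.
Proof.
have sx := hp hx; have sy := hp hy.
have xy : x != y by case/orP: (red_nf hr) => /left_neq //; rewrite eq_sym.
have yx : y != x by rewrite eq_sym.
have lxy : left X x y by apply: lo_left => //; exact: red_nf hr.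
have lxy' : left Y x y by rewrite -(redP hr).
have sb : symmetric eblue := eblue_sym s X Y T.
have hcon' : connect eblue y x by rewrite (sym_connect_sym sb).
have hr' : red y x by rewrite redC.
(* [b1] is reversed with [x], and [c1] below with [y]; in [Y] they enclose [x] and [y] from both
   sides. *)
have [k [b1 [kb rk xb ck]]] := exit_colour x hr hy hx hcon'.
have [k2 [c1 [kc rk2 yc _]]] := exit_colour x hr' hx hy hcon.
case/and3P: kb => hk hb1 kb; case/and3P: kc => hk2 hc1 kc.
have sk := hp hk; have sb1 := hp hb1; have sk2 := hp hk2; have sc1 := hp hc1.
have X_xb : left X x b1 by apply: lo_left => //; exact: blue_nf xb.
have Y_bx : left Y b1 x by rewrite -(blueP xb).
have X_xk : left X x k by apply: lo_left => //; exact: red_nf rk.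
have Y_xk : left Y x k by rewrite -(redP rk).
have Y_bk := left_trans Y_bx Y_xk.
have X_kb : left X k b1 by rewrite (blueP kb).
(* [X] orders [x, k, b1] and [Y] orders [b1, x, k]: the middle row changes. *)
have [_ nbx] : ~~ (0 < meet Y b1 k) /\ ~~ (0 < meet Y b1 x).
  by apply: (btw_swap hM) => //; rewrite /btw ?X_xk ?X_kb ?Y_bx ?Y_xk ?orbT.
have Y_by := left_trans Y_bx lxy'.
have X_by : left X b1 y.
  by apply: hi_left => //; rewrite (nf_same hM) // /comparable Y_by.
have [nyb nyx] : ~~ (0 < meet Y y b1) /\ ~~ (0 < meet Y y x).
  by apply: (btw_swap hM) => //; rewrite /btw ?X_xb ?X_by ?Y_bx ?lxy' ?orbT.
have X_cy : left X c1 y by apply: hi_left => //; rewrite nfC; exact: blue_nf yc.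
have Y_yc : left Y y c1 by move: X_cy; rewrite (blueP (X := X) (Y := Y)) // blueC.
have X_ky : left X k2 y by apply: hi_left => //; rewrite nfC; exact: red_nf rk2.
have Y_ky : left Y k2 y by rewrite -(redP (X := X)) // redC.
have Y_kc := left_trans Y_ky Y_yc.
have X_ck : left X c1 k2.
  by rewrite (blueP (X := X) (Y := Y)) // blueC.
have [_ ncy] : ~~ (0 < meet Y c1 k2) /\ ~~ (0 < meet Y c1 y).
  by apply: (btw_swap hM) => //; rewrite /btw ?X_ck ?X_ky ?Y_ky ?Y_yc ?orbT.
have Y_xc := left_trans lxy' Y_yc.
have X_xc : left X x c1.
  by apply: lo_left => //; rewrite (nf_same hM) // /comparable Y_xc.
have [nxc _] : ~~ (0 < meet Y x c1) /\ ~~ (0 < meet Y x y).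
  by apply: (btw_swap hM) => //; rewrite /btw ?X_xc ?X_cy ?lxy' ?Y_yc ?orbT.
have rxc : red x c1 by rewrite /same_dir X_xc Y_xc.
have b1y := left_neq X_by; have xb1 := left_neq X_xb.
have X_bbefy : bef X b1 y by apply: left_bef => //; rewrite meet_sym // hM // eq_sym.
have Y_xbefy : bef Y x y by apply: left_bef => //; rewrite meet_sym.
have Y_bbefx : bef Y b1 x by apply: left_bef.
(* A path of overlapping rows from [y] to [x] leaves the rows that come after [b1] in [X] and after
   [x] in [Y]; the exit row [u] will meet both [b1] and [x]. *)
have [a [u [au /and3P[ha ba xa] nu]]] : exists a u, [/\ eadj a u,
    [&& a \in T, bef X b1 a & bef Y x a] & ~~ [&& u \in T, bef X b1 u & bef Y x u]].
  apply: (connect_exit (P := fun p => [&& p \in T, bef X b1 p & bef Y x p]) (x := y) (y := x)).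
  - by rewrite hy X_bbefy.
  - by apply/negP => /and3P[_ _]; rewrite /before fl_ii => q; clear -sx q; lia.
  - exact: hadj.
case/and3P: au => _ hu au; have su := hp hu; have sa := hp ha.
have na : a != u by apply: contraTneq nu => <-; rewrite ha ba xa.
have ub : u != b1.
  apply: contraTneq au => ->; rewrite meet_sym ?bef_nadj //; last first.
    by have := left_neq (bef_left ba sb1 sa); rewrite eq_sym.
  exact: left_neq (bef_left ba sb1 sa).
have ux : u != x.
  apply: contraTneq au => ->; rewrite hM; last first.
    by have := left_neq (bef_left xa sx sa); rewrite eq_sym.
  rewrite meet_sym ?bef_nadj //; last first.
    by have := left_neq (bef_left xa sx sa); rewrite eq_sym.
  exact: left_neq (bef_left xa sx sa).
have un : u != a by rewrite eq_sym.
have Yux : ~~ (0 < meet X u x) -> bef Y x u.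
  move=> h; have : bef Y u x || bef Y x u by apply: nadj_bef => //; rewrite -hM.
  case/orP => // h1; have := bef_nadj un su sa (bef_trans h1 xa).
  by rewrite -hM // meet_sym // au.
have aub : 0 < meet X u b1.
  apply: contraT => h; have : bef X u b1 || bef X b1 u by apply: nadj_bef.
  case/orP => h1.
    by have := bef_nadj un su sa (bef_trans h1 ba); rewrite meet_sym // au.
  have nux : ~~ (0 < meet X u x).
    rewrite adjE //; apply/negP => /andP[_ h2].
    by have := fl_triP X u b1 x; move: X_xb h1 h2; rewrite /left_of /before; clear; lia.
  by move: nu; rewrite hu h1 (Yux nux).
have aux : 0 < meet X u x.
  apply: contraT => h; have h1 := Yux h; move: aub; rewrite hM // adjE // => /andP[_ h2].
  by have := fl_triP Y u x b1; move: Y_bx h1 h2; rewrite /left_of /before; clear; lia.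
have tk : touch u k.
  apply: (@touch_btw X x b1 k u) => //; rewrite ?/touch ?aux ?aub ?orbT //.
  by rewrite /btw X_xk X_kb.
have tK z : connect (fun a b => [&& eblue a b, red x a & red x b]) k z -> touch u z.
  move=> h; suff /andP[] : touch u z && (z \in T) by [].
  apply: (connect_stable (P := fun z => touch u z && (z \in T)) _ _ h); last by rewrite tk hk.
  move=> c d /andP[tc hc] /and3P[/and3P[_ hd cd] rc rd]; rewrite hd andbT.
  have X_xc' : left X x c by apply: lo_left => //; exact: red_nf rc.
  have X_xd : left X x d by apply: lo_left => //; exact: red_nf rd.
  have Y_xc' : left Y x c by rewrite -(redP rc).
  have Y_xd : left Y x d by rewrite -(redP rd).
  have sc := hp hc; have sd := hp hd.
  case/orP: (cd) => /andP[h1 h2].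
    apply: (@touch_btw Y x c d u) => //; rewrite ?/touch ?aux ?orbT //.
    by rewrite /btw Y_xd h2.
  apply: (@touch_btw X x c d u) => //; rewrite ?/touch ?aux ?orbT //.
  by rewrite /btw X_xd h1.
have symK : symmetric (fun a b => [&& eblue a b, red x a & red x b]).
  by move=> c d; rewrite sb; congr (_ && _); rewrite andbC.
have cky : connect (fun a b => [&& eblue a b, red x a & red x b]) k y.
  by rewrite (sym_connect_sym symK).
have tuy := tK y cky.
have tuc : touch u c1.
  apply: tK; apply: connect_trans cky (connect1 _).
  by rewrite /blue_edge hy hc1 yc hr rxc.
have uy : u != y by apply: contraTneq aux => ->; rewrite hM.
have uc : u != c1.
  apply: contraTneq aux => ->; have cx : c1 != x by rewrite eq_sym; exact: left_neq X_xc.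
  by rewrite hM // meet_sym.
have auy : 0 < meet X u y by move: tuy; rewrite /touch (negPf uy).
have auc : 0 < meet X u c1 by move: tuc; rewrite /touch (negPf uc).
have Y_ybefc : bef Y y c1.
  have cy : c1 != y := left_neq X_cy.
  by apply: left_bef => //; rewrite meet_sym // eq_sym.
have X_xbefy : bef X x y by apply: left_bef => //; rewrite hM // meet_sym.
(* In Y the rows x and y lie strictly inside u, so u is longer than both. *)
have [big_x big_y] : (s x < s u)%N /\ (s y < s u)%N.
  have := auc; rewrite hM // adjE // => /andP[c_1 c_2].
  have := auy; rewrite hM // adjE // => /andP[y_1 y_2].
  have := aub; rewrite hM // adjE // => /andP[b_1 b_2].
  move: Y_ybefc Y_bbefx Y_xbefy; rewrite /before => q1 q2 q3.
  have t1 := fl_triP Y u x b1; have t2 := fl_triP Y y x u; have a1 := fl_anti Y ux.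
  have t3 := fl_triP Y u y b1; have t4 := fl_triP Y c1 y u; have a2 := fl_anti Y uy.
  have t5 := fl_triP Y y x b1.
  by move: t1 t2 t3 t4 t5 a1 a2 q1 q2 q3 c_1 c_2 y_1 y_2 b_1 b_2; clear; split; lia.
have nux : ~~ comparable s X u x.
  rewrite (nf_same hM) // /comparable /left_of.
  have := aub; rewrite hM // adjE // => /andP[b_1 b_2].
  have := auy; rewrite hM // adjE // => /andP[y_1 y_2].
  move: Y_bbefx Y_xbefy; rewrite /before => q2 q3.
  have t1 := fl_triP Y u x b1; have t2 := fl_triP Y y x u; have a1 := fl_anti Y ux.
  by move: t1 t2 a1 q2 q3 y_1 y_2 b_1 b_2 big_x; clear; lia.
have nuy : ~~ comparable s X u y.
  rewrite (nf_same hM) // /comparable /left_of.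
  have := auc; rewrite hM // adjE // => /andP[b_1 b_2].
  have := aub; rewrite hM // adjE // => /andP[y_1 y_2].
  move: Y_bbefx Y_xbefy Y_ybefc; rewrite /before => q1 q2 q3.
  have t3 := fl_triP Y u y b1; have t4 := fl_triP Y c1 y u; have a2 := fl_anti Y uy.
  have t5 := fl_triP Y y x b1.
  by move: t3 t4 t5 a2 q1 q2 q3 y_1 y_2 b_1 b_2 big_y; clear; lia.
(* Longer than the extreme rows [x] and [y] and incomparable to both, [u] reaches both ends of the
   window up to one unit. *)
have c1' : fl X u x <= 0.
  by move: nux big_x; rewrite /comparable /left_of; have := fl_anti X ux; clear; lia.
have c2' : fl X y u + (s y)%:Z - (s u)%:Z <= 0.
  by move: nuy big_y; rewrite /comparable /left_of; have := fl_anti X uy; clear; lia.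
exists u => // t ht; apply/andP; split.
  have [->//|tx] := eqVneq t x.
  by have := hlo ht tx; have := fl_triP X u t x; move: c1'; clear; lia.
have [->//|ty] := eqVneq t y.
by have := hhi ht ty; have := fl_triP X y t u; move: c2'; clear; lia.
Qed.

End Span.

(** * Reordering by reflections *)

Section Orient.
Variables (n : nat) (s : 'I_n -> nat) (V : Type) (val_of : alcove n -> V).
Implicit Types (A B D X Y : alcove n) (a b c u v t : 'I_n) (T : {set 'I_n}).
Local Notation left := (left_of s).
Local Notation meet := (weight s).
Local Notation cov := (covers s).
Local Notation bef := (before s).
Local Notation in_window := (in_window s).
Local Notation closed_rows := (closed_rows s).
Local Notation mirrored := (mirrored s).
Local Notation same_graph := (same_graph s).
Local Notation same_side := (same_side s).

Definition positive T := forall t, t \in T -> (0 < s t)%N.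

Hypothesis hrefl : forall A T, positive T -> closed_rows A T ->
  exists B, [/\ mirrored A B T, in_window A B T, same_graph A B & val_of A = val_of B].

Lemma Pres_trans A B D T : in_window A B T -> in_window B D T -> in_window A D T.
Proof.
move=> [a1 a2 a3] [b1 b2 b3]; split.
- by move=> u v hu hv; rewrite a1 // b1.
- by move=> u a hu h; apply: b2 => //; apply: a2.
- by move=> u a hu h; apply: b3 => //; apply: a3.
Qed.

Lemma Pres_sub A B (T1 T : {set 'I_n}) : T1 \subset T -> in_window A B T1 -> in_window A B T.
Proof.
move=> /subsetP sub [a1 a2 a3]; have out u : u \notin T -> u \notin T1.
  by apply: contra; exact: sub.
split.
- by move=> u v hu hv; rewrite a1 // out.
- move=> u a hu h t ht; have [h1|h1] := boolP (t \in T1).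
    by apply: (a2 u a (out u hu)) => // t' /sub; exact: h.
  by rewrite -(a1 _ _ h1 (out u hu)); exact: h.
- move=> u a hu h t ht; have [h1|h1] := boolP (t \in T1).
    by apply: (a3 u a (out u hu)) => // t' /sub; exact: h.
  by rewrite -(a1 _ _ (out u hu) h1); exact: h.
Qed.

Lemma closed_pres A B T : closed_rows A T -> in_window A B T -> closed_rows B T.
Proof. by move=> h1 h2; exact: (closedE (TYC (Pres_TY h1 h2))). Qed.

Lemma closed_pres_sub A B (T1 T : {set 'I_n}) : T1 \subset T -> closed_rows A T -> in_window A B T1 -> closed_rows B T.
Proof. by move=> h1 h2 h3; exact: (closed_pres h2 (Pres_sub h1 h3)). Qed.

Lemma sameM_sym A B : same_graph A B -> same_graph B A.
Proof. by move=> h a b ab; rewrite h. Qed.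
Lemma sameM_trans A B D : same_graph A B -> same_graph B D -> same_graph A D.
Proof. by move=> h1 h2 a b ab; rewrite h1 // h2. Qed.

Variable Q : alcove n.
Definition agree B T := forall t t', t \in T -> t' \in T -> left B t t' = left Q t t'.

(** The target order is that of [Q]. [val_of] abstracts the polynomial, of which only the invariance
    [hrefl] is used. *)
Definition orientable A T := exists B, [/\ in_window A B T, same_graph B Q, val_of A = val_of B & agree B T].

Lemma full_agree B t t' : same_graph B Q -> (0 < s t)%N -> (0 < s t')%N -> ~~ comparable s B t t' ->
  left B t t' = left Q t t' /\ left B t' t = left Q t' t.
Proof.
move=> hM st st' h; have h' : ~~ comparable s Q t t' by rewrite -(nf_same hM).
by move: h h'; rewrite /comparable !negb_or => /andP[/negPf -> /negPf ->] /andP[/negPf -> /negPf ->].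
Qed.

Lemma cov_full X u t : u != t -> cov X u t -> ~~ comparable s X u t.
Proof. by move=> ut h; have [_ h1 h2] := cov_meet ut h; rewrite /comparable h1 h2. Qed.

Section Step.
Variable T : {set 'I_n}.
Hypothesis pT : positive T.
Hypothesis IH : forall T', (#|T'| < #|T|)%N -> positive T' ->
  forall A, same_graph A Q -> closed_rows A T' -> orientable A T'.

(** A row covering all of [T] is comparable to none of the others, so only these need to be
    ordered. *)
Lemma orient_dominator A u : same_graph A Q -> closed_rows A T -> u \in T ->
  (forall t, t \in T -> cov A u t) -> orientable A T.
Proof.
move=> hM hc hu hcov; have sub : T :\ u \subset T by apply: subsetDl.
have p1 : positive (T :\ u) by move=> t /setD1P[_ /pT].
have c1 : closed_rows A (T :\ u).
  move=> v hv sv; have [vT|vT] := boolP (v \in T); last first.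
    by case: (hc v vT sv) => h; [constructor 1|constructor 2|constructor 3] => t /setD1P[_ /h].
  have -> : v = u by apply/eqP; move: hv; rewrite !inE vT andbT negbK.
  by constructor 1 => t /setD1P[_ /hcov ->].
have lt1 : (#|T :\ u| < #|T|)%N by rewrite [X in (_ < X)%N](cardsD1 u) hu.
have [B [b1 b2 b3 b4]] := IH lt1 p1 hM c1.
exists B; split=> //; first exact: Pres_sub b1.
have ty := Pres_TY c1 b1.
have cB t : t \in T -> t != u -> ~~ comparable s B u t.
  move=> ht tu; have uB : u \notin T :\ u by rewrite !inE eqxx.
  have ht1 : t \in T :\ u by rewrite !inE tu.
  have ut : u != t by rewrite eq_sym.
  rewrite (nf_same (sameM_trans b2 (sameM_sym hM))) ?pT //.
  by apply: cov_full => //; exact: hcov.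
move=> t t' ht ht'; have [->|tt] := eqVneq t t'; first by rewrite /left_of !fl_ii.
have [e|tu] := eqVneq t u.
  by subst t; have [] := full_agree b2 (pT hu) (pT ht') (cB t' ht' _); rewrite // eq_sym.
have [e|tu'] := eqVneq t' u.
  by subst t'; have [] := full_agree b2 (pT hu) (pT ht) (cB t ht tu).
by apply: b4; rewrite !inE ?tu ?tu'.
Qed.

Local Notation eadjQ := (adj_edge s Q T).

Lemma eadj_sym : symmetric eadjQ.
Proof.
move=> a b; rewrite /adj_edge andbCA; congr [&& _, _ & _].
by have [->//|ab] := eqVneq a b; rewrite meet_sym.
Qed.

Lemma bef_asym X a b : (0 < s a)%N -> (0 < s b)%N -> bef X a b -> bef X b a -> False.
Proof.
move=> sa sb h1 h2; have h := bef_trans h1 h2; move: h; rewrite /before fl_ii; move: sa; lia.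
Qed.

(** Every other row of [T] lies before or after a whole component of the overlap graph. Reflecting
    the component [Z] that is first in [Q], together with the rows of [T] before it in [A], brings
    it to the front; then [Z] and the rest are ordered separately. *)
Lemma orient_disconnected A a0 b0 : same_graph A Q -> closed_rows A T -> a0 \in T -> b0 \in T ->
  ~~ connect eadjQ a0 b0 -> orientable A T.
Proof.
move=> hM hc ha0 hb0 nc.
have T0 : T != set0 by apply/set0Pn; exists a0.
have [z hz hzm] := exists_min (pos Q) T0; have sz := pT hz.
pose Z := [set t in T | connect eadjQ z t].
have subZ : Z \subset T by apply/subsetP => t; rewrite inE => /andP[].
have ZT t : t \in Z -> t \in T by move/(subsetP subZ).
have hzZ : z \in Z by rewrite inE hz connect0.
have symQ := sym_connect_sym eadj_sym.
have Z_step t t' : t \in Z -> t' \in T -> 0 < meet Q t t' -> t' \in Z.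
  rewrite !inE => /andP[ht h1] ht' h2; rewrite ht' /=.
  by apply: connect_trans h1 (connect1 _); rewrite /adj_edge ht ht' h2.
have ZD t : t \in T :\: Z -> t \in T /\ t \notin Z by rewrite inE => /andP[].
have out X t v : same_graph X Q -> t \in T -> t \notin Z -> v \in Z -> bef X t v || bef X v t.
  move=> hX ht htZ hv; have vt : v != t by apply: contraNneq htZ => <-.
  have tv : t != v by rewrite eq_sym.
  apply: nadj_bef => //; [exact: pT | exact: pT (ZT _ hv) | rewrite hX // meet_sym //].
  by apply: contra htZ => h; apply: Z_step hv ht h.
have uniform X t v0 : same_graph X Q -> t \in T -> t \notin Z -> v0 \in Z -> bef X t v0 ->
    forall v, v \in Z -> bef X t v.
  move=> hX ht htZ hv0 h0 v hv.
  have cv : connect eadjQ v0 v.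
    have : connect eadjQ v0 z by rewrite symQ; move: hv0; rewrite inE => /andP[].
    by move/connect_trans; apply; move: hv; rewrite inE => /andP[].
  suff /andP[] : bef X t v && (v \in Z) by [].
  apply: (connect_stable (P := fun v => bef X t v && (v \in Z)) _ _ cv); last by rewrite h0 hv0.
  move=> a b /andP[ta aZ] /and3P[aT bT ab]; have bZ := Z_step _ _ aZ bT ab.
  rewrite bZ andbT; case/orP: (out X t b hX ht htZ bZ) => // bt.
  have h := bef_trans bt ta; have sa := pT aT; have sb := pT bT.
  have ba := left_neq (bef_left h sb sa); have ab' : a != b by rewrite eq_sym.
  by have := bef_nadj ba sb sa h; rewrite hX // meet_sym // ab.
have uniform' X t v0 : same_graph X Q -> t \in T -> t \notin Z -> v0 \in Z -> bef X v0 t ->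
    forall v, v \in Z -> bef X v t.
  move=> hX ht htZ hv0 h0 v hv; case/orP: (out X t v hX ht htZ hv) => // h.
  have h' := uniform X t v hX ht htZ hv h v0 hv0.
  by case: (bef_asym (pT (ZT _ hv0)) (pT ht) h0 h').
have QQ : same_graph Q Q by [].
have Qfirst t v : t \in T -> t \notin Z -> v \in Z -> bef Q v t.
  move=> ht htZ hv; apply: (uniform' Q t z QQ ht htZ hzZ _ v hv).
  case/orP: (out Q t z QQ ht htZ hzZ) => // h; exfalso.
  have := hzm t ht; have := flE Q z t; have := frP Q z t; move: h (pT ht) (scale_gt0 Q).
  by rewrite /before; clear; nia.
pose U := Z :|: [set t in T | bef A t z].
have subU : U \subset T.
  by apply/subsetP => t; rewrite !inE => /orP[/andP[]|/andP[]].
have UT t : t \in U -> t \in T by move/(subsetP subU).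
have pU : positive U by move=> t /UT /pT.
have befU t : t \in T -> t \notin U -> forall v, v \in U -> bef A v t.
  move=> ht htU; have htZ : t \notin Z by apply: contra htU => h; rewrite inE h.
  have zt : bef A z t.
    case/orP: (out A t z hM ht htZ hzZ) => // h; move: htU; rewrite !inE ht h.
    by rewrite orbT.
  move=> v; rewrite in_setU => /orP[hv|]; first exact: (uniform' A t z hM ht htZ hzZ zt).
  by rewrite inE => /andP[_ h]; apply: bef_trans h zt.
have cU : closed_rows A U.
  move=> u hu su; have [uT|uT] := boolP (u \in T).
    by constructor 2 => t ht; rewrite andbb; apply: befU.
  by case: (hc u uT su) => h; [constructor 1|constructor 2|constructor 3] => t /UT /h.
have [B [m1 P1 M1 V1]] := hrefl pU cU.
have MB : same_graph B Q := sameM_trans (sameM_sym M1) hM.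
have Bfirst t v : t \in T -> t \notin Z -> v \in Z -> bef B v t.
  move=> ht htZ hv; have hvU : v \in U by rewrite inE hv.
  have [htU|htU] := boolP (t \in U); last first.
    case: (Pres_TY cU P1 htU (pT ht)) => h; have /andP[h1 h2] := h v hvU => //; exfalso.
    - have tv : t != v by apply: contraNneq htZ => ->.
      have [_ _ h3] := cov_meet tv h1.
      by have := bef_left (befU t ht htU v hvU) (pT (ZT _ hv)) (pT ht); rewrite h3.
    - exact: bef_asym (pT ht) (pT (ZT _ hv)) h1 (befU t ht htU v hvU).
  have tz : bef A t z.
    by move: htU; rewrite in_setU (negPf htZ) inE => /andP[].
  have tv := uniform A t z hM ht htZ hzZ tz v hv.
  have nv : t != v by apply: contraNneq htZ => ->.
  by rewrite /before (m1 t v) //; move: tv; rewrite /before; clear; lia.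
have TB : closed_rows B T := closed_pres_sub subU hc P1.
have pZ : positive Z by move=> t /ZT /pT.
have cZ : closed_rows B Z.
  move=> u hu su; have [uT|uT] := boolP (u \in T).
    by constructor 2 => t ht; rewrite andbb; apply: Bfirst.
  by case: (TB u uT su) => h; [constructor 1|constructor 2|constructor 3] => t /ZT /h.
have ltZ : (#|Z| < #|T|)%N.
  apply: proper_card; rewrite properE subZ /=; apply/negP => /subsetP h.
  case/negP: nc; have := h _ ha0; have := h _ hb0; rewrite !inE => /andP[_ c1] /andP[_ c2].
  by apply: connect_trans c1; rewrite symQ.
have [D [P2 M2 V2 A2]] := IH ltZ pZ MB cZ.
have TD : closed_rows D T := closed_pres_sub subZ TB P2.
pose Z' := T :\: Z.
have pZ' : positive Z' by move=> t /ZD[/pT].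
have Dfirst t v : t \in T -> t \notin Z -> v \in Z -> bef D v t.
  move=> ht htZ hv; have hb := Bfirst t v ht htZ hv.
  case: (Pres_TY cZ P2 htZ (pT ht)) => h; have /andP[h1 h2] := h v hv => //; exfalso.
    have tv : t != v by apply: contraNneq htZ => ->.
    have [_ _ h3] := cov_meet tv h1.
    by have := bef_left hb (pT (ZT _ hv)) (pT ht); rewrite h3.
  exact: bef_asym (pT ht) (pT (ZT _ hv)) h1 hb.
have cZ' : closed_rows D Z'.
  move=> u hu su; have [uT|uT] := boolP (u \in T).
    have uZ : u \in Z by move: hu; rewrite inE uT andbT negbK.
    by constructor 3 => t /ZD[ht htZ]; rewrite andbb; apply: Dfirst.
  by case: (TD u uT su) => h; [constructor 1|constructor 2|constructor 3] => t /ZD[/h].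
have ltZ' : (#|Z'| < #|T|)%N.
  by rewrite [X in (_ < X)%N](cardsD1 z) hz add1n ltnS subset_leq_card //;
  apply/subsetP => t /ZD[ht htZ]; rewrite !inE ht andbT; apply: contraNneq htZ => ->.
have [Ee [P3 M3 V3 A3]] := IH ltZ' pZ' M2 cZ'.
exists Ee; split=> //.
- apply: Pres_trans (Pres_sub subU P1) (Pres_trans (Pres_sub subZ P2) (Pres_sub _ P3)).
  exact: subsetDl.
- by rewrite V1 V2 V3.
have zero t : t \in Z -> t \notin Z' by move=> h; rewrite inE h.
have cross t v : t \in T -> t \notin Z -> v \in Z -> bef Ee v t.
  move=> ht htZ hv; have ht' : t \in Z' by rewrite inE htZ.
  have hb := Dfirst t v ht htZ hv; have vt : v != t by apply: contraNneq htZ => <-.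
  case: (Pres_TY cZ' P3 (zero v hv) (pT (ZT _ hv))) => h; have /andP[h1 h2] := h t ht' => //; exfalso.
    have [_ h3 _] := cov_meet vt h1.
    by have := bef_left hb (pT (ZT _ hv)) (pT ht); rewrite h3.
  exact: bef_asym (pT ht) (pT (ZT _ hv)) h1 hb.
move=> t t' ht ht'; have [tZ|tZ] := boolP (t \in Z); have [tZ'|tZ'] := boolP (t' \in Z).
- rewrite -A2 //; have [e _ _] := P3.
  by rewrite /left_of e ?zero.
- have c1 := bef_left (cross t' t ht' tZ' tZ) (pT ht) (pT ht').
  by rewrite c1 (bef_left (Qfirst t' t ht' tZ' tZ) (pT ht) (pT ht')).
- have c1 := bef_left (cross t t' ht tZ tZ') (pT ht') (pT ht).
  have c2 := bef_left (Qfirst t t' ht tZ tZ') (pT ht') (pT ht).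
  by rewrite (left_asym c1) (left_asym c2).
- by apply: A3; rewrite inE ?tZ ?tZ'.
Qed.

Lemma extremes X : T != set0 -> exists x y, [/\ x \in T, y \in T,
  forall t, t \in T -> t != x -> 0 <= fl X t x &
  forall t, t \in T -> t != y -> 0 <= fl X y t + (s y)%:Z - (s t)%:Z].
Proof.
move=> T0; have [x hx hxm] := exists_min (pos X) T0.
have [y hy hym] := exists_min (fun t => - (pos X t + (s t)%:Z * scale X)) T0.
have N0 := scale_gt0 X.
exists x, y; split=> // t ht _.
  by have := hxm t ht; rewrite /fl lez_divRL //; clear; lia.
suff : (s t)%:Z - (s y)%:Z <= fl X y t by clear; lia.
by have := hym t ht; rewrite /fl lez_divRL //; clear; lia.
Qed.

(** If [x], starting first, and [y], ending last, were not in this order, then up to one unit [y]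
    would also start first or [x] also end last, and this row would cover [T]. *)
Lemma extremes_left X x y : x \in T -> y \in T ->
  (forall t, t \in T -> t != x -> 0 <= fl X t x) ->
  (forall t, t \in T -> t != y -> 0 <= fl X y t + (s y)%:Z - (s t)%:Z) ->
  ~~ [exists u in T, forall t in T, cov X u t] -> left X x y.
Proof.
move=> hx hy hlo hhi /existsPn nd.
have lo t : t \in T -> fl X x t <= 0.
  move=> ht; have [->|tx] := eqVneq t x; first by rewrite fl_ii.
  by have := hlo t ht tx; rewrite (fl_anti X tx); clear; lia.
have hi t : t \in T -> fl X t y + (s t)%:Z - (s y)%:Z <= 0.
  move=> ht; have [->|ty] := eqVneq t y; first by rewrite fl_ii; clear; lia.
  by have := hhi t ht ty; rewrite (fl_anti X ty); clear; lia.
apply: contraT => nl; have [h|h] : fl X y x <= 0 \/ fl X y x + (s y)%:Z - (s x)%:Z <= 0.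
- by move: nl; rewrite /left_of; clear; lia.
- have := nd y; rewrite hy /= => /negP []; apply/forallP => t; apply/implyP => ht.
  rewrite /covers hi // andbT.
  by have := lo t ht; have := fl_triP X y t x; have [->|tx] := eqVneq t x; [|have := hlo t ht tx]; move: h; clear; lia.
have := nd x; rewrite hx /= => /negP []; apply/forallP => t; apply/implyP => ht.
rewrite /covers lo //=; have [->|ty] := eqVneq t y; first by [].
by have := hhi t ht ty; have := fl_triP X y t x; move: h; clear; lia.
Qed.

Definition nblue A := #|[set p : 'I_n * 'I_n | [&& p.1 \in T, p.2 \in T & opp_dir s A Q p.1 p.2]]|.

Hypothesis hadj : forall a b, a \in T -> b \in T -> connect eadjQ a b.

Lemma eadj_same A a b : same_graph A Q -> adj_edge s A T a b = eadjQ a b.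
Proof.
move=> hM; rewrite /adj_edge; congr [&& _, _ & _].
have [->|ab] := eqVneq a b; last by rewrite hM.
by rewrite /weight !fl_ii.
Qed.

(** The inner induction is on the number of reordered pairs. The hull of a component of such pairs
    is a proper subset and can be ordered as in [Q]; what remains is that the extreme rows of the
    resulting alcove are again ordered as in [Q]. *)
Lemma orient_core m A x y : (nblue A < m)%N -> same_graph A Q -> closed_rows A T ->
  x \in T -> y \in T ->
  (forall t, t \in T -> t != x -> 0 <= fl A t x) ->
  (forall t, t \in T -> t != y -> 0 <= fl A y t + (s y)%:Z - (s t)%:Z) ->
  same_dir s A Q x y -> orientable A T.
Proof.
elim: m A x y => // m IHm A x y hm hM hc hx hy hlo hhi hr.
have [/existsP[u /andP[hu /forallP hcov]]|nd] := boolP [exists u in T, forall t in T, cov A u t].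
  by apply: (orient_dominator hM hc hu) => t; exact/implyP.
have [/existsP[b0 /existsP[b1 b01]]|nb] := boolP [exists b0, exists b1, blue_edge s A Q T b0 b1]; last first.
  exists A; split=> //.
  move=> t t' ht ht'; have [h|h] := boolP (comparable s A t t'); last first.
    by have [] := full_agree hM (pT ht) (pT ht') h.
  case/orP: (nf_colour hM (pT ht) (pT ht') h) => [|hb]; first exact: redP.
  by case/negP: nb; apply/existsP; exists t; apply/existsP; exists t'; rewrite /blue_edge ht ht'.
pose T1 := comp_hull s A Q T b0.
have c1 : closed_rows A T1 := hull_closed hM pT b01 hc.
have sub1 : T1 \subset T by apply/subsetP => t; exact: hull_sub.
have p1 : positive T1 by move=> t /(subsetP sub1) /pT.
have lt1 : (#|T1| < #|T|)%N.
  apply: proper_card; rewrite properE sub1 /=; apply/negP => /subsetP sub2.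
  (* The rows added to a component start after and end before some row of it, so the extremes lie in
     the component itself. *)
  have xC : x \in opp_comp s A Q T b0.
    apply: contraT => nx; have [t ht h] := hull_lo b01 (sub2 x hx) nx.
    have tx : t != x by apply: contraNneq nx => <-.
    by have := hlo t (comp_sub ht) tx; rewrite (fl_anti A tx); move: h; clear; lia.
  have yC : y \in opp_comp s A Q T b0.
    apply: contraT => ny; have [t ht h] := hull_hi b01 (sub2 y hy) ny.
    have ty : t != y by apply: contraNneq ny => <-.
    by have := hhi t (comp_sub ht) ty; move: h; rewrite (fl_anti A ty); clear; lia.
  have hcon : connect (blue_edge s A Q T) x y.
    move: xC yC; rewrite !inE => /andP[_ h1] /andP[_ h2].
    by apply: connect_trans h2; rewrite (sym_connect_sym (eblue_sym s A Q T)).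
  have hadjA a b : a \in T -> b \in T -> connect (adj_edge s A T) a b.
    move=> ha hb; rewrite (eq_connect (e' := eadjQ)); first exact: hadj.
    by move=> a' b'; exact: eadj_same.
  have [u hu hcov] := spanning_dominator hM pT hx hy hlo hhi hr hadjA hcon.
  case/negP: nd; apply/existsP; exists u; rewrite hu; apply/forallP => t.
  by apply/implyP; exact: hcov.
have [B [P1 M1 V1 A1]] := IH lt1 p1 hM c1.
have hcB : closed_rows B T := closed_pres_sub sub1 hc P1.
have PT : in_window A B T := Pres_sub sub1 P1.
have ty := Pres_TY c1 P1; have [hE _ _] := P1.
suff [D [P2 M2 V2 A2]] : orientable B T.
  exists D; split=> //; [exact: Pres_trans PT P2 | by rewrite V1].
have [/existsP[u /andP[hu /forallP hcov]]|ndB] := boolP [exists u in T, forall t in T, cov B u t].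
  by apply: (orient_dominator M1 hcB hu) => t; exact/implyP.
have T0 : T != set0 by apply/set0Pn; exists x.
have [x2 [y2 [hx2 hy2 lo2 hi2]]] := extremes B T0.
have l2 := extremes_left hx2 hy2 lo2 hi2 ndB.
have xy2 := left_neq l2.
have same a b : a \in T -> b \in T -> ~~ ((a \in T1) && (b \in T1)) -> left B a b = left A a b.
  move=> ha hb nab; have [->|ab] := eqVneq a b; first by rewrite /left_of !fl_ii.
  by have [_ ->] := TY_same hE ty p1 ab nab; rewrite ?pT.
have same_red a b : a \in T -> b \in T -> ~~ ((a \in T1) && (b \in T1)) -> same_dir s B Q a b = same_dir s A Q a b.
  by move=> ha hb nab; rewrite /same_dir !same // andbC.
have in_blue a b : a \in T1 -> b \in T1 -> opp_dir s B Q a b = false.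
  move=> ha hb; apply/negP; rewrite /opp_dir !A1 // => /orP[]/andP[h1 h2];
  by rewrite (left_asym h1) in h2.
apply: (IHm B x2 y2) => //.
  rewrite -ltnS; apply: leq_trans hm; apply: proper_card; rewrite properE.
  apply/andP; split.
    apply/subsetP => -[a b]; rewrite !inE /= => /and3P[ha hb hab]; rewrite ha hb /=.
    have [/andP[h1 h2]|nab] := boolP ((a \in T1) && (b \in T1)); first by rewrite in_blue in hab.
    by move: hab; rewrite /opp_dir !same // andbC.
  apply/negP => /subsetP /(_ (b0, b1)); rewrite !inE /=; case/and3P: (b01) => h0 h1 h2.
  rewrite h0 h1 h2 /= in_blue => [/(_ isT)//||]; rewrite in_setU.
    by rewrite (comp_b0 b01).
  by rewrite (comp_b1 b01).
have nf2 : comparable s B x2 y2 by rewrite /comparable l2.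
have nf2A : comparable s A x2 y2 by rewrite (nf_same (sameM_trans hM (sameM_sym M1))) ?pT.
have [x1|x1] := boolP (x2 \in T1); have [y1|y1] := boolP (y2 \in T1).
- by rewrite /same_dir -A1 // l2.
- rewrite same_red ?(negPf y1) ?andbF // redC.
  by apply: (hull_out hM pT b01 hy2 y1 x1); rewrite nfC.
- rewrite same_red ?(negPf x1) //.
  exact: (hull_out hM pT b01 hx2 x1 y1).
rewrite same_red ?(negPf x1) //.
(* If the first row changes, the old one lies in [T1] and the new one covers [T1]; the two are
   incomparable, and [full_red] transfers the colour. *)
have covx : x2 != x -> x \in T1 /\ forall t, t \in T1 -> cov A x2 t.
  move=> ne; have en : x != x2 by rewrite eq_sym.
  have k1 := hlo x2 hx2 ne; have k2 := lo2 x hx en.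
  have xT1 : x \in T1.
    apply: contraT => nx; have e := hE x x2 nx x1.
    by move: k1 k2; rewrite -e (fl_anti A ne); clear; lia.
  split=> //; case: (ty x2 x1 (pT hx2)) => h; first by move=> t /h /andP[].
    have /andP[_] := h x xT1; move: k2; rewrite /before (fl_anti B en); clear; lia.
  have /andP[+ _] := h x xT1; move: k1; rewrite /before (fl_anti A ne); clear; lia.
have covy : y2 != y -> y \in T1 /\ forall t, t \in T1 -> cov A y2 t.
  move=> ne; have en : y != y2 by rewrite eq_sym.
  have k1 := hhi y2 hy2 ne; have k2 := hi2 y hy en.
  have yT1 : y \in T1.
    apply: contraT => nx; have e := hE y2 y y1 nx.
    by move: k1 k2; rewrite -e (fl_anti A ne); clear; lia.
  split=> //; case: (ty y2 y1 (pT hy2)) => h; first by move=> t /h /andP[].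
    have /andP[+ _] := h y yT1; move: k1; rewrite /before (fl_anti A en); clear; lia.
  have /andP[_] := h y yT1; move: k2; rewrite /before (fl_anti B ne); clear; lia.
have [ex|nx] := eqVneq x2 x; have [ey|ny] := eqVneq y2 y.
- by rewrite ex ey.
- have [yT1 cy] := covy ny.
  rewrite redC; apply: (full_red hM (pT hy) (pT hy2) (pT hx2)); rewrite 1?nfC //.
    by apply: cov_full => //; exact: cy.
  by rewrite redC ex.
- have [xT1 cx] := covx nx.
  apply: (full_red hM (pT hx) (pT hx2) (pT hy2)) => //; last by rewrite ey.
  by rewrite nfC; apply: cov_full => //; exact: cx.
have [xT1 cx] := covx nx; have [yT1 _] := covy ny.
have := cx x xT1; have := cx y yT1; rewrite /covers => /andP[_ k1] /andP[k2 _].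
case/negP: nd; apply/existsP; exists x2; rewrite hx2 /=; apply/forallP => t.
apply/implyP => ht; apply/andP; split.
  have [->//|tx] := eqVneq t x.
  by have := hlo t ht tx; have := fl_triP A x2 t x; move: k2; clear; lia.
have [->//|ty'] := eqVneq t y.
by have := hhi t ht ty'; have := fl_triP A y t x2; move: k1; clear; lia.
Qed.

End Step.

(** If the extreme rows are reversed with respect to [Q], reflecting all of [T] puts them right;
    then [orient_core] applies. *)
Lemma orient T : positive T -> forall A, same_graph A Q -> closed_rows A T -> orientable A T.
Proof.
have [m] := ubnP #|T|; elim: m T => // m IHm T hm pT A hM hc.
have IH T' : (#|T'| < #|T|)%N -> positive T' ->
  forall A, same_graph A Q -> closed_rows A T' -> orientable A T'.
  by move=> h; apply: IHm; apply: leq_trans h _.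
have [e|T0] := eqVneq T set0.
  exists A; split=> //.
  by move=> t t'; rewrite e inE.
have [/existsP[a /andP[ha /existsP[b /andP[hb nab]]]]|hcon] :=
    boolP [exists a in T, exists b in T, ~~ connect (adj_edge s Q T) a b].
  exact: (orient_disconnected pT IH hM hc ha hb nab).
have hadj a b : a \in T -> b \in T -> connect (adj_edge s Q T) a b.
  move=> ha hb; apply: contraT => nab; case/negP: hcon; apply/existsP; exists a.
  by rewrite ha; apply/existsP; exists b; rewrite hb.
have [/existsP[u /andP[hu /forallP hcov]]|nd] := boolP [exists u in T, forall t in T, cov A u t].
  by apply: (orient_dominator pT IH hM hc hu) => t; exact/implyP.
have [x [y [hx hy hlo hhi]]] := extremes A T0.
have l := extremes_left hx hy hlo hhi nd; have xy := left_neq l.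
have nxy : comparable s A x y by rewrite /comparable l.
case/orP: (nf_colour hM (pT x hx) (pT y hy) nxy) => [hr|hb].
  exact: (orient_core pT IH hadj (ltnSn _) hM hc hx hy hlo hhi hr).
have [B [m1 P1 M1 V1]] := hrefl pT hc.
have MB : same_graph B Q := sameM_trans (sameM_sym M1) hM.
have [D [P2 M2 V2 A2]] : orientable B T.
  apply: (orient_core pT IH hadj (ltnSn _) MB (closed_pres hc P1) hy hx).
  - move=> t ht ty; rewrite (m1 t y) //.
    exact: hhi.
  - move=> t ht tx; rewrite (m1 x t) // 1?eq_sym //.
    by have := hlo t ht tx; clear; lia.
  have [_ e] := mir_meet m1 hx hy xy.
  by rewrite /same_dir -e l -(blueP hb) l.
exists D; split=> //; [exact: Pres_trans P1 P2 | by rewrite V1].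
Qed.

End Orient.

(** * Induction on the sum of squared lengths *)

Lemma sum_sqr_le n (s : 'I_n -> nat) : (\sum_h s h ^ 2 <= (\sum_h s h) ^ 2)%N.
Proof.
rewrite -mulnn big_distrl /=; apply: leq_sum => h _.
by rewrite -mulnn leq_mul2l (bigD1 h) //= leq_addr orbT.
Qed.

Theorem F_graph n (R : idomainType) (q : R) (vmax smax : nat) (y : nat -> R) (s : 'I_n -> nat) :
  q != 0 -> (\sum_h s h <= smax)%N -> forall A B : alcove n, same_graph s A B ->
  llt_sum q vmax smax y s (fl A) = llt_sum q vmax smax y s (fl B).
Proof.
move=> q0; have [d] := ubnP ((\sum_h s h) ^ 2 - \sum_h s h ^ 2)%N.
elim: d s => // d IHd s hd hS A B hM.
have IH s' : (\sum_h s' h = \sum_h s h)%N -> (\sum_h s h ^ 2 < \sum_h s' h ^ 2)%N ->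
    forall A B : alcove n, same_graph s' A B -> llt_sum q vmax smax y s' (fl A) = llt_sum q vmax smax y s' (fl B).
  move=> e lt; apply: IHd; rewrite ?e //.
  by have := sum_sqr_le s'; rewrite e; move: lt hd; clear; lia.
pose T := [set h | (0 < s h)%N].
have pT : positive s T by move=> t; rewrite inE.
have cT : closed_rows s A T by move=> u; rewrite inE => /negP.
have [D [_ M1 V1 A1]] := orient (val_of := fun A => llt_sum q vmax smax y s (fl A)) (Q := B)
  (reflection q0 hS IH) pT hM cT.
rewrite V1; apply: F_conv => //.
  by move=> h; apply: leq_trans hS; rewrite (bigD1 h) //= leq_addr.
by move=> a b sa sb; apply: A1; rewrite inE.
Qed.

Local Close Scope ring_scope.
Local Open Scope nat_scope.
From mathcomp Require Import boolp classical_sets functions cardinality fsbigop.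

(** * The LLT polynomial of a strip *)

(** Uniqueness of digits in base [K]. *)
Lemma base_inj (K B : nat) (c d : nat -> nat) :
  (forall v, c v < K) -> (forall v, d v < K) ->
  \sum_(v < B) c v * K ^ v = \sum_(v < B) d v * K ^ v -> forall v, v < B -> c v = d v.
Proof.
elim: B c d => // B IH c d hc hd; rewrite !big_ord_recl !expn0 !muln1.
have e (g : nat -> nat) : \sum_(i < B) g (bump 0 i) * K ^ bump 0 i =
    K * \sum_(i < B) g i.+1 * K ^ i.
  by rewrite big_distrr; apply: eq_bigr => i _; rewrite /bump /= add1n expnS; ring.
rewrite !e => h.
have K0 : 0 < K by apply: leq_ltn_trans (hc 0).
have h0 : c 0 = d 0.
  move/(congr1 (modn^~ K)): (h) => /=.
  by rewrite ![_ + K * _]addnC ![K * _]mulnC !modnMDl !modn_small.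
move=> [|v] hv //; apply: (IH (fun v => c v.+1) (fun v => d v.+1)) => //.
by move/eqP: h; rewrite h0 eqn_add2l eqn_pmul2l // => /eqP.
Qed.

(* For K larger than the number of entries, code K r determines r up to order. *)
Definition code (K : nat) (r : seq nat) := \sum_(v <- r) K ^ v.

Lemma code_count K B r : all (fun v => v < B) r ->
  code K r = \sum_(v < B) count_mem (v : nat) r * K ^ v.
Proof.
rewrite /code; elim: r => [|x r IH]; first by rewrite big_nil big1.
move=> /= /andP[hx hr]; rewrite big_cons IH //.
rewrite [RHS](eq_bigr (fun v : 'I_B => (if v == Ordinal hx then K ^ v else 0) + count_mem (v : nat) r * K ^ v)).
  by rewrite big_split /= -big_mkcond big_pred1_eq.
move=> v _; rewrite mulnDl; congr (_ + _).
have -> : (v == Ordinal hx) = (x == v :> nat) by rewrite eq_sym.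
by case: eqP; rewrite ?mul1n.
Qed.

Lemma code_inj K r r' : size r < K -> size r' < K -> code K r = code K r' -> perm_eq r r'.
Proof.
move=> h h'; pose B := (\max_(v <- r ++ r') v).+1.
have hB v : v \in r ++ r' -> v < B by move=> hv; rewrite ltnS; apply: leq_bigmax_seq.
rewrite (@code_count K B r); last by apply/allP => v hv; apply: hB; rewrite mem_cat hv.
rewrite (@code_count K B r'); last by apply/allP => v hv; apply: hB; rewrite mem_cat hv orbT.
move=> e; rewrite /perm_eq; apply/allP => v hv /=; apply/eqP.
apply: (base_inj (c := fun v => count_mem v r) (d := fun v => count_mem v r') _ _ e (hB v hv)).
  by move=> w; apply: leq_ltn_trans h; exact: count_size.
by move=> w; apply: leq_ltn_trans h'; exact: count_size.
Qed.

Section Link.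
Variables (n : nat) (lam : hstrip n).

Definition sizes (i : 'I_n) := hrow_size (tnth lam i).

Lemma card_iota (a b c d : nat) :
  #|` [fset j in index_iota a b] `&` [fset j in index_iota c d]|%fset = minn b d - maxn a c.
Proof.
have -> : ([fset j in index_iota a b] `&` [fset j in index_iota c d] =
  [fset j in index_iota (maxn a c) (minn b d)])%fset.
  by apply/fsetP => j; rewrite !inE !mem_index_iota; clear; lia.
by rewrite card_fseq undup_id ?iota_uniq // size_iota.
Qed.

Lemma sizeE (r : hrow) : hrow_size r = hrow_a r - hrow_b r.
Proof. by rewrite /hrow_size /cells card_fseq undup_id ?iota_uniq // size_iota; lia. Qed.

Lemma row_meetE (r r' : hrow) :
  row_meet r r' = if hrow_b r <= hrow_b r' then minn (hrow_a r) (hrow_a r') - hrow_b r'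
                  else minn (hrow_a r) (hrow_a r').+1 - hrow_b r.
Proof.
rewrite /row_meet /hrow_l /cells /cell_seq; case: leqP => h; rewrite card_iota /=; lia.
Qed.

Local Open Scope ring_scope.

(** The shift [eps] of the row positions is [1 / n.+1], cleared of denominators. *)
Definition strip_pos (i : 'I_n) : int := n.+1%:Z * (hrow_b (tnth lam i))%:Z + (i : nat)%:Z.

Lemma strip_inj i j : (n.+1%:Z %| strip_pos i - strip_pos j)%Z -> i = j.
Proof.
case/dvdzP => c; rewrite /strip_pos => e; apply: val_inj => /=.
have := ltn_ord i; have := ltn_ord j => hj hi.
have : c - (hrow_b (tnth lam i))%:Z + (hrow_b (tnth lam j))%:Z = 0 by nia.
by nia.
Qed.

Definition strip_alcove : alcove n := @Alcove n n.+1%:Z strip_pos isT strip_inj.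

Lemma fl_strip (i j : 'I_n) : (i < j)%N ->
  fl strip_alcove j i = (hrow_b (tnth lam j))%:Z - (hrow_b (tnth lam i))%:Z.
Proof.
move=> ij; apply: (@fl_unique _ _ _ _ _ ((j : nat)%:Z - (i : nat)%:Z)).
  by rewrite /= /strip_pos; lia.
by have := ltn_ord j; rewrite /=; lia.
Qed.

Lemma meet_strip (i j : 'I_n) : (i < j)%N ->
  weight sizes strip_alcove i j = (row_meet (tnth lam i) (tnth lam j))%:Z.
Proof.
move=> ij; rewrite /weight fl_strip // /sizes !sizeE row_meetE /overlap.
have h1 := hrow_leP (tnth lam i); have h2 := hrow_leP (tnth lam j).
by case: leqP => h; lia.
Qed.

Lemma meet_eweight (i j : 'I_n) : i != j ->
  weight sizes strip_alcove i j = (eweight (Pi lam) i j)%:Z.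
Proof.
move=> ij; rewrite /=; case: (ltngtP i j) => h; first exact: meet_strip.
  by rewrite meet_sym // meet_strip.
by move: ij; rewrite (val_inj h) eqxx.
Qed.

Lemma inv_strip (T : filling n) : (forall i, size (tnth T i) = sizes i) ->
  ninv (fl strip_alcove) (tnth T) = inversions lam T.
Proof.
move=> hT; rewrite /ninv /inversions.
pose g i j := inter (fl strip_alcove j i) (tnth T i) (tnth T j).
have split2 (h : 'I_n -> 'I_n -> nat) : (forall i, h i i = 0%N) ->
   (\sum_(i : 'I_n) \sum_(j : 'I_n) h i j = \sum_(i : 'I_n) \sum_(j : 'I_n | i < j) (h i j + h j i))%N.
  move=> h0; under [RHS]eq_bigr do rewrite big_split /=.
  rewrite big_split /= [X in _ = (_ + X)%N](exchange_big_dep predT) //= -big_split /=.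
  apply: eq_bigr => i _; rewrite (bigD1 i) //= h0 add0n.
  rewrite (bigID (fun j : 'I_n => (i < j)%N)) /=; congr (_ + _)%N; apply: eq_bigl => j.
    by case: (ltngtP i j) => // ; rewrite ?andbF // andbT => hij; rewrite neq_ltn hij orbT.
  by rewrite -leqNgt neq_ltn; case: (ltngtP i j).
rewrite (split2 g) => [|i]; last by rewrite /g fl_ii inter_self.
apply: eq_bigr => i _; apply: eq_bigr => j ij; rewrite /g /inter.
have e (r : hrow) (h : nat -> nat) : (\sum_(u <- cell_seq r) h u = \sum_(u < hrow_size r) h ((hrow_b r).+1 + u)%N)%N.
  rewrite /cell_seq sizeE -[X in index_iota X _]add0n.
  have -> : (hrow_a r).+1 = (hrow_a r - hrow_b r + (hrow_b r).+1)%N by have := hrow_leP r; lia.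
  by rewrite big_addn addnK big_mkord; apply: eq_bigr => u _; rewrite addnC.
rewrite e; rewrite !hT [X in (_ + X)%N]exchange_big /= -big_split /=; apply: eq_bigr => u _.
rewrite e -big_split /=; apply: eq_bigr => v _.
rewrite /inversion /entry /content fl_strip // (fl_anti strip_alcove (_ : i != j)) ?fl_strip //; last first.
  by rewrite neq_ltn ij.
rewrite !addKn !addSn /=.
set a := nth _ _ _; set b := nth _ _ _.
set bi := hrow_b (tnth lam i); set bj := hrow_b (tnth lam j).
have e1 : (bj%:Z - bi%:Z + (v : nat)%:Z - (u : nat)%:Z == 0) = (bi + u == bj + v)%N.
  by apply/eqP/eqP; lia.
have e2 : (-1 - (bj%:Z - bi%:Z) + (u : nat)%:Z - (v : nat)%:Z == 0) = (bi + u == (bj + v).+1)%N.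
  by apply/eqP/eqP; lia.
rewrite e1 e2; case: eqP => [->|_]; case: eqP => // h /=; last by rewrite ?addn0 ?add0n ?orbF.
  by lia.
Qed.

Definition to_filling vmax smax (T : {ffun 'I_n -> frow vmax smax}) : filling n := [tuple val (T i) | i < n].

Lemma to_filling_inj vmax smax : injective (@to_filling vmax smax).
Proof.
move=> T T' e; apply/ffunP => i; apply: val_inj.
by have := congr1 (fun t => tnth t i) e; rewrite !tnth_mktuple.
Qed.

Lemma code_nth K r : code K r = (\sum_(u < size r) K ^ nth 0%N r u)%N.
Proof. by rewrite /code (big_nth 0%N) big_mkord. Qed.

Lemma code_flatten K (t : filling n) : code K (flatten t) = (\sum_i \sum_(u < size (tnth t i)) K ^ nth 0%N (tnth t i) u)%N.
Proof.
rewrite {1}/code big_flatten /= big_tuple; apply: eq_bigr => i _; exact: code_nth.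
Qed.

Lemma wtE vmax smax K (T : {ffun 'I_n -> frow vmax smax}) f :
  wt ('X%:P : {poly {poly int}}) (fun v => 'X^(K ^ v)) f (fun h => val (T h)) =
  ('X^(ninv f (tnth (to_filling T))))%:P * 'X^(code K (flatten (to_filling T))).
Proof.
rewrite /wt mulrC polyC_exp; congr (_ ^+ _ * _).
  by apply: eq_bigr => a _; apply: eq_bigr => b _; rewrite !tnth_mktuple.
rewrite code_flatten (big_morph _ (exprD 'X) (expr0 'X)); apply: eq_bigr => h _.
by rewrite tnth_mktuple (big_morph _ (exprD 'X) (expr0 'X)).
Qed.

(** Kronecker substitution of ['X^(K ^ v)] for [x_v]: the fillings have fewer than [K] entries, so
    [code K] determines their monomials and the coefficient of [alpha] can be read off. *)
Lemma LLT_coef (alpha : monomial) (vmax smax K : nat) :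
  (forall v, v \in alpha -> (v <= vmax)%N) -> (\sum_i sizes i <= smax)%N -> (smax < K)%N ->
  (size (enum_mset alpha) < K)%N ->
  LLT lam alpha = (llt_sum ('X%:P : {poly {poly int}}) vmax smax (fun v => 'X^(K ^ v)) sizes
     (fl strip_alcove))`_(code K (enum_mset alpha)).
Proof.
move=> hB hS hK ha.
have sS i : (sizes i <= smax)%N by apply: leq_trans hS; rewrite (bigD1 i) //= leq_addr.
pose ok (T : {ffun 'I_n -> frow vmax smax}) := [forall h, size (val (T h)) == sizes h].
pose good T := ok T && perm_eq (flatten (to_filling T)) (enum_mset alpha).
have ok_size T : ok T -> forall i, size (tnth (to_filling T) i) = sizes i.
  by move=> /forallP h i; rewrite tnth_mktuple; apply/eqP.
have size_flat T : ok T -> (size (flatten (to_filling T)) < K)%N.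
  move=> h; apply: leq_ltn_trans hK; apply: leq_trans hS.
  rewrite size_flatten /shape sumnE big_map big_tuple.
  by rewrite (eq_bigr sizes) // => i _; exact: ok_size.
rewrite /llt_sum coef_sum.
have -> : \sum_(T | ok T) (wt ('X%:P : {poly {poly int}}) (fun v => 'X^(K ^ v))
    (fl strip_alcove) (fun h => val (T h)))`_(code K (enum_mset alpha)) =
  \sum_(T | good T) ('X^(inversions lam (to_filling T)) : {poly int}).
  rewrite [RHS]big_mkcondr /=; apply: eq_bigr => T hT.
  rewrite wtE coefCM coefXn inv_strip; last exact: ok_size.
  case: (boolP (perm_eq _ _)) => hp.
    by rewrite /code (perm_big _ hp) eqxx mulr1.
  rewrite (_ : (_ == _) = false) ?mulr0 //; apply: contraNF hp => /eqP e.
  by apply: code_inj (esym e) => //; exact: size_flat.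
have -> : \sum_(T | good T) ('X^(inversions lam (to_filling T)) : {poly int}) =
   \sum_(t <- [seq to_filling T | T <- enum good]) 'X^(inversions lam t).
  by rewrite big_map big_enum.
rewrite fsbig_seq; last by rewrite map_inj_uniq ?enum_uniq //; exact: to_filling_inj.
suff eS : [set t : filling n | SSYT lam t /\ filling_monomial t = alpha]%classic =
    [set` [seq to_filling T | T <- enum good]]%classic by rewrite /LLT eS.
apply/seteqP; split=> t /=.
  move=> [st et].
  have pa : perm_eq (flatten t) (enum_mset alpha).
    by rewrite -et perm_sym; exact: perm_eq_seq_mset.
  have mem i : tnth t i \in allrows vmax smax.
    have /and3P[/eqP h1 h2 h3] := st i.
    apply: (mem_allrows (sS i)); rewrite mem_rows h1 eqxx h3 andbT /=.
    apply/allP => v hv; rewrite (allP h2) //= hB //.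
    rewrite -(perm_mem pa); apply/flattenP; exists (tnth t i) => //; exact: mem_tnth.
  have e : t = to_filling [ffun i => SeqSub (mem i)].
    by apply: eq_from_tnth => i; rewrite tnth_mktuple ffunE.
  rewrite e; apply: map_f; rewrite mem_enum /in_mem /= /good -e pa andbT.
  by apply/forallP => i; rewrite ffunE /=; have /and3P[] := st i.
case/mapP => T; rewrite mem_enum /in_mem /= => /andP[h1 h2] ->; split.
  move=> i; have := ok_size T h1 i; rewrite tnth_mktuple /semistandard => e.
  have := allrows_sub (valP (T i)); rewrite mem_rows e => /and3P[_ h3 h4].
  rewrite eqxx h4 andbT /=; apply: sub_all h3 => v; lia.
by rewrite /filling_monomial -[RHS]seq_mset_id; apply/eq_seq_msetP.
Qed.

End Link.

Theorem theorem2p7 (n m : nat) (lam : hstrip n) (mu : hstrip m) :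
  wgraph_iso (Pi lam) (Pi mu) -> LLT lam = LLT mu.
Proof.
case=> phi [bphi hv he]; have enm : n = m.
  by have := bij_eq_card bphi; rewrite !card_ord.
subst m; have inj : injective phi := bij_inj bphi.
have hs : sizes lam =1 (fun i => sizes mu (phi i)) by move=> i; exact: hv.
have esum : (\sum_i sizes mu i = \sum_i sizes lam i)%N.
  by rewrite (reindex_inj inj); apply: eq_bigr => i _; rewrite hs.
apply/funext => alpha.
pose vmax := \max_(v <- enum_mset alpha) v; pose smax := (\sum_i sizes lam i)%N.
pose K := (smax + size (enum_mset alpha)).+1.
have hB v : v \in alpha -> v <= vmax by move=> hv'; apply: leq_bigmax_seq.
rewrite (@LLT_coef _ lam alpha vmax smax K) ?(@LLT_coef _ mu alpha vmax smax K) ?esum //; try by rewrite /K; lia.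
have hM : same_graph (sizes lam) (strip_alcove lam) (relabel (strip_alcove mu) inj).
  move=> i j ij; rewrite meet_eweight // he -meet_eweight ?(inj_eq inj) //.
  by rewrite /weight fl_relabel !hs.
have q0 : ('X%:P : {poly {poly int}})%R != 0%R by rewrite polyC_eq0 polyX_eq0.
rewrite (F_graph vmax _ q0 (leqnn smax) hM).
by rewrite -(F_relabel _ _ _ _ (sizes mu) _ inj) (F_sizes _ _ _ _ _ hs).
Qed.
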